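(* Let $\nu$ be a dominant cocharacter of $G_{\bar{\mathbb{F}}_p}$, where $G=\mathrm{Res}_{k/\mathbb{F}_p}\mathrm{GL}_2$, and let $A\in LG(\bar{\mathbb{F}}_p)=\mathrm{GL}_2((\bar{\mathbb{F}}_p\otimes_{\mathbb{F}_p}k)((u)))$ be such that the rank $2$ étale $\varphi$-module $(N,\Phi_A)=((\bar{\mathbb{F}}_p\otimes_{\mathbb{F}_p}k)((u))^2,\ A\varphi)$ is simple, i.e. has no proper nonzero $\Phi_A$-stable sub-$(\bar{\mathbb{F}}_p\otimes_{\mathbb{F}_p}k)((u))$-module. Then the Kisin variety $C_\nu(A)$ is geometrically connected.
   Context: Let $p$ be a prime ($p=2$ allowed), $k$ a finite field of characteristic $p$, $n=[k:\mathbb{F}_p]$, and $\bar{\mathbb{F}}_p$ an algebraic closure of $\mathbb{F}_p$. Let $G=\mathrm{Res}_{k/\mathbb{F}_p}\mathrm{GL}_2$, with an identification $G_{\bar{\mathbb{F}}_p}\cong\prod_{i=1}^n(\mathrm{GL}_2)_{\bar{\mathbb{F}}_p}$ and the Borel subgroup of upper triangular matrices in each factor. $LG(R)=G(R((u)))$ and $L^+G(R)=G(R[[u]])$ are the loop group and positive loop group, and $\mathcal{F}_G=LG/L^+G$ is the affine Grassmannian; its $\bar{\mathbb{F}}_p$-points are the lattices $g\,(\bar{\mathbb{F}}_p\otimes_{\mathbb{F}_p}k)[[u]]^2\subset(\bar{\mathbb{F}}_p\otimes_{\mathbb{F}_p}k)((u))^2$, $g\in LG(\bar{\mathbb{F}}_p)$.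 The endomorphism $\varphi$ of $(\bar{\mathbb{F}}_p\otimes_{\mathbb{F}_p}k)((u))$ is the identity on $\bar{\mathbb{F}}_p$, the absolute Frobenius on $k$, and sends $u$ to $u^p$. $\Phi_A$ is the $\varphi$-semilinear map $v\mapsto A\varphi(v)$, with $\varphi$ applied coordinatewise. A dominant cocharacter $\nu$ is an $n$-tuple of cocharacters $t\mapsto\mathrm{diag}(t^{\alpha_i},t^{\beta_i})$ with integers $\alpha_i\ge\beta_i$. For dominant $\nu,\nu'$, one writes $\nu'\le\nu$ if $\alpha'_i+\beta'_i=\alpha_i+\beta_i$ and $\alpha'_i-\beta'_i\le\alpha_i-\beta_i$ for all $i$. $u^{\nu'}\in LG(\bar{\mathbb{F}}_p)$ is the image of $u$ under $\nu'$. The Kisin variety $C_\nu(A)$ is the reduced projective closed subscheme of $\mathcal{F}_G\otimes\bar{\mathbb{F}}_p$ with $\bar{\mathbb{F}}_p$-points $$\{g(\bar{\mathbb{F}}_p\otimes_{\mathbb{F}_p}k)[[u]]^2\ :\ g^{-1}A\varphi(g)\in L^+G(\bar{\mathbb{F}}_p)\,u^{\nu'}L^+G(\bar{\mathbb{F}}_p)\ \text{for some dominant }\nu'\le\nu\}.$$ If $\nu$ and $A$ are defined over a finite subfield $\mathbb{F}\subset\bar{\mathbb{F}}_p$, then $C_\nu(A)$ is defined as a reduced projective variety over $\mathbb{F}$ with these $\bar{\mathbb{F}}_p$-points, and geometrically connected means connected after base change to $\bar{\mathbb{F}}_p$. The empty scheme is regarded as connected. *)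

(* Defs.v *)
From HB Require Import structures.
From mathcomp Require Import all_boot all_order all_algebra all_field.
From mathcomp Require Import zify.
From mathcomp Require Import all_classical topology.
From mathcomp Require Import -(notations) mpoly.

Set Implicit Arguments.
Unset Strict Implicit.
Unset Printing Implicit Defensive.

Import Order.TTheory GRing.Theory Num.Theory.
Local Open Scope classical_set_scope.
Local Open Scope ring_scope.

(* [laurent R] is R((u)): the functions int -> R, j |-> coefficient of u^j,
   that vanish below some index; products are convolutions. *)

Section Laurent.
Variable R : comNzRingType.

Definition bounded_below (f : int -> R) : Prop :=
  exists N : int, forall j : int, j < N -> f j = 0.

Record laurent := Laurent {
  lcoef : int -> R;
  lcoef_bounded : `[< bounded_below lcoef >] }.

HB.instance Definition _ := [isSub for lcoef].
HB.instance Definition _ := [Choice of laurent by <:].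

Implicit Types f g h : laurent.

Lemma laurentP f g : (forall j, lcoef f j = lcoef g j) -> f = g.
Proof. by move=> fg; apply/val_inj/funext. Qed.

Lemma lcoef_bound f :
  exists N : nat, forall j : int, j < - N%:Z -> lcoef f j = 0.
Proof.
have /asboolP[N fN] := lcoef_bounded f.
by exists `|N|%N => j jN; apply: fN; lia.
Qed.

Definition lmono_fun (a : int) (j : int) : R := (j == a)%:R.

Lemma lmono_bounded a : `[< bounded_below (lmono_fun a) >].
Proof.
by apply/asboolP; exists a => j; rewrite /lmono_fun; case: eqP => // ->; lia.
Qed.

(* u^a *)
Definition lmono (a : int) : laurent := Laurent (lmono_bounded a).

Definition lmul_fun (f g : laurent) (j : int) : R :=
  \sum_(i \in [set: int]) lcoef f i * lcoef g (j - i).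

Lemma lmul_fun_low f g (N M : nat) (j : int) :
    (forall i, i < - N%:Z -> lcoef f i = 0) ->
    (forall i, i < - M%:Z -> lcoef g i = 0) ->
  j < - N%:Z - M%:Z -> lmul_fun f g j = 0.
Proof.
move=> fN gM jNM; rewrite /lmul_fun fsbig1// => i _.
have [iN|iN] := ltP i (- N%:Z); first by rewrite fN ?mul0r.
by rewrite gM ?mulr0//; lia.
Qed.

Definition lpoly (K : nat) (N : nat) f : {poly R} :=
  \poly_(s < K) lcoef f (s%:Z - N%:Z).

Lemma lmul_funE f g (N M K m : nat) :
    (forall i, i < - N%:Z -> lcoef f i = 0) ->
    (forall i, i < - M%:Z -> lcoef g i = 0) -> (m < K)%N ->
  lmul_fun f g (m%:Z - N%:Z - M%:Z) = (lpoly K N f * lpoly K M g)`_m.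
Proof.
move=> fN gM mK; rewrite /lmul_fun coefM.
pose r := [seq s%:Z - N%:Z | s <- iota 0 m.+1].
rewrite -(fsbig_widen [set` r])//=; last first.
  move=> i [_ /= ri]; apply/eqP; move: ri; have [iN|iN] := ltP i (- N%:Z).
    by rewrite fN ?mul0r.
  have [mi|mi] := ltP (m%:Z - N%:Z) i; first by rewrite gM ?mulr0//; lia.
  case; apply/mapP; exists (absz (i + N%:Z)); last by lia.
  by rewrite mem_iota; lia.
rewrite -fsbig_seq; last first.
  by rewrite map_inj_uniq ?iota_uniq// => a b; lia.
rewrite big_map -[iota 0 m.+1]/(index_iota 0 m.+1) big_mkord; apply: eq_bigr => s _.
have sm := ltn_ord s.
rewrite !coef_poly !ifT; [|lia|lia].
by congr (_ * lcoef g _); lia.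
Qed.

Lemma lmul_bounded f g : `[< bounded_below (lmul_fun f g) >].
Proof.
have [[N fN] [M gM]] := (lcoef_bound f, lcoef_bound g).
apply/asboolP; exists (- N%:Z - M%:Z) => j; exact: lmul_fun_low.
Qed.

Definition lmul f g : laurent := Laurent (lmul_bounded f g).

Lemma lzero_bounded : `[< bounded_below (fun=> 0) >].
Proof. by apply/asboolP; exists 0. Qed.

Lemma lopp_bounded f : `[< bounded_below (fun j => - lcoef f j) >].
Proof.
have /asboolP[N fN] := lcoef_bounded f.
by apply/asboolP; exists N => j /fN ->; rewrite oppr0.
Qed.

Lemma ladd_bounded f g :
  `[< bounded_below (fun j => lcoef f j + lcoef g j) >].
Proof.
have [[N fN] [M gM]] := (lcoef_bound f, lcoef_bound g).
apply/asboolP; exists (- N%:Z - M%:Z) => j jNM.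
by rewrite fN ?gM ?addr0//; lia.
Qed.

Definition lzero : laurent := Laurent lzero_bounded.
Definition lopp f : laurent := Laurent (lopp_bounded f).
Definition ladd f g : laurent := Laurent (ladd_bounded f g).

Lemma laddA : associative ladd.
Proof. by move=> f g h; apply: laurentP => j /=; rewrite addrA. Qed.
Lemma laddC : commutative ladd.
Proof. by move=> f g; apply: laurentP => j /=; rewrite addrC. Qed.
Lemma ladd0 : left_id lzero ladd.
Proof. by move=> f; apply: laurentP => j /=; rewrite add0r. Qed.
Lemma laddN : left_inverse lzero lopp ladd.
Proof. by move=> f; apply: laurentP => j /=; rewrite addNr. Qed.

HB.instance Definition _ := GRing.isZmodule.Build laurent laddA laddC ladd0 laddN.

Lemma int_shiftP (N : nat) (j : int) :
  (exists m : nat, j = m%:Z - N%:Z) \/ (j < - N%:Z).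
Proof.
have [jN|jN] := ltP j (- N%:Z); [by right | left].
by exists (absz (j + N%:Z)); lia.
Qed.

Lemma lmulA : associative lmul.
Proof.
move=> f g h; apply: laurentP => j /=.
have [[N fN] [M gM] [L hL]] := And3 (lcoef_bound f) (lcoef_bound g) (lcoef_bound h).
have fgB i : i < - (N + M)%N%:Z -> lcoef (lmul f g) i = 0.
  by move=> iNM; apply: lmul_fun_low fN gM _; lia.
have ghB i : i < - (M + L)%N%:Z -> lcoef (lmul g h) i = 0.
  by move=> iML; apply: lmul_fun_low gM hL _; lia.
have [[m jm]|jNML] := int_shiftP (N + M + L) j; last first.
  by rewrite (lmul_fun_low fN ghB) ?(lmul_fun_low fgB hL)//; lia.
have -> : j = m%:Z - N%:Z - (M + L)%N%:Z by lia.
rewrite (lmul_funE fN ghB (ltnSn m)).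
have -> : m%:Z - N%:Z - (M + L)%N%:Z = m%:Z - (N + M)%N%:Z - L%:Z by lia.
rewrite (lmul_funE fgB hL (ltnSn m)).
have E1 s : (s < m.+1)%N ->
    (lpoly m.+1 (M + L) (lmul g h))`_s = (lpoly m.+1 M g * lpoly m.+1 L h)`_s.
  move=> sm; rewrite -(lmul_funE gM hL sm) coef_poly sm /=.
  by congr (lmul_fun _ _ _); lia.
have E2 s : (s < m.+1)%N ->
    (lpoly m.+1 (N + M) (lmul f g))`_s = (lpoly m.+1 N f * lpoly m.+1 M g)`_s.
  move=> sm; rewrite -(lmul_funE fN gM sm) coef_poly sm /=.
  by congr (lmul_fun _ _ _); lia.
transitivity (lpoly m.+1 N f * (lpoly m.+1 M g * lpoly m.+1 L h))`_m.
  by rewrite !coefM; apply: eq_bigr => s _; rewrite E1 -?coefM// ltnS leq_subr.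
by rewrite mulrA coefM [RHS]coefM; apply: eq_bigr => s _; rewrite E2.
Qed.

Lemma lmulC : commutative lmul.
Proof.
move=> f g; apply: laurentP => j /=.
have [[N fN] [M gM]] := (lcoef_bound f, lcoef_bound g).
have [[m jm]|jNM] := int_shiftP (N + M) j; last first.
  by rewrite (lmul_fun_low fN gM) ?(lmul_fun_low gM fN)//; lia.
have -> : j = m%:Z - N%:Z - M%:Z by lia.
rewrite (lmul_funE fN gM (ltnSn m)) mulrC -(lmul_funE gM fN (ltnSn m)).
by congr (lmul_fun _ _ _); lia.
Qed.

Lemma lmul1 : left_id (lmono 0) lmul.
Proof.
move=> f; apply: laurentP => j /=; rewrite /lmul_fun.
rewrite -(fsbig_widen [set (0 : int)])//=.
  by rewrite fsbig_set1 /= /lmono_fun eqxx mul1r subr0.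
move=> i [_ /= /eqP i0]; rewrite /lmono_fun (negbTE i0) mul0r//.
Qed.

Lemma lmulDl : left_distributive lmul +%R.
Proof.
move=> f g h; apply: laurentP => j /=.
have [[N0 fN0] [M0 gM0] [L hL]] :=
  And3 (lcoef_bound f) (lcoef_bound g) (lcoef_bound h).
pose N := (N0 + M0)%N.
have fN i : i < - N%:Z -> lcoef f i = 0 by move=> iN; apply: fN0; lia.
have gN i : i < - N%:Z -> lcoef g i = 0 by move=> iN; apply: gM0; lia.
have fgN i : i < - N%:Z -> lcoef (f + g) i = 0.
  by move=> iN /=; rewrite fN ?gN ?addr0.
have [[m jm]|jNL] := int_shiftP (N + L) j; last first.
  rewrite (lmul_fun_low fgN hL) ?(lmul_fun_low fN hL) ?(lmul_fun_low gN hL);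
    by rewrite ?addr0//; lia.
have -> : j = m%:Z - N%:Z - L%:Z by lia.
rewrite (lmul_funE fgN hL (ltnSn m)) (lmul_funE fN hL (ltnSn m)).
rewrite (lmul_funE gN hL (ltnSn m)) -coefD -mulrDl.
rewrite !coefM; apply: eq_bigr => s _; congr (_ * _).
by rewrite coefD !coef_poly; case: ifP => //=; rewrite ?addr0.
Qed.

Lemma lone_neq0 : lmono 0 != lzero.
Proof.
apply/eqP => /(congr1 (fun f => lcoef f 0)) /eqP /=.
by rewrite /lmono_fun eqxx oner_eq0.
Qed.

HB.instance Definition _ :=
  GRing.Zmodule_isComNzRing.Build laurent lmulA lmulC lmul1 lmulDl lone_neq0.

Definition lunit : {pred laurent} := fun f => `[< exists g, g * f = 1 >].

Definition linv f : laurent :=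
  if pselect (exists g, g * f = 1) is left e then projT1 (cid e) else f.

Lemma lmulV : {in lunit, left_inverse 1 linv *%R}.
Proof.
move=> f /asboolP fU; rewrite /linv; case: pselect => // e; by case: cid.
Qed.

Lemma lunitP f g : g * f = 1 -> lunit f.
Proof. by move=> gf; apply/asboolP; exists g. Qed.

Lemma linv_out : {in [predC lunit], linv =1 id}.
Proof. by move=> f /asboolPn fU; rewrite /linv; case: pselect. Qed.

HB.instance Definition _ :=
  GRing.ComNzRing_hasMulInverse.Build laurent lmulV lunitP linv_out.

(* f lies in u^a R[[u]] *)
Definition lval_ge (a : int) (f : laurent) : Prop :=
  forall j : int, j < a -> lcoef f j = 0.

(* L^+G as a subset of LG = GL_2(R((u))) *)
Definition GL2_integral (g : 'M[laurent]_2) : Prop :=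
  [/\ g \in unitmx, forall i j, lval_ge 0 (g i j)
    & forall i j, lval_ge 0 (invmx g i j)].

(* u^a R[[u]]^2 *)
Definition std_lattice (a : int) : set 'cV[laurent]_2 :=
  [set v | forall i, lval_ge a (v i 0)].

(* g R[[u]]^2 *)
Definition lattice (g : 'M[laurent]_2) : set 'cV[laurent]_2 :=
  [set g *m v | v in std_lattice 0].

Definition submodule (M : set 'cV[laurent]_2) : Prop :=
  [/\ M 0, forall v w, M v -> M w -> M (v + w)
    & forall a v, M v -> M (a *: v)].

End Laurent.

Arguments std_lattice R a : clear implicits.

Section LaurentMap.
Variables R S : comNzRingType.

Lemma lmap_bounded (h : {rmorphism R -> S}) (f : laurent R) :
  `[< bounded_below (fun j => h (lcoef f j)) >].
Proof.
have /asboolP[N fN] := lcoef_bounded f.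
by apply/asboolP; exists N => j /fN ->; rewrite rmorph0.
Qed.

Definition lmap (h : {rmorphism R -> S}) (f : laurent R) : laurent S :=
  Laurent (lmap_bounded h f).

End LaurentMap.

Section LaurentFrobenius.
Variables (p : nat) (R : comNzRingType) (phi : {rmorphism R -> R}).

Definition lfrob_fun (f : laurent R) (j : int) : R :=
  if (p%:Z %| j)%Z then phi (lcoef f (j %/ p%:Z)%Z) else 0.

Lemma lfrob_bounded f : `[< bounded_below (lfrob_fun f) >].
Proof.
have [N fN] := lcoef_bound f.
apply/asboolP; exists (- (p%:Z * N%:Z)) => j jN; rewrite /lfrob_fun.
case: ifP => // /dvdzP[q jq]; rewrite fN ?rmorph0//.
move: jN; rewrite jq; case: (posnP p) => [->|p0]; first by rewrite mulr0; lia.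
by rewrite mulzK; nia.
Qed.

(* sum_j a_j u^j |-> sum_j phi(a_j) u^(p j) *)
Definition lfrob (f : laurent R) : laurent R := Laurent (lfrob_bounded f).

(* (R((u))^2, A phi) has no proper nonzero sub-R((u))-module stable under
   v |-> A phi(v) *)
Definition simple_phi_module (A : 'M[laurent R]_2) : Prop :=
  forall M : set 'cV[laurent R]_2, submodule M ->
    (forall v, M v -> M (A *m map_mx lfrob v)) ->
    M = [set 0] \/ M = [set: 'cV[laurent R]_2].

End LaurentFrobenius.

Definition is_algebraic_closure_Fp (p : nat) (F : closedFieldType)
    (Fp : p \in [pchar F]) : Prop :=
  forall x : pPrimeCharType Fp, algebraicOver (in_alg (pPrimeCharType Fp)) x.

(* [k : F_p] *)
Definition degree_Fp (p : nat) (k : finFieldType) (kp : p \in [pchar k]) : nat :=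
  \dim {: pPrimeCharType kp}.

(* T, with the maps iF and iK, is the tensor product of F and K over F_p, for
   F and K of characteristic p: it is their coproduct among commutative
   F_p-algebras, and all ring morphisms between F_p-algebras are
   F_p-linear. *)
Definition is_tensor_product (F K T : comNzRingType)
    (iF : {rmorphism F -> T}) (iK : {rmorphism K -> T}) : Prop :=
  forall (S : comNzRingType) (f : {rmorphism F -> S}) (g : {rmorphism K -> S}),
    (exists h : {rmorphism T -> S}, h \o iF =1 f /\ h \o iK =1 g) /\
    (forall h1 h2 : {rmorphism T -> S},
       h1 \o iF =1 h2 \o iF -> h1 \o iK =1 h2 \o iK -> h1 =1 h2).

(* the coefficient Frobenius of F (x) k: identity on F, absolute Frobenius
   on k *)
Definition is_coef_frobenius (p : nat) (F K T : comNzRingType)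
    (iF : {rmorphism F -> T}) (iK : {rmorphism K -> T})
    (phi : {rmorphism T -> T}) : Prop :=
  (forall x, phi (iF x) = iF x) /\ (forall y, phi (iK y) = iK (y ^+ p)).

(* The theta i are the components of an isomorphism of F-algebras T ~ F^n;
   it induces the identification of G over F with a product of n copies of
   GL_2. *)
Definition is_identification (n : nat) (F T : comNzRingType)
    (iF : {rmorphism F -> T}) (theta : 'I_n -> {rmorphism T -> F}) : Prop :=
  (forall i x, theta i (iF x) = x) /\
  bijective (fun t : T => [ffun i => theta i t]).

(* nu i = (alpha_i, beta_i) stands for t |-> diag(t^alpha_i, t^beta_i) *)
Definition cocharacter (n : nat) := 'I_n -> int * int.

Definition dominant (n : nat) (nu : cocharacter n) : Prop :=
  forall i, (nu i).2 <= (nu i).1.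

Definition cochar_le (n : nat) (nu' nu : cocharacter n) : Prop :=
  forall i, (nu' i).1 + (nu' i).2 = (nu i).1 + (nu i).2 /\
            (nu' i).1 - (nu' i).2 <= (nu i).1 - (nu i).2.

(* The F-points of the affine Grassmannian. The parameter theta only serves to
   attach the Zariski topology below to the type. *)
Record affgr (n : nat) (F T : comNzRingType)
    (theta : 'I_n -> {rmorphism T -> F}) := AffGr {
  affgr_set : set 'cV[laurent T]_2;
  affgr_lattice :
    exists2 g : 'M[laurent T]_2, g \in unitmx & affgr_set = lattice g }.

Section AffineGrassmannian.
Variables (n : nat) (F : fieldType) (T : comNzRingType).
Variable theta : 'I_n -> {rmorphism T -> F}.

Definition diag_upow (ab : int * int) : 'M[laurent F]_2 :=
  \matrix_(i, j) (if i == j then lmono F (if i == 0 then ab.1 else ab.2) else 0).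

(* U = u^nu in GL_2(T((u))) *)
Definition is_upow (nu : cocharacter n) (U : 'M[laurent T]_2) : Prop :=
  forall i, map_mx (lmap (theta i)) U = diag_upow (nu i).

HB.instance Definition _ := gen_eqMixin (affgr theta).
HB.instance Definition _ := gen_choiceMixin (affgr theta).

(* Zariski topology. The affine Grassmannian is the increasing union of the
   closed subvarieties [truncated N], the lattices L such that
   u^N T[[u]]^2 <= L <= u^-N T[[u]]^2. Through L |-> L / u^N T[[u]]^2 these are
   closed in the disjoint union over d of the Grassmannians of d-dimensional
   F-subspaces of V_N = u^-N T[[u]]^2 / u^N T[[u]]^2, and the latter carry the
   topology defined by homogeneous polynomials in the Pluecker coordinates. *)

Definition truncated (N : nat) : set (affgr theta) :=
  [set L : affgr theta | std_lattice T N%:Z `<=` affgr_set L /\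
                   affgr_set L `<=` std_lattice T (- N%:Z)].

(* dim_F V_N = #|coord_index N|; the coordinate (r, i, s) of v is the i-th
   component of the coefficient of u^(s - N) in the r-th entry of v *)
Definition coord_index (N : nat) := ('I_2 * 'I_n * 'I_(N + N))%type.
Definition vdim (N : nat) : nat := #|{: coord_index N}|.

Definition coords (N : nat) (v : 'cV[laurent T]_2) : 'rV[F]_(vdim N) :=
  \row_j (let x : coord_index N := enum_val j in
          theta x.1.2 (lcoef (v x.1.1 0) ((x.2 : nat)%:Z - N%:Z))).

(* the rows of B form a basis of L / u^N T[[u]]^2 in V_N *)
Definition is_basis (N d : nat) (L : affgr theta) (B : 'M[F]_(d, vdim N)) : Prop :=
  row_free B /\
  forall w : 'rV[F]_(vdim N), (w <= B)%MS <-> exists2 v, affgr_set L v & coords N v = w.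

(* Minors are indexed by all d-tuples of columns rather than by the
   increasing ones; the additional ones are zero or repeat others up to
   sign. *)
Definition plucker_index (N d : nat) := {ffun 'I_d -> 'I_(vdim N)}.
Definition plucker_dim (N d : nat) : nat := #|{: plucker_index N d}|.

Definition plucker (N d : nat) (B : 'M[F]_(d, vdim N)) (J : 'I_(plucker_dim N d)) : F :=
  \det (colsub (enum_val J) B).

(* The locus P_d <> 0 in each Grassmannian of d-dimensional subspaces. As P_d
   is homogeneous, the condition does not depend on the basis B. *)
Definition basic_open (N : nat)
    (P : forall d, mpoly (plucker_dim N d) F) : set (affgr theta) :=
  [set L | forall d (B : 'M[F]_(d, vdim N)),
     is_basis L B -> meval (plucker B) (P d) != 0].

Definition zariski_open (U : set (affgr theta)) : Prop :=
  forall (N : nat) (L : affgr theta), truncated N L -> U L ->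
    exists P : forall d, mpoly (plucker_dim N d) F,
      [/\ forall d, exists e : nat, P d \is ishomog1 e mdeg,
          basic_open P L & truncated N `&` basic_open P `<=` U].

Lemma zariski_openT : zariski_open setT.
Proof.
move=> N L _ _; exists (fun d => 1); split=> //.
  by move=> d; exists 0%N; exact: dhomog1.
by move=> d B _; rewrite meval1 oner_neq0.
Qed.

Lemma zariski_openI : setI_closed zariski_open.
Proof.
move=> U V Uo Vo N L LN [LU LV].
have [P [Ph LP PU]] := Uo N L LN LU; have [Q [Qh LQ QV]] := Vo N L LN LV.
exists (fun d => P d * Q d); split.
- move=> d; have [e Pe] := Ph d; have [e' Qe'] := Qh d.
  by exists (e + e')%N; exact: dhomogM.
- by move=> d B BL; rewrite mevalM mulf_neq0 ?LP ?LQ.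
move=> L' [L'N PQ]; split.
  apply: PU; split=> // d B BL; apply: contra (PQ d B BL) => /eqP P0.
  by rewrite mevalM P0 mul0r.
apply: QV; split=> // d B BL; apply: contra (PQ d B BL) => /eqP Q0.
by rewrite mevalM Q0 mulr0.
Qed.

Lemma zariski_open_bigU (I : Type) (f : I -> set (affgr theta)) :
  (forall i, zariski_open (f i)) -> zariski_open (\bigcup_i f i).
Proof.
move=> fo N L LN [i _ Li]; have [P [Ph LP PU]] := fo i N L LN Li.
by exists P; split=> // L' /PU fL'; exists i.
Qed.

HB.instance Definition _ := isOpenTopological.Build (affgr theta)
  zariski_openT zariski_openI zariski_open_bigU.

(* The set of F-points of C_nu(A). *)
Definition kisin_variety (p : nat) (phi : {rmorphism T -> T})
    (nu : cocharacter n) (A : 'M[laurent T]_2) : set (affgr theta) :=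
  [set L | exists g : 'M[laurent T]_2,
     [/\ g \in unitmx, affgr_set L = lattice g &
         exists nu' : cocharacter n, [/\ dominant nu', cochar_le nu' nu &
           exists P U Q : 'M[laurent T]_2,
             [/\ GL2_integral P, is_upow nu' U, GL2_integral Q &
                 invmx g *m A *m map_mx (lfrob p phi) g = P *m U *m Q]]]].

End AffineGrassmannian.

Arguments kisin_variety {n F T} theta p phi nu A _.

(* Main.v *)
Require Import Defs.
From HB Require Import structures.
From mathcomp Require Import all_boot all_order all_algebra all_field.
From mathcomp Require Import all_classical topology.
From mathcomp Require Import all_fingroup zify ring.
From mathcomp Require Import -(notations) mpoly.

(** Why the Kisin variety is connected.

    The identification theta splits everything into factors. Put K = F((u)). A
    point is a family of lattices L_i in K^2, and the Frobenius becomes a cycle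
    of maps Phi_i from the i-th plane to the next one, which are additive and
    semilinear for the substitution u |-> u^p; they commute with scalars of F.
    The factors form a single cycle because N is simple. After a twist by
    powers of u, the Cartan decomposition shows that the family is a point of
    the Kisin variety iff Phi_i maps L_i into the next lattice for all i and
    the determinants of the L_i have prescribed valuations
    ([kisin_config_of], [kisin_of_config]).

    Each plane has its tree of lattices up to homothety. The composite Psi of
    the maps around the cycle of length n multiplies distances in the tree by
    q = p^n. Since N is simple, Psi stabilizes no line; by a Newton polygon
    argument ([companion_dichotomy]) it then fixes a point in the interior of
    an edge and exchanges the two sides of this point. The fixed points in all
    planes are encoded by additive norms w_i with w (Phi v) = p w v, for which
    multiplication by u adds e = q^2 - 1 ([system_norm]). Their values form two
    classes modulo e, exchanged by multiplication by q: the two sides.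

    Contraction: let L_j be a lattice that is not an end of the central edge,
    and M its neighbour towards the fixed point. If Phi maps the preceding
    lattice into u M, every neighbour of M may replace L_j as far as the
    condition at j is concerned. The condition at the next index may fail,
    unless the next lattice moves as well, and so on. The group SL_2(F) acts on
    the planes through the bases M, Phi M, Phi Phi M, ..., compatibly with the
    Phi_i, because Frobenius fixes F. The lattices which have to move are those
    branching off the image of M in the direction in which the image of L_j
    does; the first one that does not contains everything needed
    ([lattice_dichotomy]), and if there is none before the end of the cycle
    then the exchange of the two sides makes the condition at j hold
    ([follows_around]). So a whole SL_2(F)-orbit
    of configurations lies in the Kisin variety. The Weyl element brings L_j
    closer to the fixed point and moves no other lattice away from it
    ([contraction]). Elementary matrices trace affine lines, on which
    Pluecker coordinates are polynomials in the parameter; hence nonempty open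
    subsets of such a line meet ([line_opens_meet]) and no clopen subset
    separates two points of the orbit.

    A configuration that cannot be contracted satisfies a rigid recursion: the
    smallest norm a of L_i and the smallest norm a' of the next lattice verify
    a' = p a unless the next lattice is an end of the central edge. This cannot
    happen all around the cycle, since q a and a lie in different classes; so
    some lattice is an end of the central edge, hence known, and the recursion
    determines all the others ([minimal_unique]). All points of the Kisin
    variety are thus linked to a single one. *)

Set Implicit Arguments.
Unset Strict Implicit.
Unset Printing Implicit Defensive.

Import Order.TTheory GRing.Theory Num.Theory.
Local Open Scope classical_set_scope.
Local Open Scope ring_scope.

(** * Laurent series over a commutative ring *)

Section LaurentRing.
Variable R : comNzRingType.
Implicit Types f g : laurent R.

Lemma lcoefD f g j : lcoef (f + g) j = lcoef f j + lcoef g j.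
Proof. by []. Qed.

Lemma lcoefN f j : lcoef (- f) j = - lcoef f j.
Proof. by []. Qed.

Lemma lcoefB f g j : lcoef (f - g) j = lcoef f j - lcoef g j.
Proof. by []. Qed.

Lemma lcoef0 j : lcoef (0 : laurent R) j = 0.
Proof. by []. Qed.

Lemma lcoef1 j : lcoef (1 : laurent R) j = (j == 0)%:R.
Proof. by []. Qed.

Lemma lcoefMmono a f j : lcoef (lmono R a * f) j = lcoef f (j - a).
Proof.
rewrite -[LHS]/(lmul_fun _ _ _) /lmul_fun -(fsbig_widen [set a])//=.
  by rewrite fsbig_set1 /= /lmono_fun eqxx mul1r.
by move=> i [_ /= /eqP i0]; rewrite /lmono_fun (negbTE i0) mul0r.
Qed.

Lemma lmonoD a b : lmono R (a + b) = lmono R a * lmono R b.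
Proof.
by apply: laurentP => j; rewrite lcoefMmono /= /lmono_fun subr_eq addrC.
Qed.

Lemma lmono0 : lmono R 0 = 1. Proof. by []. Qed.

Lemma lmonoVl a : lmono R (- a) * lmono R a = 1.
Proof. by rewrite -lmonoD addNr. Qed.

Lemma lmono_unit a : lmono R a \is a GRing.unit.
Proof. by apply/asboolP; exists (lmono R (- a)); rewrite lmonoVl. Qed.

Lemma lval_ge_mono a b f : lval_ge (a + b) (lmono R a * f) <-> lval_ge b f.
Proof.
split=> fb j jb; last by rewrite lcoefMmono fb//; lia.
by have := fb (j + a); rewrite lcoefMmono addrK; apply; lia.
Qed.

(** Products and images of series reduce by a shift to series without negative
    part, whose products have coefficients given by finite sums. *)
Lemma laurent_shift f : exists N : nat, exists2 f0, lval_ge 0 f0 & f = lmono R (- N%:Z) * f0.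
Proof.
have [N fN] := lcoef_bound f; exists N; exists (lmono R N%:Z * f).
  by move=> j jN; rewrite lcoefMmono fN//; lia.
by rewrite mulrA lmonoVl mul1r.
Qed.

Lemma lcoefM0 f g (m : nat) : lval_ge 0 f -> lval_ge 0 g ->
  lcoef (f * g) m%:Z = \sum_(i < m.+1) lcoef f i%:Z * lcoef g (m - i)%N%:Z.
Proof.
move=> f0 g0; have := @lmul_funE _ f g 0 0 m.+1 m f0 g0 (ltnSn m).
rewrite !subr0 => E.
rewrite -[LHS]/(lmul_fun f g m%:Z) E coefM; apply: eq_bigr => i _.
by rewrite !coef_poly !ifT ?subr0//; have := ltn_ord i; lia.
Qed.

Lemma lval_ge0M f g : lval_ge 0 f -> lval_ge 0 g -> lval_ge 0 (f * g).
Proof.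
move=> f0 g0 j j0; apply: (@lmul_fun_low _ f g 0 0) => //; lia.
Qed.

Lemma lval_geM a b f g : lval_ge a f -> lval_ge b g -> lval_ge (a + b) (f * g).
Proof.
move=> fa gb.
have E h c : h = lmono R c * (lmono R (- c) * h).
  by rewrite mulrA -lmonoD addrN mul1r.
rewrite (E f a) (E g b) mulrACA -lmonoD -[X in lval_ge X]addr0; apply/lval_ge_mono.
by apply: lval_ge0M; [rewrite -[0](addNr a)|rewrite -[0](addNr b)];
  apply/lval_ge_mono.
Qed.

Lemma lval_geD a f g : lval_ge a f -> lval_ge a g -> lval_ge a (f + g).
Proof. by move=> fa ga j ja; rewrite lcoefD fa// ga// addr0. Qed.

Lemma lval_geN a f : lval_ge a f -> lval_ge a (- f).
Proof. by move=> fa j ja; rewrite lcoefN fa// oppr0. Qed.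

Lemma lval_geB a f g : lval_ge a f -> lval_ge a g -> lval_ge a (f - g).
Proof. by move=> fa ga; apply: lval_geD => //; apply: lval_geN. Qed.

Lemma lval_ge_le a b f : b <= a -> lval_ge a f -> lval_ge b f.
Proof. by move=> ba fa j jb; apply: fa; lia. Qed.

Lemma lval_ge_zero a : lval_ge a (0 : laurent R).
Proof. by []. Qed.

Lemma lval_ge_one : lval_ge 0 (1 : laurent R).
Proof. by move=> j j0; rewrite lcoef1; case: eqP j0 => // ->. Qed.

Lemma lval_ge_all f : (forall k : nat, lval_ge k%:Z f) -> f = 0.
Proof. by move=> fk; apply: laurentP => j; apply: (fk `|j|.+1); lia. Qed.

Lemma lval_ge_sum a I (r : seq I) (P : pred I) (f : I -> laurent R) :
  (forall i, P i -> lval_ge a (f i)) -> lval_ge a (\sum_(i <- r | P i) f i).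
Proof. by move=> fa; elim/big_rec: _ => // i x Pi; apply/lval_geD/fa. Qed.

Lemma lconst_bounded (c : R) :
  `[< bounded_below (fun j : int => if j == 0 then c else 0) >].
Proof. by apply/asboolP; exists 0 => j j0; case: eqP j0 => // ->. Qed.

Definition lconst (c : R) : laurent R := Laurent (lconst_bounded c).

Lemma lcoefMconst c f j : lcoef (lconst c * f) j = c * lcoef f j.
Proof.
rewrite -[LHS]/(lmul_fun _ _ _) /lmul_fun -(fsbig_widen [set (0 : int)])//=.
  by rewrite fsbig_set1 /= subr0.
by move=> i [_ /= /eqP i0]; rewrite (negbTE i0) mul0r.
Qed.

Lemma lconst_is_zmod_morphism : zmod_morphism lconst.
Proof.
by move=> c d; apply: laurentP => j; rewrite lcoefB /=; case: eqP; rewrite ?subr0.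
Qed.

Lemma lconst_is_monoid_morphism : monoid_morphism lconst.
Proof.
split=> [|c d]; apply: laurentP => j; first by rewrite lcoef1 /=; case: eqP.
by rewrite lcoefMconst /=; case: eqP; rewrite ?mulr0.
Qed.

HB.instance Definition _ :=
  GRing.isZmodMorphism.Build R (laurent R) lconst lconst_is_zmod_morphism.
HB.instance Definition _ :=
  GRing.isMonoidMorphism.Build R (laurent R) lconst lconst_is_monoid_morphism.

Lemma lval_ge_const c : lval_ge 0 (lconst c).
Proof. by move=> j j0 /=; case: eqP j0 => // ->. Qed.

(** u-adic completeness, in the only form used below: the iterates of H at 0
    stabilize coefficient by coefficient. *)
Lemma contraction_fixpoint (H : laurent R -> laurent R) :
    (forall f, lval_ge 0 f -> lval_ge 0 (H f)) ->
    (forall f g (k : nat), lval_ge 0 f -> lval_ge 0 g ->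
       lval_ge k%:Z (f - g) -> lval_ge k.+1%:Z (H f - H g)) ->
  exists2 f, lval_ge 0 f & H f = f.
Proof.
move=> H0 HS; pose s k := iter k H 0.
have s0 k : lval_ge 0 (s k) by elim: k => // k IH; apply: H0.
have sS k : lval_ge k%:Z (s k.+1 - s k).
  by elim: k => [|k IH]; [exact: lval_geB (s0 1%N) (s0 0%N) | exact: HS (s0 _) (s0 _) IH].
have sk k m : lval_ge k%:Z (s (m + k)%N - s k).
  elim: m => [|m IH]; first by rewrite subrr.
  rewrite addSn -[s _.+1](subrK (s (m + k)%N)) -addrA; apply: lval_geD => //.
  by apply: lval_ge_le (sS _); lia.
have bd : `[< bounded_below (fun j : int => if j < 0 then 0 else lcoef (s `|j|.+1) j) >].
  by apply/asboolP; exists 0 => j ->.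
pose f := Laurent bd.
have fs k : lval_ge k%:Z (f - s k).
  move=> j jk; rewrite lcoefB /=; case: ifP => j0.
    by rewrite s0 ?subrr.
  have jk' : (`|j|.+1 <= k)%N by lia.
  have jj : j < `|j|.+1%:Z by lia.
  have := sk `|j|.+1 (k - `|j|.+1)%N j jj.
  by rewrite subnK// lcoefB => /subr0_eq ->; rewrite subrr.
have f0 : lval_ge 0 f by rewrite -(subr0 f); apply: (fs 0%N).
exists f => //.
apply/eqP; rewrite -subr_eq0; apply/eqP/lval_ge_all => -[|k].
  exact: lval_geB (H0 _ f0) f0.
rewrite -(subrK (s k.+1) (H f)) -addrA; apply: lval_geD.
  exact: HS f0 (s0 k) (fs k).
by rewrite -opprB; apply: lval_geN (fs k.+1).
Qed.

End LaurentRing.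

Section LaurentMapMorphism.
Variables (R S : comNzRingType) (h : {rmorphism R -> S}).

Lemma lmap_mono a : lmap h (lmono R a) = lmono S a.
Proof. by apply: laurentP => j /=; rewrite /lmono_fun rmorph_nat. Qed.

Lemma lmap_is_zmod_morphism : zmod_morphism (lmap h).
Proof. by move=> f g; apply: laurentP => j; rewrite !lcoefB /= rmorphB. Qed.

Lemma lmap_is_monoid_morphism : monoid_morphism (lmap h).
Proof.
split=> [|f g]; first exact: lmap_mono.
have sh a x : lmap h (lmono R a * x) = lmono S a * lmap h x.
  by apply: laurentP => j; rewrite lcoefMmono /= -lcoefMmono.
have [N [f0 f00 ->]] := laurent_shift f; have [M [g0 g00 ->]] := laurent_shift g.
rewrite mulrACA -lmonoD !sh mulrACA -lmonoD; congr (_ * _).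
have ge0 x : lval_ge 0 x -> lval_ge 0 (lmap h x).
  by move=> x0 j j0 /=; rewrite x0 ?rmorph0.
apply: laurentP => j; case: (ltP j 0) => j0.
  rewrite [RHS]lval_ge0M ?[LHS]ge0//; [exact: lval_ge0M|exact: ge0|exact: ge0].
case: j j0 => // m _; rewrite [RHS]lcoefM0//; [|exact: ge0|exact: ge0].
transitivity (h (lcoef (f0 * g0) m%:Z)) => //.
rewrite lcoefM0// rmorph_sum; apply: eq_bigr => i _.
by rewrite rmorphM.
Qed.

HB.instance Definition _ :=
  GRing.isZmodMorphism.Build (laurent R) (laurent S) (lmap h) lmap_is_zmod_morphism.
HB.instance Definition _ :=
  GRing.isMonoidMorphism.Build (laurent R) (laurent S) (lmap h) lmap_is_monoid_morphism.

Lemma lval_ge_map a f : lval_ge a f -> lval_ge a (lmap h f).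
Proof. by move=> fa j ja /=; rewrite fa ?rmorph0. Qed.

End LaurentMapMorphism.

(** * The field of Laurent series *)

Section LaurentField.
Variable F : fieldType.
Implicit Types f g : laurent F.

(** With c the constant coefficient of f, an inverse of f is a fixed point of
    g |-> c^-1 (1 - (f - c) g), which is contracting because f - c is divisible
    by u. *)
Lemma laurent_inv0 f : lval_ge 0 f -> lcoef f 0 != 0 ->
  exists2 g, lval_ge 0 g & g * f = 1.
Proof.
move=> f0 fn0; pose c := lcoef f 0.
pose H g := lconst c^-1 * (1 - (f - lconst c) * g).
have f1 : lval_ge 1 (f - lconst c).
  move=> j j1; rewrite lcoefB /=; case: eqP => [->|/eqP jn0]; first exact: subrr.
  by rewrite f0 ?subr0//; lia.
have [||g g0 gH] := @contraction_fixpoint _ H.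
- move=> g g0; apply: lval_ge0M; first exact: lval_ge_const.
  apply: lval_geB; first exact: lval_ge_one.
  by apply: lval_ge0M => //; apply: lval_ge_le f1.
- move=> g g' k g0 g0' gg'.
  have -> : H g - H g' = lconst c^-1 * ((f - lconst c) * (g' - g)).
    by rewrite /H; ring.
  rewrite -[X in lval_ge X]add0r; apply: lval_geM; first exact: lval_ge_const.
  have -> : k.+1%:Z = 1 + k%:Z by lia.
  by apply: lval_geM => //; rewrite -opprB; apply: lval_geN.
exists g => //; have : lconst c * H g = lconst c * g by rewrite gH.
rewrite /H mulrA -rmorphM mulfV// rmorph1 mul1r => E.
by rewrite mulrC -[RHS](subrK ((f - lconst c) * g)) E; ring.
Qed.

Lemma laurent_least f : f != 0 ->
  exists a, lcoef f a != 0 /\ lval_ge a f.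
Proof.
move=> fn0; have [N fN] := lcoef_bound f.
have ex : exists m : nat, lcoef f (m%:Z - N%:Z) != 0.
  apply: contrapT => nex; move/eqP: fn0; apply; apply: laurentP => j.
  have [jN|jN] := ltP j (- N%:Z); first exact: fN.
  apply/eqP; apply: contrapT => /negP fj; apply: nex; exists (absz (j + N%:Z)).
  by have -> : (absz (j + N%:Z))%:Z - N%:Z = j by lia.
exists ((ex_minn ex)%:Z - N%:Z); case: ex_minnP => m fm mmin; split=> // j jm.
have [jN|jN] := ltP j (- N%:Z); first exact: fN.
apply/eqP; apply: contraTT isT => fj.
have := mmin (absz (j + N%:Z)); have -> : (absz (j + N%:Z))%:Z - N%:Z = j by lia.
by move=> /(_ fj); lia.
Qed.

Definition lval f : int :=
  if pselect (exists a, lcoef f a != 0 /\ lval_ge a f) is left e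
  then projT1 (cid e) else 0.

Lemma lvalP f : f != 0 -> lcoef f (lval f) != 0 /\ lval_ge (lval f) f.
Proof.
by move=> /laurent_least e; rewrite /lval; case: pselect => // e'; case: cid.
Qed.

Lemma lval_eq f a : lcoef f a != 0 -> lval_ge a f -> lval f = a.
Proof.
move=> fa ga; have fn0 : f != 0 by apply: contraNneq fa => ->.
have [fv gv] := lvalP fn0; apply/eqP; rewrite eq_le; apply/andP; split.
  by rewrite leNgt; apply: contraNN fa => /gv ->.
by rewrite leNgt; apply: contraNN fv => /ga ->.
Qed.

Lemma lval_geP f a : f != 0 -> lval_ge a f <-> a <= lval f.
Proof.
move=> fn0; have [fv gv] := lvalP fn0; split=> [ga|av].
  by rewrite leNgt; apply: contraNN fv => /ga ->.
exact: lval_ge_le gv.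
Qed.

Lemma laurent_unitK f : f != 0 -> f \is a GRing.unit.
Proof.
move=> /lvalP[fv gv]; set a := lval f in fv gv.
have Ef : f = lmono F a * (lmono F (- a) * f).
  by rewrite mulrA -lmonoD addrN mul1r.
have [||g g0 gf] := @laurent_inv0 (lmono F (- a) * f).
- by rewrite -[0](addNr a); apply/lval_ge_mono.
- by rewrite lcoefMmono opprK add0r.
apply/asboolP; exists (g * lmono F (- a)).
by rewrite -mulrA gf.
Qed.

HB.instance Definition _ :=
  GRing.ComUnitRing_isField.Build (laurent F) laurent_unitK.

Lemma lval_mono a : lval (lmono F a) = a.
Proof.
apply: lval_eq; first by rewrite /= /lmono_fun eqxx oner_neq0.
by move=> j ja; rewrite /= /lmono_fun; case: eqP ja => // ->; rewrite ltxx.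
Qed.

Lemma lmono_neq0 a : lmono F a != 0.
Proof. by apply: contraTneq (lmono_unit F a) => ->; rewrite unitr0. Qed.

Lemma lvalM f g : f != 0 -> g != 0 -> lval (f * g) = lval f + lval g.
Proof.
move=> /lvalP[fv gv] /lvalP[fv' gv']; set a := lval f in fv gv *.
set b := lval g in fv' gv' *; apply: lval_eq; last exact: lval_geM.
have E h c : h = lmono F c * (lmono F (- c) * h).
  by rewrite mulrA -lmonoD addrN mul1r.
have E0 (h : laurent F) c : lval_ge c h -> lval_ge 0 (lmono F (- c) * h).
  by move=> hc; rewrite -[0](addNr c); apply/lval_ge_mono.
rewrite (E f a) (E g b) mulrACA -lmonoD lcoefMmono subrr.
rewrite (@lcoefM0 _ _ _ 0)//; [|exact: E0|exact: E0].
by rewrite big_ord1 subn0 !lcoefMmono !opprK !add0r mulf_neq0.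
Qed.

Lemma lval1 : lval 1 = 0.
Proof. exact: lval_mono. Qed.

Lemma lvalV f : f != 0 -> lval f^-1 = - lval f.
Proof.
move=> fn0; apply: (addrI (lval f)).
by rewrite -lvalM ?invr_neq0// mulfV// lval1 subrr.
Qed.

Lemma lvalN f : lval (- f) = lval f.
Proof.
have [->|fn0] := eqVneq f 0; first by rewrite oppr0.
have [fv gv] := lvalP fn0; apply: lval_eq; last exact: lval_geN.
by rewrite lcoefN oppr_eq0.
Qed.

Lemma lvalD_ge f g a : f + g != 0 -> (f != 0 -> a <= lval f) ->
  (g != 0 -> a <= lval g) -> a <= lval (f + g).
Proof.
move=> fg fa ga; apply/lval_geP => //; apply: lval_geD.
  by have [->|f0] := eqVneq f 0; [apply: lval_ge_zero|apply/lval_geP; auto].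
by have [->|g0] := eqVneq g 0; [apply: lval_ge_zero|apply/lval_geP; auto].
Qed.

Lemma lvalD_lt f g : f != 0 -> (g != 0 -> lval f < lval g) ->
  f + g != 0 /\ lval (f + g) = lval f.
Proof.
move=> f0; have [-> _|g0 /(_ isT) fg] := eqVneq g 0; first by rewrite addr0.
have [[fv gv] [_ gv']] := (lvalP f0, lvalP g0).
have fgv : lcoef (f + g) (lval f) != 0 by rewrite lcoefD (gv' _ fg) addr0.
split; first by apply: contraNneq fgv => ->.
by apply: lval_eq => //; apply: lval_geD => //; apply: lval_ge_le gv'; apply: ltW.
Qed.

Lemma lval_ge_iff f a : lval_ge a f <-> (f != 0 -> a <= lval f).
Proof.
have [->|f0] := eqVneq f 0; first by split.
by split=> [/lval_geP H _|H]; [apply: H|apply/lval_geP => //; apply: H].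
Qed.

End LaurentField.

(** The positivity of p is an argument so that the morphism instances below can be
    inferred: the substitution u |-> u^0 is not multiplicative. *)
Definition frob (F : fieldType) (p : nat) (p_gt0 : (0 < p)%N) (f : laurent F) :
  laurent F := lfrob p idfun f.

Section FieldFrobenius.
Variables (F : fieldType) (p : nat) (p_gt0 : (0 < p)%N).
Implicit Types f g : laurent F.

Lemma lcoef_frobM f j : lcoef (frob p_gt0 f) (p%:Z * j) = lcoef f j.
Proof.
by rewrite /= /lfrob_fun mulrC dvdz_mull// mulzK//; lia.
Qed.

Lemma lcoef_frob0 f j : ~~ (p%:Z %| j)%Z -> lcoef (frob p_gt0 f) j = 0.
Proof. by rewrite /= /lfrob_fun => /negbTE ->. Qed.

Lemma frobP f g : (forall j, lcoef g (p%:Z * j) = lcoef f j) ->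
  (forall j, ~~ (p%:Z %| j)%Z -> lcoef g j = 0) -> g = frob p_gt0 f.
Proof.
move=> g1 g0; apply: laurentP => j; case: (boolP (p%:Z %| j)%Z) => [|pj].
  by case/dvdzP => i ->; rewrite mulrC lcoef_frobM g1.
by rewrite g0 ?lcoef_frob0.
Qed.

Lemma frob_is_zmod_morphism : zmod_morphism (@frob F p p_gt0).
Proof.
move=> f g; symmetry; apply: frobP => j; rewrite lcoefB ?lcoef_frobM//.
by move=> pj; rewrite !lcoef_frob0 ?subrr.
Qed.

Lemma frob_is_monoid_morphism : monoid_morphism (@frob F p p_gt0).
Proof.
split=> [|f g].
  symmetry; apply: frobP => j; rewrite !lcoef1 ?mulf_eq0.
    by have -> : (p%:Z == 0) = false by lia.
  by case: eqP => // ->; rewrite dvdz0.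
symmetry; apply: frobP => j.
  rewrite -[LHS]/(lmul_fun _ _ _) -[RHS]/(lmul_fun _ _ _) /lmul_fun.
  rewrite -(fsbig_widen (range (fun i : int => p%:Z * i)))//=; last first.
    move=> i [_ /= pi]; rewrite [lfrob_fun p idfun f i]lcoef_frob0 ?mul0r//.
    by apply/negP => /dvdzP[r ir]; apply: pi; exists r; rewrite // ir mulrC.
  rewrite (reindex_fsbig (fun i : int => p%:Z * i) setT)/=.
    apply: eq_fsbigr => i _; rewrite -mulrBr.
    by rewrite [lfrob_fun p idfun f _]lcoef_frobM [lfrob_fun p idfun g _]lcoef_frobM.
  split=> [i _ /=||i [r _ <-]]; [by exists i| |by exists r].
  by move=> a b _ _ /= ab; apply: (mulfI _ ab); lia.
move=> pj; rewrite -[LHS]/(lmul_fun _ _ _) /lmul_fun fsbig1// => i _.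
case: (boolP (p%:Z %| i)%Z) => pi; last by rewrite lcoef_frob0 ?mul0r.
rewrite [lcoef (frob p_gt0 g) _]lcoef_frob0 ?mulr0//.
by apply: contraNN pj => pji; rewrite -(subrK i j) rpredD.
Qed.

HB.instance Definition _ := GRing.isZmodMorphism.Build (laurent F) (laurent F)
  (@frob F p p_gt0) frob_is_zmod_morphism.
HB.instance Definition _ := GRing.isMonoidMorphism.Build (laurent F) (laurent F)
  (@frob F p p_gt0) frob_is_monoid_morphism.

End FieldFrobenius.

(** * The Frobenius and the equation of a stable line *)

Section FrobeniusValuation.
Variables (F : fieldType) (p : nat) (p_gt0 : (0 < p)%N).
Implicit Types f g : laurent F.

Lemma frob_mono a : frob p_gt0 (lmono F a) = lmono F (p%:Z * a).
Proof.
symmetry; apply: frobP => j; rewrite /= /lmono_fun.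
  by congr (_%:R); congr nat_of_bool; apply/eqP/eqP => [E|->//]; apply: (mulfI _ E); lia.
by case: eqP => // ->; rewrite dvdz_mulr.
Qed.

Lemma frob_const c : frob p_gt0 (lconst c) = lconst c :> laurent F.
Proof.
symmetry; apply: frobP => j /=.
  by rewrite mulf_eq0; have -> : (p%:Z == 0) = false by lia.
by case: eqP => // ->; rewrite dvdz0.
Qed.

Lemma lval_ge_frob a f : lval_ge a f -> lval_ge (p%:Z * a) (frob p_gt0 f).
Proof.
move=> fa j ja; case: (boolP (p%:Z %| j)%Z) => [|pj]; last exact: lcoef_frob0.
case/dvdzP => i ij; rewrite ij mulrC lcoef_frobM fa//.
by move: ja; rewrite ij mulrC ltr_pM2l//; lia.
Qed.

Lemma frob_eq0 f : (frob p_gt0 f == 0) = (f == 0).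
Proof. exact: fmorph_eq0. Qed.

Lemma lval_frob f : lval (frob p_gt0 f) = p%:Z * lval f.
Proof.
have [->|fn0] := eqVneq f 0.
  suff E : lval (0 : laurent F) = 0 by rewrite rmorph0 E mulr0.
  by rewrite /lval; case: pselect => // e; exfalso; by case: e => a []; rewrite lcoef0 eqxx.
by have [fv gv] := lvalP fn0; apply: lval_eq; [rewrite lcoef_frobM|exact: lval_ge_frob].
Qed.

End FrobeniusValuation.

Lemma frobM (F : fieldType) (p q : nat) (p_gt0 : (0 < p)%N) (q_gt0 : (0 < q)%N)
  (pq_gt0 : (0 < p * q)%N) (f : laurent F) :
  frob p_gt0 (frob q_gt0 f) = frob pq_gt0 f.
Proof.
apply: frobP => j; first by rewrite PoszM -mulrA !lcoef_frobM.
case: (boolP (p%:Z %| j)%Z) => [/dvdzP[i ->]|pj _]; last exact: lcoef_frob0.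
rewrite mulrC lcoef_frobM => pqi; apply: lcoef_frob0; apply: contraNN pqi.
by rewrite PoszM; apply: dvdz_mul.
Qed.

Section FixedLine.
Variables (F : closedFieldType) (q : nat) (q_gt0 : (0 < q)%N) (q_gt1 : (1 < q)%N).
Implicit Types gam del x : laurent F.
Local Notation frob := (frob q_gt0).

(** Hensel's lemma with a Frobenius. Since [frob] multiplies valuations by q, the
    derivative of the equation at a root x0 of its reduction is the constant
    term of the second factor, so that a nonzero second factor is enough. *)
Lemma hensel_frob gam del (m : nat) (x0 : F) :
    lval_ge 0 gam -> lval_ge 0 del ->
    (m == 0%N)%:R * x0 + lcoef del 0 != 0 ->
    x0 * ((m == 0%N)%:R * x0 + lcoef del 0) = lcoef gam 0 ->
  exists y, y * (lmono F m%:Z * frob y + del) = gam.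
Proof.
move=> gam0 del0 d0 x0P.
pose y z := lconst x0 + lmono F 1 * z.
pose den z := lmono F m%:Z * frob (y z) + del.
have y0 z : lval_ge 0 z -> lval_ge 0 (y z).
  move=> z0; apply: lval_geD; first exact: lval_ge_const.
  by apply: lval_ge_le (_ : lval_ge 1 _) => //; rewrite -[1]addr0; apply/lval_ge_mono.
have den0 z : lval_ge 0 z -> lval_ge 0 (den z).
  move=> z0; apply: lval_geD => //; apply: (@lval_ge_le _ (m%:Z + 0)); first by lia.
  by apply/lval_ge_mono; rewrite -[X in lval_ge X](mulr0 q%:Z); apply: lval_ge_frob; apply: y0.
have cy z : lval_ge 0 z -> lcoef (y z) 0 = x0.
  by move=> z0; rewrite lcoefD lcoefMmono z0// addr0.
have cden z : lval_ge 0 z -> lcoef (den z) 0 = (m == 0%N)%:R * x0 + lcoef del 0.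
  move=> z0; rewrite lcoefD lcoefMmono; congr (_ + _).
  case: m {den den0 d0 x0P} => [|m].
    rewrite subrr. rewrite -[X in lcoef _ X](mulr0 q%:Z) lcoef_frobM cy//. by rewrite eqxx mul1r.
  rewrite mul0r; have /(lval_ge_frob q_gt0) := y0 _ z0; rewrite mulr0; apply.
  by lia.
have dn0 z : lval_ge 0 z -> den z != 0.
  by move=> z0; apply: contraNneq d0 => dz; rewrite -(cden z z0) dz.
have dv z : lval_ge 0 z -> lval (den z) = 0.
  by move=> z0; apply: lval_eq; [rewrite cden|exact: den0].
have dinv z : lval_ge 0 z -> lval_ge 0 (den z)^-1.
  by move=> z0; apply/lval_ge_iff => _; rewrite lvalV ?dn0// dv.
pose H z := lmono F (-1) * (gam / den z - lconst x0).
have [||z z0 zH] := @contraction_fixpoint _ H.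
- move=> z z0; rewrite -[0](addNr 1); apply/lval_ge_mono.
  have -> : gam / den z - lconst x0 = (gam - lconst x0 * den z) * (den z)^-1.
    by rewrite mulrBl mulfK ?dn0.
  rewrite -[1]addr0; apply: lval_geM; last exact: dinv.
  move=> j j1; have [->|jn0] := eqVneq j 0.
    by rewrite lcoefB lcoefMconst cden// x0P subrr.
  rewrite lcoefB lcoefMconst den0 ?gam0 ?mulr0 ?subrr//; lia.
- move=> z z' k z0 z0' zz'.
  have -> : H z - H z' = lmono F (-1) * (gam * (lmono F m%:Z *
      (frob (lmono F 1 * (z' - z)) * ((den z)^-1 * (den z')^-1)))).
    rewrite /H -mulrBr opprB addrA subrK; congr (_ * _).
    have -> : lmono F 1 * (z' - z) = y z' - y z by rewrite /y; ring.
    have E : lmono F m%:Z * frob (y z' - y z) = den z' - den z.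
      by rewrite rmorphB /den; ring.
    rewrite [X in _ = gam * X]mulrA E.
    by field; rewrite !dn0.
  have -> : k.+1%:Z = -1 + k.+2%:Z by lia.
  apply/lval_ge_mono; rewrite -[X in lval_ge X]add0r; apply: lval_geM => //.
  apply: (@lval_ge_le _ (m%:Z + k.+2%:Z)); first by lia.
  apply/lval_ge_mono; rewrite -[X in lval_ge X]addr0; apply: lval_geM; last first.
    by apply: lval_ge0M; apply: dinv.
  apply: (@lval_ge_le _ (q%:Z * (1 + k%:Z))); first by nia.
  by apply/lval_ge_frob/lval_ge_mono; rewrite -opprB; apply: lval_geN.
exists (y z); have : lmono F 1 * H z = lmono F 1 * z by rewrite zH.
rewrite /H mulrA -lmonoD subrr mul1r => E.
have yE : y z = gam / den z by rewrite {1}/y -E addrC subrK.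
by rewrite -/(den z) {1}yE mulfVK ?dn0.
Qed.

Lemma closed_quadratic (b c : F) : exists x : F, x * (x + b) = c.
Proof.
have [x xP] := @solve_monicpoly F 2 (fun i => if i == 0%N then c else - b) isT.
exists x; move: xP; rewrite big_ord_recr big_ord1 /= expr0 mulr1 expr1 expr2.
by rewrite mulrDr => ->; rewrite mulNr [x * b]mulrC subrK.
Qed.

(** If a semilinear map has matrix (0, gam; 1, del) in a basis (e1, e2), then
    e2 + x e1 spans a stable line iff x (frob x + del) = gam. Over an
    algebraically closed field the equation is solvable as soon as its Newton
    polygon has an integral slope to start from. The other possibility says that
    there is a single slope, with denominator not dividing q + 1. *)
Lemma companion_dichotomy gam del : gam != 0 ->
  (exists x, x * (frob x + del) = gam) \/
  ((del != 0 -> q%:Z * lval gam < (q%:Z + 1) * lval del) /\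
   ~~ (q%:Z + 1 %| lval gam)%Z).
Proof.
move=> gam0.
(* X, D' and x0 are the valuation of a root, that of the other factor, and the
   leading coefficient of the root *)
suff key (X D' : int) (x0 : F) : D' <= q%:Z * X -> X + D' = lval gam -> lval_ge D' del ->
    x0 * ((D' == q%:Z * X)%:R * x0 + lcoef del D') = lcoef gam (lval gam) ->
  exists x, x * (frob x + del) = gam.
  have [gv gg] := lvalP gam0.
  case: (boolP ((del != 0) && ((q%:Z + 1) * lval del <= q%:Z * lval gam))).
    case/andP => del0 dg; left; have [dv dd] := lvalP del0.
    have [E|E] := eqVneq (lval del) (q%:Z * (lval gam - lval del)).
      have [x xP] := closed_quadratic (lcoef del (lval del)) (lcoef gam (lval gam)).
      by apply: (key (lval gam - lval del) (lval del) x); rewrite ?subrK//;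
        [lia | rewrite {1}E eqxx mul1r].
    apply: (key (lval gam - lval del) (lval del)
      (lcoef gam (lval gam) / lcoef del (lval del))); rewrite ?subrK//; first by lia.
    by rewrite (negbTE E) mul0r add0r mulfVK.
  rewrite negb_and negbK => H.
  have H' : del != 0 -> q%:Z * lval gam < (q%:Z + 1) * lval del.
    by move=> del0; move: H; rewrite (negbTE del0) /= -ltNge.
  case: (boolP (q%:Z + 1 %| lval gam)%Z) => [/dvdzP[X EX]|nd]; last by right.
  left; have dX : lval_ge (q%:Z * X + 1) del.
    by apply/lval_ge_iff => /H'; rewrite EX; nia.
  have [x xP] := closed_quadratic 0 (lcoef gam (lval gam)).
  apply: (key X (q%:Z * X) x) => //; first by lia.
    by apply: lval_ge_le dX; lia.
  by rewrite eqxx mul1r dX//; lia.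
move=> D'X XD' del0 x0P.
have [gv gg] := lvalP gam0.
pose m := absz (q%:Z * X - D' : int)%R.
have [||||y yP] := @hensel_frob (lmono F (- lval gam) * gam) (lmono F (- D') * del) m x0.
- by rewrite -[0](addNr (lval gam)); apply/lval_ge_mono.
- by rewrite -[0](addNr D'); apply/lval_ge_mono.
- rewrite lcoefMmono opprK add0r; have -> : (m == 0%N) = (D' == q%:Z * X) by lia.
  by apply: contraNneq gv => E; rewrite -x0P E mulr0.
- rewrite !lcoefMmono !opprK !add0r; have -> : (m == 0%N) = (D' == q%:Z * X) by lia.
  by [].
exists (lmono F X * y).
have -> : frob (lmono F X * y) = lmono F (q%:Z * X) * frob y.
  by rewrite rmorphM; congr (_ * _); apply: frob_mono.
have := congr1 ( *%R (lmono F (lval gam))) yP.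
rewrite [X in _ = X]mulrA -lmonoD subrr mul1r => <-.
have -> : q%:Z * X = D' + m%:Z by lia.
rewrite -XD' !lmonoD.
set del' := lmono F (- D') * del.
have -> : del = lmono F D' * del' by rewrite mulrA -lmonoD subrr mul1r.
by ring.
Qed.

End FixedLine.

(** * Norms on a plane with two classes of values *)

Lemma ord2P (i : 'I_2) : i = 0 \/ i = 1.
Proof. by case: i => -[|[|//]] im; [left|right]; apply: val_inj. Qed.

Lemma sum2 (R : nmodType) (f : 'I_2 -> R) : \sum_i f i = f 0 + f 1.
Proof. by rewrite big_ord_recr big_ord1; congr (f _ + f _); apply: val_inj. Qed.

Lemma det2 (R : comNzRingType) (A : 'M[R]_2) :
  \det A = A 0 0 * A 1 1 - A 0 1 * A 1 0.
Proof.
rewrite (expand_det_row _ 0) sum2 /cofactor !det_mx11 !mxE /=.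
rewrite expr0 mul1r addn1 expr1 mulN1r mulrN.
by congr (_ * A _ _ - _ * A _ _); apply: val_inj.
Qed.

Lemma mulmx_col2 (R : comNzRingType) (b : 'M[R]_2) (c : 'cV[R]_2) :
  b *m c = c 0 0 *: col 0 b + c 1 0 *: col 1 b.
Proof. by apply/matrixP => i j; rewrite !mxE sum2 (ord1 j) mulrC [c 1 0 * _]mulrC. Qed.

Lemma cv2P (R : comNzRingType) (c d : 'cV[R]_2) :
  c 0 0 = d 0 0 -> c 1 0 = d 1 0 -> c = d.
Proof. by move=> c0 c1; apply/colP => i; case: (ord2P i) => ->. Qed.

Lemma cv2_neq0 (R : comNzRingType) (c : 'cV[R]_2) :
  c != 0 -> c 0 0 != 0 \/ c 1 0 != 0.
Proof.
move=> cn0; apply: contrapT => /not_orP[/negP + /negP]; rewrite !negbK => /eqP c0 /eqP c1.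
by move/eqP: cn0; apply; apply: cv2P; rewrite ?c0 ?c1 mxE.
Qed.

Definition mx2 (R : comNzRingType) (v0 v1 : 'cV[R]_2) : 'M[R]_2 :=
  \matrix_(i, j) if j == 0 then v0 i 0 else v1 i 0.

Lemma col_mx20 (R : comNzRingType) (v0 v1 : 'cV[R]_2) : col 0 (mx2 v0 v1) = v0.
Proof. by apply/colP => i; rewrite !mxE. Qed.

Lemma col_mx21 (R : comNzRingType) (v0 v1 : 'cV[R]_2) : col 1 (mx2 v0 v1) = v1.
Proof. by apply/colP => i; rewrite !mxE. Qed.

Lemma mul_mx2 (R : comNzRingType) (b : 'M[R]_2) v0 v1 :
  b *m mx2 v0 v1 = mx2 (b *m v0) (b *m v1).
Proof.
by apply/matrixP => i j; rewrite !mxE !sum2 !mxE; case: (ord2P j) => ->.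
Qed.

Lemma col_eqP (R : comNzRingType) (b b' : 'M[R]_2) :
  col 0 b = col 0 b' -> col 1 b = col 1 b' -> b = b'.
Proof.
move=> /colP b0 /colP b1; apply/matrixP => i j.
by case: (ord2P j) => ->; [have := b0 i | have := b1 i]; rewrite !mxE.
Qed.

Lemma unitmx_inj (F : fieldType) n (b : 'M[F]_n) :
  (forall c : 'cV[F]_n, b *m c = 0 -> c = 0) -> b \in unitmx.
Proof.
move=> binj; rewrite unitmxE unitfE -det_tr; apply/det0P => -[v vn0 vb].
move/eqP: vn0; apply; apply: trmx_inj; rewrite trmx0; apply: binj.
by rewrite -[b]trmxK -trmx_mul vb trmx0.
Qed.

Lemma unitmx_col_neq0 (F : fieldType) n (b : 'M[F]_n) j : b \in unitmx -> col j b != 0.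
Proof.
move=> bU; apply: contraTneq bU => bj; rewrite unitmxE unitfE negbK -det_tr.
apply/det0P; exists (delta_mx 0 j).
  by apply/eqP => /matrixP/(_ 0 j)/eqP; rewrite !mxE !eqxx oner_eq0.
by rewrite -rowE -tr_col bj trmx0.
Qed.

Lemma mulVmxv (R : comUnitRingType) n (b : 'M[R]_n) (v : 'cV[R]_n) :
  b \in unitmx -> b *m (invmx b *m v) = v.
Proof. by move=> bU; rewrite mulmxA mulmxV ?mul1mx. Qed.

Lemma unitmx_mulv_eq0 (R : comUnitRingType) n (b : 'M[R]_n) (v : 'cV[R]_n) :
  b \in unitmx -> (b *m v == 0) = (v == 0).
Proof.
move=> bU; apply/eqP/eqP => [bv|->]; last exact: mulmx0.
by rewrite -[v]mul1mx -(mulVmx bU) -mulmxA bv mulmx0.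
Qed.

Definition eqm (e a b : int) : Prop := (e %| a - b)%Z.

Lemma eqmP e a b : eqm e a b <-> exists k, a = b + e * k.
Proof.
split=> [/dvdzP[k E]|[k ->]]; first by exists k; rewrite mulrC -E addrC subrK.
by rewrite /eqm addrAC subrr add0r dvdz_mulr.
Qed.

Lemma eqm_refl e a : eqm e a a. Proof. by rewrite /eqm subrr dvdz0. Qed.
Lemma eqm_sym e a b : eqm e a b -> eqm e b a.
Proof. by move=> /eqmP[k ->]; apply/eqmP; exists (- k); ring. Qed.
Lemma eqm_trans e a b c : eqm e a b -> eqm e b c -> eqm e a c.
Proof. by move=> /eqmP[k ->] /eqmP[l ->]; apply/eqmP; exists (k + l); ring. Qed.
Lemma eqmM e a b c : eqm e a b -> eqm e (c * a) (c * b).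
Proof. by move=> /eqmP[k ->]; apply/eqmP; exists (c * k); ring. Qed.
Lemma eqm_addl e a b k : eqm e a b -> eqm e (e * k + a) b.
Proof. by move=> /eqmP[l ->]; apply/eqmP; exists (k + l); ring. Qed.

Section Norm.
Variable F : fieldType.
Local Notation K := (laurent F).
Local Notation V := 'cV[K]_2.
Implicit Types (v c : V) (e s : int) (w : V -> int).

(** The norm of a vector with coordinates c in an orthogonal basis whose vectors
    have norms s0 and s1. The value at c = 0 is arbitrary. *)
Definition wt e s0 s1 c : int :=
  if c 0 0 == 0 then e * lval (c 1 0) + s1 else
  if c 1 0 == 0 then e * lval (c 0 0) + s0 else
  if e * lval (c 0 0) + s0 <= e * lval (c 1 0) + s1 then e * lval (c 0 0) + s0
  else e * lval (c 1 0) + s1.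

Lemma wt_attained e s0 s1 c : c != 0 ->
  (c 0 0 != 0 /\ wt e s0 s1 c = e * lval (c 0 0) + s0) \/
  (c 1 0 != 0 /\ wt e s0 s1 c = e * lval (c 1 0) + s1).
Proof.
move=> cn0; rewrite /wt; case: eqP => c0.
  by right; split=> //; case: (cv2_neq0 cn0) => //; rewrite c0 eqxx.
case: eqP => c1; first by left; split=> //; apply/eqP.
by case: ifP => _; [left|right]; split=> //; apply/eqP.
Qed.

Lemma wt_geP e s0 s1 c b : c != 0 ->
  b <= wt e s0 s1 c <->
  (c 0 0 != 0 -> b <= e * lval (c 0 0) + s0) /\
  (c 1 0 != 0 -> b <= e * lval (c 1 0) + s1).
Proof.
move=> cn0; split.
  rewrite /wt; case: eqP => c0; case: eqP => c1; try by split.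
  by case: ifP => h bw; split=> _; lia.
by move=> [H0 H1]; case: (wt_attained e s0 s1 cn0) => -[cn ->]; auto.
Qed.

(** Additive norms fixed by a semilinear map without stable line. The values fall
    into two classes modulo e, exchanged by multiplication by q; e is the norm
    of the scalar u. These are the points in the interior of an edge of the tree
    of lattices, and the class of the norm of a vector tells on which side of
    the point the direction of the vector lies. *)
Record is_norm e (q : int) w : Prop := IsNorm {
  normZ : forall x v, x != 0 -> v != 0 -> w (x *: v) = e * lval x + w v;
  normD : forall v v' a, v != 0 -> v' != 0 -> v + v' != 0 ->
    a <= w v -> a <= w v' -> a <= w (v + v');
  norm_class : forall v v', v != 0 -> v' != 0 ->
    eqm e (w v') (w v) \/ eqm e (w v') (q * w v);
  norm_swap : forall v, v != 0 -> ~ eqm e (q * w v) (w v);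
  norm_both : forall v, v != 0 -> exists2 v', v' != 0 & eqm e (w v') (q * w v);
  norm_vol : exists kappa, forall b : 'M[K]_2,
    col 0 b != 0 -> col 1 b != 0 -> eqm e (w (col 1 b)) (q * w (col 0 b)) ->
    w (col 0 b) + w (col 1 b) = e * lval (\det b) + kappa }.

Section NormTheory.
Variables (e q : int) (w : V -> int).
Hypothesis wN : is_norm e q w.

Lemma normN v : v != 0 -> w (- v) = w v.
Proof.
by move=> v0; rewrite -scaleN1r (normZ wN) ?oppr_eq0 ?oner_eq0// lvalN lval1 mulr0 add0r.
Qed.

Lemma normD_lt v v' : v != 0 -> v' != 0 -> w v < w v' ->
  v + v' != 0 /\ w (v + v') = w v.
Proof.
move=> v0 v'0 vv'; have s0 : v + v' != 0.
  by apply/eqP => /addr0_eq v'E; move: vv'; rewrite -v'E normN ?ltxx.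
split=> //; apply/eqP; rewrite eq_le; apply/andP; split; last first.
  by apply: (normD wN) => //; apply: ltW.
rewrite leNgt; apply/negP => lt; pose a := Num.min (w (v + v')) (w v').
have : a <= w ((v + v') + (- v')).
  by apply: (normD wN); rewrite ?oppr_eq0 ?addrK// ?normN// ge_min lexx ?orbT.
by rewrite addrK /a; case: leP; lia.
Qed.

(** Two vectors with norms in different classes are orthogonal: in a combination
    of them the two terms never have the same norm, so that nothing cancels. *)
Lemma norm_orthogonal (b : 'M[K]_2) c :
    col 0 b != 0 -> col 1 b != 0 -> eqm e (w (col 1 b)) (q * w (col 0 b)) ->
    c != 0 ->
  b *m c != 0 /\ w (b *m c) = wt e (w (col 0 b)) (w (col 1 b)) c.
Proof.
move=> b0 b1 bc cn0; rewrite mulmx_col2 /wt.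
have [c0|c0] := eqVneq (c 0 0) 0.
  case: (cv2_neq0 cn0) => [/eqP//|c1].
  by rewrite c0 scale0r add0r (normZ wN)// scaler_eq0 negb_or c1.
have [c1|c1] := eqVneq (c 1 0) 0.
  by rewrite c1 scale0r addr0 (normZ wN)// scaler_eq0 negb_or c0.
have n0 : c 0 0 *: col 0 b != 0 by rewrite scaler_eq0 negb_or c0.
have n1 : c 1 0 *: col 1 b != 0 by rewrite scaler_eq0 negb_or c1.
rewrite -!(normZ wN)//; case: leP => h.
  apply: normD_lt => //; rewrite lt_neqAle h andbT; apply/eqP => E.
  apply: (norm_swap wN b0); apply: eqm_trans (eqm_sym bc) _.
  move: E; rewrite !(normZ wN)// => E; apply/eqmP.
  exists (lval (c 0 0) - lval (c 1 0)).
  by rewrite -[LHS](addKr (e * lval (c 1 0))) -E; ring.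
by rewrite addrC; apply: normD_lt.
Qed.

Lemma orthogonal_unitmx (b : 'M[K]_2) :
    col 0 b != 0 -> col 1 b != 0 -> eqm e (w (col 1 b)) (q * w (col 0 b)) ->
  b \in unitmx.
Proof.
move=> b0 b1 bc; apply: unitmx_inj => c bc0; apply/eqP; apply: contraPT bc0 => cn0.
by have [/eqP] := norm_orthogonal b0 b1 bc cn0.
Qed.

End NormTheory.
End Norm.

(** * Lattices and adapted bases *)

Lemma int_min (T : Type) (P : T -> Prop) (w : T -> int) (B : int) :
    (exists v : T, P v) -> (forall v : T, P v -> B <= w v) ->
  exists2 v : T, P v & forall v' : T, P v' -> w v <= w v'.
Proof.
move=> [v0 Pv0] PB.
have ex : exists m : nat, `[< exists2 v : T, P v & w v = B + m%:Z >].
  exists (absz (w v0 - B : int)); apply/asboolP; exists v0 => //.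
  by have := PB _ Pv0; lia.
case: (ex_minnP ex) => m /asboolP[v Pv wv] mmin; exists v => // v' Pv'.
rewrite leNgt; apply/negP => lt; have Bv' := PB _ Pv'.
have /mmin : `[< exists2 v : T, P v & w v = B + (absz (w v' - B : int))%:Z >].
  by apply/asboolP; exists v' => //; lia.
by lia.
Qed.

Lemma le_mulDl (e l a : int) : 0 < e -> 0 <= l -> a <= e * l + a.
Proof. by move=> *; nia. Qed.

Lemma mulDl_ge0 (e l a : int) : 0 < e -> a <= e * l + a -> 0 <= l.
Proof. by move=> *; nia. Qed.

Section Lattices.
Variable F : fieldType.
Local Notation K := (laurent F).
Local Notation V := 'cV[K]_2.
Implicit Types (v c : V) (g b : 'M[K]_2).

Definition integral n m (A : 'M[K]_(n, m)) : Prop := forall i j, lval_ge 0 (A i j).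

Lemma integralM n m r (A : 'M[K]_(n, m)) (B : 'M[K]_(m, r)) :
  integral A -> integral B -> integral (A *m B).
Proof.
by move=> A0 B0 i j; rewrite mxE; apply: lval_ge_sum => l _; apply: lval_ge0M.
Qed.

Lemma std_latticeE v : std_lattice F 0 v <-> integral v.
Proof. by split=> [v0 i j|v0 i]; [rewrite (ord1 j)|]. Qed.

Lemma latticeP g v : g \in unitmx -> lattice g v <-> integral (invmx g *m v).
Proof.
move=> gU; split=> [[c /std_latticeE c0 <-]|v0]; first by rewrite mulKmx.
by exists (invmx g *m v); [apply/std_latticeE|rewrite mulVmxv].
Qed.

Lemma lattice0 g : lattice g 0.
Proof. by exists 0; [move=> i; rewrite mxE|rewrite mulmx0]. Qed.

Lemma latticeD g v v' : lattice g v -> lattice g v' -> lattice g (v + v').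
Proof.
move=> [c c0 <-] [c' c'0 <-]; exists (c + c'); last by rewrite mulmxDr.
by move=> i; rewrite mxE; apply: lval_geD; [apply: c0|apply: c'0].
Qed.

Lemma latticeZ g x v : lval_ge 0 x -> lattice g v -> lattice g (x *: v).
Proof.
move=> x0 [c c0 <-]; exists (x *: c); last by rewrite scalemxAr.
by move=> i; rewrite mxE; apply: lval_ge0M.
Qed.

Lemma latticeN g v : lattice g v -> lattice g (- v).
Proof.
by move=> gv; rewrite -scaleN1r; apply: latticeZ => //; apply/lval_geN/lval_ge_one.
Qed.

Lemma latticeB g v v' : lattice g v -> lattice g v' -> lattice g (v - v').
Proof. by move=> gv gv'; apply: latticeD => //; apply: latticeN. Qed.

Lemma lattice_col g j : lattice g (col j g).
Proof.
exists (delta_mx j 0); last by rewrite -colE.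
by move=> i; rewrite mxE; case: (_ && _); [apply: lval_ge_one|apply: lval_ge_zero].
Qed.

Lemma lattice_subP g (L : set V) : L 0 ->
    (forall v v', L v -> L v' -> L (v + v')) ->
    (forall x v, lval_ge 0 x -> L v -> L (x *: v)) ->
    L (col 0 g) -> L (col 1 g) -> lattice g `<=` L.
Proof.
move=> L0 LD LZ L1 L2 _ [c c0 <-]; rewrite mulmx_col2.
by apply: LD; apply: LZ.
Qed.

Lemma lattice_sub_lattice g g' : lattice g' (col 0 g) -> lattice g' (col 1 g) ->
  lattice g `<=` lattice g'.
Proof.
move=> g0 g1; apply: lattice_subP => //; first exact: lattice0.
  exact: latticeD.
exact: latticeZ.
Qed.

Lemma lattice_mul g h : integral h -> lattice (g *m h) `<=` lattice g.
Proof.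
move=> h0 _ [c /std_latticeE c0 <-]; exists (h *m c); last by rewrite mulmxA.
by apply/std_latticeE/integralM.
Qed.

Lemma lattice_sub_integral g g' : g' \in unitmx -> lattice g `<=` lattice g' ->
  integral (invmx g' *m g).
Proof.
move=> g'U sub i j; have /(latticeP _ g'U) := sub _ (@lattice_col g j).
by move/(_ i 0); rewrite colE mulmxA -colE mxE.
Qed.

Lemma integral_det (h : 'M[K]_2) : integral h -> lval_ge 0 (\det h).
Proof.
by move=> h0; rewrite det2; apply: lval_geB; apply: lval_ge0M.
Qed.

Lemma unitmx_det_neq0 g : (g \in unitmx) = (\det g != 0).
Proof. by rewrite unitmxE unitfE. Qed.

Lemma lattice_sub_det g g' : g \in unitmx -> g' \in unitmx ->
  lattice g `<=` lattice g' -> lval (\det g') <= lval (\det g).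
Proof.
move=> gU g'U sub; have h0 := lattice_sub_integral g'U sub.
have E : g = g' *m (invmx g' *m g) by rewrite mulmxA mulmxV ?mul1mx.
have hU : invmx g' *m g \in unitmx by rewrite unitmx_mul unitmx_inv g'U.
rewrite [in leRHS]E det_mulmx lvalM -?unitmx_det_neq0//.
by rewrite ler_wpDr//; apply/lval_geP; [rewrite -unitmx_det_neq0|apply: integral_det].
Qed.

Lemma lattice_scale a g v : lattice (lmono F a *: g) v <-> lattice g (lmono F (- a) *: v).
Proof.
split=> -[c c0 E]; exists c => //.
  by rewrite -E -scalemxAl scalerA lmonoVl scale1r.
by rewrite -scalemxAl E scalerA -lmonoD subrr scale1r.
Qed.

Lemma unitmx_lmono a g : g \in unitmx -> lmono F a *: g \in unitmx.
Proof.
by rewrite !unitmx_det_neq0 detZ => gU; rewrite mulf_neq0// expf_neq0// lmono_neq0.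
Qed.

Lemma mx_bounded n m (A : 'M[K]_(n, m)) : exists N : nat, integral (lmono F N%:Z *: A).
Proof.
have bd (f : K) : exists N : nat, lval_ge (- N%:Z) f.
  by have [N fN] := lcoef_bound f; exists N.
have /fin_all_exists[N NP] : forall ij : 'I_n * 'I_m, exists N : nat, lval_ge (- N%:Z) (A ij.1 ij.2).
  by move=> ij; apply: bd.
exists (\max_ij N ij)%N => i j; rewrite mxE -[X in lval_ge X](addrN (\max_ij N ij)%N%:Z).
apply/lval_ge_mono; apply: lval_ge_le (NP (i, j)).
by rewrite lerN2 lez_nat (leq_bigmax (i, j)).
Qed.

Lemma lattice_absorb g v : g \in unitmx -> exists N : nat, lattice g (lmono F N%:Z *: v).
Proof.
move=> gU; have [N NP] := mx_bounded (invmx g *m v); exists N.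
by apply/latticeP => //; rewrite -scalemxAr.
Qed.

Lemma lattice_commensurable g g' : g \in unitmx -> g' \in unitmx ->
  exists N : nat, lattice (lmono F N%:Z *: g) `<=` lattice g'.
Proof.
move=> gU g'U; have [N NP] := mx_bounded (invmx g' *m g); exists N.
have -> : lmono F N%:Z *: g = g' *m (lmono F N%:Z *: (invmx g' *m g)).
  by rewrite -scalemxAr mulmxA mulmxV ?mul1mx.
exact: lattice_mul.
Qed.

Section Adapted.
Variables (e q : int) (w : V -> int).
Hypotheses (e_gt0 : 0 < e) (wN : is_norm e q w).

Lemma normD2 x0 x1 v0 v1 a : v0 != 0 -> v1 != 0 -> x0 *: v0 + x1 *: v1 != 0 ->
    (x0 != 0 -> a <= e * lval x0 + w v0) -> (x1 != 0 -> a <= e * lval x1 + w v1) ->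
  a <= w (x0 *: v0 + x1 *: v1).
Proof.
move=> n0 n1; have [->|x0n] := eqVneq x0 0.
  rewrite scale0r add0r scaler_eq0 negb_or => /andP[x1n _] _ /(_ x1n).
  by rewrite (normZ wN).
have [->|x1n] := eqVneq x1 0.
  by rewrite scale0r addr0 (normZ wN)// => _ /(_ isT).
move=> s0 /(_ isT) a0 /(_ isT) a1; apply: (normD wN) => //;
  by rewrite ?(normZ wN)// scaler_eq0 negb_or ?x0n ?x1n.
Qed.

Lemma norm_lattice_bounded g : g \in unitmx ->
  exists B, forall v, lattice g v -> v != 0 -> B <= w v.
Proof.
move=> gU; have [g0 g1] := (unitmx_col_neq0 0 gU, unitmx_col_neq0 1 gU).
exists (Num.min (w (col 0 g)) (w (col 1 g))) => _ [c c0 <-].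
rewrite mulmx_col2 => n0; apply: normD2 => // cn0.
  have l0 : 0 <= lval (c 0 0) by apply/(lval_geP _ cn0)/c0.
  by rewrite ge_min; apply/orP; left; apply: le_mulDl.
have l0 : 0 <= lval (c 1 0) by apply/(lval_geP _ cn0)/c0.
by rewrite ge_min; apply/orP; right; apply: le_mulDl.
Qed.

(** An orthogonal basis, the vector of smallest norm first. In the tree, it spans
    an apartment through the lattice and the fixed point, and the difference of
    the two norms measures their distance. *)
Record adapted b : Prop := Adapted {
  adapted0 : col 0 b != 0;
  adapted1 : col 1 b != 0;
  adapted_class : eqm e (w (col 1 b)) (q * w (col 0 b));
  adapted_lt : w (col 0 b) < w (col 1 b) }.

(** The two basis vectors are the vectors of smallest norm in each of the two
    classes. *)
Lemma lattice_adapted g : g \in unitmx ->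
  exists b, [/\ b \in unitmx, lattice b = lattice g & adapted b].
Proof.
move=> gU; have [B PB] := norm_lattice_bounded gU.
(* v0 has smallest norm, v1 has smallest norm in the other class *)
have [|v [gv vn0]|v0 [g0 n0] min0] :=
    @int_min _ (fun v => lattice g v /\ v != 0) w B.
- by exists (col 0 g); split; [apply: lattice_col|apply: unitmx_col_neq0].
- exact: PB.
have [|v [gv nv _]|v1 [g1 n1 c1] min1] :=
    @int_min _ (fun v => [/\ lattice g v, v != 0 & eqm e (w v) (q * w v0)]) w B.
- have [v' v'0 cv'] := norm_both wN n0; have [N vN] := lattice_absorb v' gU.
  exists (lmono F N%:Z *: v'); split=> //.
    by rewrite scaler_eq0 negb_or lmono_neq0.
  by rewrite (normZ wN) ?lmono_neq0//; apply: eqm_addl.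
- exact: PB.
pose b := mx2 v0 v1.
have [b0 b1] : col 0 b = v0 /\ col 1 b = v1 by rewrite col_mx20 col_mx21.
have bU : b \in unitmx by apply: (orthogonal_unitmx wN); rewrite ?b0 ?b1.
have w01 : w v0 < w v1.
  rewrite lt_neqAle min0 ?andbT//; apply/eqP => E.
  by apply: (norm_swap wN n0); apply: eqm_sym; rewrite {1}E.
exists b; split=> //; last by split; rewrite ?b0 ?b1.
apply/seteqP; split.
  by apply: lattice_sub_lattice; rewrite ?b0 ?b1.
move=> v gv; have [->|vn0] := eqVneq v 0; first exact: lattice0.
pose c := invmx b *m v.
have cn0 : c != 0 by rewrite unitmx_mulv_eq0 ?unitmx_inv.
have Ev : v = c 0 0 *: v0 + c 1 0 *: v1 by rewrite -b0 -b1 -mulmx_col2 mulVmxv.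
have key0 : lattice g (c 0 0 *: v0) -> lval_ge 0 (c 0 0).
  move=> gc; apply/lval_ge_iff => c0.
  have cv0 : c 0 0 *: v0 != 0 by rewrite scaler_eq0 negb_or c0.
  by have := min0 _ (conj gc cv0); rewrite (normZ wN)//; apply: mulDl_ge0.
have key1 : lattice g (c 1 0 *: v1) -> lval_ge 0 (c 1 0).
  move=> gc; apply/lval_ge_iff => c1n.
  have cv1 : c 1 0 *: v1 != 0 by rewrite scaler_eq0 negb_or c1n.
  have cc : eqm e (w (c 1 0 *: v1)) (q * w v0) by rewrite (normZ wN)//; apply: eqm_addl.
  by have := min1 _ (And3 gc cv1 cc); rewrite (normZ wN)//; apply: mulDl_ge0.
have [_ wv] : b *m c != 0 /\ w (b *m c) = wt e (w (col 0 b)) (w (col 1 b)) c.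
  by apply: (norm_orthogonal wN); rewrite ?b0 ?b1.
rewrite mulVmxv// b0 b1 in wv.
suff [c0 c1'] : lval_ge 0 (c 0 0) /\ lval_ge 0 (c 1 0).
  by apply/latticeP => // i j; rewrite (ord1 j); case: (ord2P i) => ->.
case: (wt_attained e (w v0) (w v1) cn0) => -[cn E]; rewrite E in wv.
  have c0 : lval_ge 0 (c 0 0).
    by apply/lval_geP => //; have := min0 _ (conj gv vn0); rewrite wv; apply: mulDl_ge0.
  split=> //; apply: key1.
  have -> : c 1 0 *: v1 = v - c 0 0 *: v0 by rewrite Ev addrAC subrr add0r.
  by apply: latticeB => //; apply: latticeZ.
have c1' : lval_ge 0 (c 1 0).
  apply/lval_geP => //; have cc : eqm e (w v) (q * w v0) by rewrite wv; apply: eqm_addl.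
  by have := min1 _ (And3 gv vn0 cc); rewrite wv; apply: mulDl_ge0.
split=> //; apply: key0.
have -> : c 0 0 *: v0 = v - c 1 0 *: v1 by rewrite Ev addrK.
by apply: latticeB => //; apply: latticeZ.
Qed.

Lemma adapted_unitmx b : adapted b -> b \in unitmx.
Proof. by case=> *; apply: (orthogonal_unitmx wN). Qed.

Lemma adapted_wt b c : adapted b -> c != 0 ->
  w (b *m c) = wt e (w (col 0 b)) (w (col 1 b)) c.
Proof. by case=> b0 b1 bc _ cn0; case: (norm_orthogonal wN b0 b1 bc cn0). Qed.

End Adapted.
End Lattices.

(** * Norms defined by a basis *)

Section WeightNorm.
Variable F : fieldType.
Local Notation K := (laurent F).
Local Notation V := 'cV[K]_2.
Implicit Types (v c : V).

Lemma wt_normD e s0 s1 c c' a : 0 < e -> c != 0 -> c' != 0 -> c + c' != 0 ->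
  a <= wt e s0 s1 c -> a <= wt e s0 s1 c' -> a <= wt e s0 s1 (c + c').
Proof.
move=> e0 cn0 cn0' sn0 /(wt_geP _ _ _ _ cn0)[a0 a1] /(wt_geP _ _ _ _ cn0')[a0' a1'].
have key (x y : K) s : (x != 0 -> a <= e * lval x + s) -> (y != 0 -> a <= e * lval y + s) ->
    x + y != 0 -> a <= e * lval (x + y) + s.
  have [->|x0] := eqVneq x 0; first by rewrite add0r => _ Hy yn0; apply: Hy.
  have [->|y0] := eqVneq y 0; first by rewrite addr0 => /(_ isT).
  move=> /(_ isT) ax /(_ isT) ay xy0.
  have [z az zl] : exists2 z, a <= e * z + s & z <= lval (x + y).
    exists (Num.min (lval x) (lval y)); first by case: (leP (lval x)).
    by apply: lvalD_ge => // _; rewrite ge_min lexx ?orbT.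
  by apply: le_trans az _; rewrite lerD2r ler_pM2l.
by apply/wt_geP => //; rewrite !mxE; split; apply: key.
Qed.

Lemma wt_normZ e s0 s1 x c : 0 < e -> x != 0 -> c != 0 ->
  wt e s0 s1 (x *: c) = e * lval x + wt e s0 s1 c.
Proof.
move=> e0 x0 cn0; rewrite /wt !mxE !mulf_eq0 (negbTE x0) /=.
have [c0|c0] := eqVneq (c 0 0) 0.
  by case: (cv2_neq0 cn0) => [/eqP//|c1]; rewrite lvalM// mulrDr addrA.
have [c1|c1] := eqVneq (c 1 0) 0; first by rewrite lvalM// mulrDr addrA.
by rewrite !lvalM// !mulrDr -!addrA lerD2l; case: ifP.
Qed.

Lemma wt_class e s0 s1 c : c != 0 ->
  eqm e (wt e s0 s1 c) s0 \/ eqm e (wt e s0 s1 c) s1.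
Proof.
by case/(wt_attained e s0 s1) => -[_ ->]; [left|right]; apply/eqm_addl/eqm_refl.
Qed.

Lemma wt_delta e s0 s1 (i : 'I_2) :
  wt e s0 s1 (delta_mx i 0 : V) = if i == 0 then s0 else s1.
Proof.
by case: (ord2P i) => ->; rewrite /wt !mxE /= ?eqxx ?oner_eq0 lval1 mulr0 add0r.
Qed.

(** One of the two terms of the determinant dominates: the one given by the
    coordinates at which the norms of the columns are attained. *)
Lemma wt_det e q s0 s1 (h : 'M[K]_2) : 0 < e -> col 0 h != 0 -> col 1 h != 0 ->
    eqm e s1 (q * s0) -> eqm e s0 (q * s1) -> ~ eqm e (q * s0) s0 ->
    eqm e (wt e s0 s1 (col 1 h)) (q * wt e s0 s1 (col 0 h)) ->
  \det h != 0 /\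
  wt e s0 s1 (col 0 h) + wt e s0 s1 (col 1 h) = e * lval (\det h) + s0 + s1.
Proof.
move=> e0 h0 h1 s10 s01 ns cls; rewrite det2.
have n01 : ~ eqm e s1 s0 by move=> s; apply: ns; apply: eqm_trans (eqm_sym s10) s.
have cl (x y : int) : eqm e (e * x + s0) (e * y + s1) -> False.
  by move=> /eqmP[k E]; apply: n01; apply/eqmP; exists (x - y - k); lia.
(* the norms s0 and s1 are in different classes *)
have cln (x y : int) : e * x + s0 <> e * y + s1.
  by move=> xy; apply: (cl x y); rewrite xy; apply: eqm_refl.
have [a0 a1] := (wt_attained e s0 s1 h0, wt_attained e s0 s1 h1).
have /(wt_geP _ _ _ _ h0)[] := lexx (wt e s0 s1 (col 0 h)).
have /(wt_geP _ _ _ _ h1)[] := lexx (wt e s0 s1 (col 1 h)).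
move: a0 a1 cls; set w0 := wt _ _ _ _; set w1 := wt _ _ _ _; rewrite !mxE.
move=> [][x0 E0] [][x1 E1]; rewrite {}E0 {}E1 => cls m01 m11 m00 m10.
- exfalso; case/eqmP: s10 => k1 E1; case/eqmP: cls => k2 E2.
  apply: n01; apply/eqmP; exists (lval (h 0 1) - q * lval (h 0 0) - k2 + k1); lia.
- have [||d1 d2] := @lvalD_lt _ (h 0 0 * h 1 1) (- (h 0 1 * h 1 0)).
  + by rewrite mulf_neq0.
  + rewrite oppr_eq0 mulf_eq0 negb_or lvalN => /andP[y0 y1]; rewrite !lvalM//.
    have := m01 y0; have := m10 y1; have := cln (lval (h 0 0)) (lval (h 1 0)).
    by nia.
  by rewrite d1 d2 lvalM//; split=> //; ring.
- have [||d1 d2] := @lvalD_lt _ (- (h 0 1 * h 1 0)) (h 0 0 * h 1 1).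
  + by rewrite oppr_eq0 mulf_neq0.
  + rewrite mulf_eq0 negb_or lvalN => /andP[y0 y1]; rewrite !lvalM//.
    have := m00 y0; have := m11 y1; have := cln (lval (h 0 0)) (lval (h 1 0)).
    by nia.
  by rewrite addrC d1 d2 lvalN lvalM//; split=> //; ring.
exfalso; case/eqmP: s01 => k1 E1; case/eqmP: cls => k2 E2.
apply: n01; apply/eqmP; exists (- (lval (h 1 1) - q * lval (h 1 0) - k2 + k1)); lia.
Qed.

Lemma wt_is_norm e q s0 s1 (E : 'M[K]_2) : 0 < e -> E \in unitmx ->
    eqm e s1 (q * s0) -> eqm e s0 (q * s1) -> ~ eqm e (q * s0) s0 ->
  is_norm e q (fun v => wt e s0 s1 (invmx E *m v)).
Proof.
move=> e0 EU s10 s01 ns.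
have EV v : v != 0 -> invmx E *m v != 0 by move=> vn0; rewrite unitmx_mulv_eq0 ?unitmx_inv.
have ns1 : ~ eqm e (q * s1) s1.
  by move=> s11; apply: ns; apply: eqm_trans (eqm_sym s10) _;
     apply: eqm_trans (eqm_sym s11) (eqm_sym s01).
have cl v : v != 0 -> eqm e (wt e s0 s1 (invmx E *m v)) s0 \/
   eqm e (wt e s0 s1 (invmx E *m v)) s1 by move=> /EV; apply: wt_class.
split.
- by move=> x v x0 vn0; rewrite -scalemxAr wt_normZ// EV.
- move=> v v' a vn0 v'n0 sn0; rewrite mulmxDr; apply: wt_normD => //;
    by rewrite -?mulmxDr EV.
- move=> v v' /cl + /cl; set x := wt _ _ _ _; set x' := wt _ _ _ _.
  move=> [] xs [] xs'.
  + by left; apply: eqm_trans xs' (eqm_sym xs).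
  + by right; apply: eqm_trans xs' _; apply: eqm_trans s10 _; apply/eqmM/eqm_sym.
  + by right; apply: eqm_trans xs' _; apply: eqm_trans s01 _; apply/eqmM/eqm_sym.
  + by left; apply: eqm_trans xs' (eqm_sym xs).
- move=> v /cl; set x := wt _ _ _ _ => -[] xs qx; [apply: ns|apply: ns1];
    by apply: eqm_trans (eqm_trans qx xs); apply/eqmM/eqm_sym.
- move=> v /cl; set x := wt _ _ _ _.
  have dn0 (i : 'I_2) : delta_mx i 0 != 0 :> V.
    by apply/eqP => /matrixP/(_ i 0)/eqP; rewrite !mxE !eqxx oner_eq0.
  move=> [] xs; [exists (E *m delta_mx 1 0)|exists (E *m delta_mx 0 0)];
    rewrite ?unitmx_mulv_eq0// mulKmx// wt_delta /=.
    by apply: eqm_trans s10 _; apply/eqmM/eqm_sym.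
  by apply: eqm_trans s01 _; apply/eqmM/eqm_sym.
- exists (s0 + s1 - e * lval (\det E)) => b /EV b0 /EV b1.
  have [h bE] : exists h, b = E *m h by exists (invmx E *m b); rewrite mulmxA mulmxV ?mul1mx.
  have cm j : invmx E *m col j b = col j h.
    by rewrite !colE mulmxA bE mulKmx.
  rewrite !cm in b0 b1 *; move=> cls.
  have [dh dhv] := wt_det e0 b0 b1 s10 s01 ns cls.
  rewrite dhv bE det_mulmx lvalM -?unitmx_det_neq0//; first by ring.
  by rewrite unitmx_det_neq0.
Qed.

End WeightNorm.

Section Companion.
Variable F : fieldType.
Local Notation K := (laurent F).
Local Notation V := 'cV[K]_2.

(** A companion matrix with a single slope multiplies the norm by q when the basis
    vectors have norms G and q G. On the left, c' is the image of the vector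
    whose coordinates, after Frobenius, are c. *)
Lemma wt_companion gam del (c c' : V) (Q : int) (G := lval gam) (e := (Q - 1) * (Q + 1)) :
    1 < Q -> gam != 0 -> (del != 0 -> Q * G < (Q + 1) * lval del) ->
    ~~ (Q + 1 %| G)%Z -> c != 0 ->
    c' 0 0 = gam * c 1 0 -> c' 1 0 = c 0 0 + del * c 1 0 ->
  wt e G (Q * G) c' = wt e (Q * G) (Q * (Q * G)) c.
Proof.
move=> Q1 gam0 dP nd cn0 c'0 c'1.
have eG : e * G + G = Q * (Q * G) by rewrite /e; ring.
have dP' : del != 0 -> Q * (Q * G) < e * lval del + Q * G.
  move=> /dP h; have := mulr_gt0 (_ : 0 < Q - 1) (_ : 0 < (Q + 1) * lval del - Q * G).
  rewrite !subr_gt0 => /(_ Q1 h) h'; rewrite /e -subr_gt0; apply: lt_le_trans h' _.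
  by rewrite le_eqVlt; apply/orP; left; apply/eqP; ring.
have e0 : 0 < e by rewrite mulr_gt0 ?subr_gt0//; lia.
(* the two coordinates of c never have the same norm, as q + 1 does not divide G *)
have tie (A B : int) : e * A + Q * G <> e * B + Q * (Q * G).
  move=> AB; move/negP: nd; apply; apply/dvdzP; exists (G - (A - B)).
  apply: (@mulfI _ (Q - 1)); first by lia.
  have : e * A - e * B = Q * (Q * G) - Q * G by rewrite -[Q * (Q * G)](addKr (e * B)) -AB; ring.
  rewrite -mulrBr /e -!mulrA => E.
  have -> : (Q - 1) * ((G - (A - B)) * (Q + 1)) = (Q - 1) * (Q + 1) * G - (Q - 1) * ((Q + 1) * (A - B)) by ring.
  by rewrite E; ring.
rewrite /wt c'0 c'1 mulf_eq0 (negbTE gam0) /=.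
have [c1|c1] := eqVneq (c 1 0) 0.
  by rewrite c1 mulr0 addr0; case: eqP => // c0; case: (cv2_neq0 cn0); rewrite ?c0 ?c1 eqxx.
rewrite lvalM// -/G mulrDr addrAC eG.
have [c0|c0] := eqVneq (c 0 0) 0.
  rewrite c0 add0r mulf_eq0 (negbTE c1) orbF; case: eqP => [_|/eqP d0]; first exact: addrC.
  rewrite lvalM// mulrDr addrAC ifT; first exact: addrC.
  by rewrite lerD2r; apply/ltW/dP'.
set a := lval (c 0 0); set b := lval (c 1 0); have {}tie := tie a b.
have [lt|lt] := ltP (e * a + Q * G) (e * b + Q * (Q * G)).
  have [||h1 ->] := @lvalD_lt _ (c 0 0) (del * c 1 0); first by [].
    rewrite mulf_eq0 negb_or => /andP[d0 _]; rewrite lvalM// -/a -/b.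
    rewrite -(ltr_pM2l e0) -(ltrD2r (Q * G)); apply: (lt_trans lt).
    by rewrite mulrDr [e * lval del + _]addrC -addrA ltrD2l; apply: dP'.
  by rewrite (negbTE h1) -/a (ltW lt) [in X in if X then _ else _]addrC leNgt lt.
have {}lt : e * b + Q * (Q * G) < e * a + Q * G.
  by rewrite lt_neqAle lt andbT; apply/eqP => E; apply: tie.
rewrite [X in _ = (if X then _ else _)]leNgt lt /=.
case: eqP => [_|/eqP s0]; first exact: addrC.
rewrite ifT; first exact: addrC.
rewrite addrC; have [d0|d0] := eqVneq del 0.
  by rewrite d0 mul0r addr0 -/a; apply: ltW.
have ge : Num.min a (lval del + b) <= lval (c 0 0 + del * c 1 0).
  apply: lvalD_ge => // _; first by rewrite ge_min lexx.
  by rewrite lvalM// ge_min lexx orbT.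
have {}ge : e * Num.min a (lval del + b) + Q * G <= e * lval (c 0 0 + del * c 1 0) + Q * G.
  by rewrite lerD2r ler_pM2l.
apply: le_trans ge; case: (leP a) => _; first exact: ltW.
by rewrite mulrDr addrAC addrC lerD2r; apply/ltW/dP'.
Qed.

End Companion.

(** * The norm fixed by a cycle of semilinear maps *)

Section Cycle.
Variables (I : finType) (tau : I -> I).
Hypothesis tau_inj : injective tau.
Hypothesis tau_trans : forall i j, fconnect tau i j.

Lemma order_cycle i : fingraph.order tau i = #|I|.
Proof. by apply: eq_card => j; rewrite inE tau_trans. Qed.

Lemma iter_cycle i : iter #|I| tau i = i.
Proof. by rewrite -(order_cycle i); apply: iter_order. Qed.

Lemma findex_lt i j : (findex tau i j < #|I|)%N.
Proof. by rewrite -(order_cycle i); apply: findex_max. Qed.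

Lemma iter_findex_cycle i j : iter (findex tau i j) tau i = j.
Proof. exact: iter_findex. Qed.

Lemma findex_next i j : (findex tau i j).+1 = findex tau i (tau j) \/
  [/\ (findex tau i j).+1 = #|I|, tau j = i & findex tau i (tau j) = 0%N].
Proof.
have E : tau j = iter (findex tau i j).+1 tau i by rewrite iterS iter_findex_cycle.
have := findex_lt i j; rewrite leq_eqVlt => /orP[/eqP jn|jn].
  have Ei : tau j = i by rewrite E jn iter_cycle.
  by right; split; rewrite // Ei findex0.
by left; rewrite E findex_iter// order_cycle.
Qed.

Lemma card_cycle_gt0 (i : I) : (0 < #|I|)%N.
Proof. by apply/card_gt0P; exists i. Qed.

End Cycle.

Section System.
Variables (F : closedFieldType) (p : nat) (p_gt0 : (0 < p)%N) (p_gt1 : (1 < p)%N).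
Local Notation K := (laurent F).
Local Notation V := 'cV[K]_2.
Local Notation frb := (@frob F p p_gt0).
Variables (I : finType) (tau : I -> I).
Variable D : I -> 'M[K]_2.
Implicit Types (v : V) (i j : I).

Definition phiV i v : V := D i *m map_mx frb v.

Lemma phiVD i v v' : phiV i (v + v') = phiV i v + phiV i v'.
Proof. by rewrite /phiV map_mxD mulmxDr. Qed.

Lemma phiVZ i x v : phiV i (x *: v) = frb x *: phiV i v.
Proof. by rewrite /phiV map_mxZ scalemxAr. Qed.

Lemma phiV0 i : phiV i 0 = 0.
Proof. by rewrite /phiV map_mx0 mulmx0. Qed.

Lemma phiV_mul i (b : 'M[K]_2) c :
  phiV i (b *m c) = (D i *m map_mx frb b) *m map_mx frb c.
Proof. by rewrite /phiV map_mxM mulmxA. Qed.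

Fixpoint phi_iter m i v : V := if m is m'.+1 then phiV (iter m' tau i) (phi_iter m' i v) else v.

Lemma phi_iterS m i v : phi_iter m.+1 i v = phiV (iter m tau i) (phi_iter m i v). Proof. by []. Qed.

Lemma expp_gt0 m : (0 < p ^ m)%N. Proof. by rewrite expn_gt0 p_gt0. Qed.

Lemma phi_iterD m i v v' : phi_iter m i (v + v') = phi_iter m i v + phi_iter m i v'.
Proof. by elim: m => //= m ->; rewrite phiVD. Qed.

Lemma phi_iterZ m i x v : phi_iter m i (x *: v) = frob (expp_gt0 m) x *: phi_iter m i v.
Proof.
elim: m => [|m IH].
  have -> : frob (expp_gt0 0) x = x.
    apply: laurentP => j; have E : (p ^ 0)%N%:Z * j = j by rewrite expn0 mul1r.
    by rewrite -{1}E lcoef_frobM.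
  by [].
have pp : (0 < p * p ^ m)%N by rewrite muln_gt0 p_gt0 expp_gt0.
have E : frb (frob (expp_gt0 m) x) = frob (expp_gt0 m.+1) x.
  rewrite (frobM p_gt0 (expp_gt0 m) pp).
  by move: (expp_gt0 m.+1) pp; rewrite expnS => h pp; rewrite (eq_irrelevance h pp).
by rewrite phi_iterS IH phiVZ E.
Qed.

Hypothesis D_unit : forall i, D i \in unitmx.

Lemma map_frob_eq0 v : (map_mx frb v == 0) = (v == 0).
Proof.
apply/eqP/eqP => [/matrixP v0|->]; last exact: map_mx0.
apply/matrixP => a b; have := v0 a b; rewrite !mxE => /eqP.
by rewrite frob_eq0 => /eqP.
Qed.

Lemma phiV_eq0 i v : (phiV i v == 0) = (v == 0).
Proof. by rewrite unitmx_mulv_eq0// map_frob_eq0. Qed.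

Lemma phi_iter_eq0 m i v : (phi_iter m i v == 0) = (v == 0).
Proof. by elim: m => //= m <-; rewrite phiV_eq0. Qed.

Hypothesis tau_inj : injective tau.
Hypothesis tau_trans : forall i j, fconnect tau i j.
Local Notation n := #|I|.

Hypothesis no_line : forall l : I -> V, (forall i, l i != 0) ->
  ~ (forall i, exists x, phiV i (l i) = x *: l (tau i)).

(** The images along the cycle of a line fixed by the composite form a stable
    family of lines. *)
Lemma no_fixed_line i v x : v != 0 -> phi_iter n i v <> x *: v.
Proof.
move=> vn0 vx; apply: (@no_line (fun j => phi_iter (findex tau i j) i v)).
  by move=> j; rewrite phi_iter_eq0.
move=> j; case: (findex_next tau_inj tau_trans i j) => [<-|[jn _ ->]].
  by exists 1; rewrite scale1r phi_iterS iter_findex_cycle.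
exists x; rewrite [phi_iter 0 _ _]/= -vx -jn phi_iterS.
by rewrite iter_findex_cycle.
Qed.

Local Notation q := (p ^ n)%N.

Lemma q_gt1 (i : I) : (1 < q)%N.
Proof. by rewrite -{1}(exp1n n) ltn_exp2r// (card_cycle_gt0 i). Qed.

Lemma wt_frob e s0 s1 (c : V) :
  wt e (p%:Z * s0) (p%:Z * s1) (map_mx frb c) = p%:Z * wt e s0 s1 c.
Proof.
rewrite /wt !mxE !frob_eq0 !lval_frob !(mulrCA e) -!mulrDr.
by rewrite ler_pM2l ?ltz_nat//; do ![case: ifP => _ //].
Qed.

Lemma map_mx2 (v0 v1 : V) : map_mx frb (mx2 v0 v1) = mx2 (map_mx frb v0) (map_mx frb v1).
Proof. by apply/matrixP => i j; rewrite !mxE; case: ifP. Qed.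

(** The two classes of norms are different because q + 1 is prime to p and does
    not divide G. *)
Lemma eqm_swap (Q G P : int) : 1 < Q -> coprimez (Q + 1) P -> ~~ (Q + 1 %| G)%Z ->
  ~ eqm ((Q - 1) * (Q + 1)) (Q * (P * G)) (P * G).
Proof.
move=> Q1 cop nd /eqmP[k E]; move/negP: nd; apply.
rewrite -(Gauss_dvdzr _ cop); apply/dvdzP; exists k.
apply: (@mulfI _ (Q - 1)); first by lia.
by rewrite mulrBl mul1r E; ring.
Qed.

(** For e1 arbitrary and e2 its image around the cycle, stability of no line
    excludes the first alternative of [companion_dichotomy]. *)
Lemma companion_basis (i0 : I) : exists (e1 e2 : V) (gam del : K),
  [/\ mx2 e1 e2 \in unitmx, phi_iter n i0 e1 = e2, phi_iter n i0 e2 = gam *: e1 + del *: e2,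
      gam != 0 & (del != 0 -> q%:Z * lval gam < (q%:Z + 1) * lval del) /\
     ~~ (q%:Z + 1 %| lval gam)%Z].
Proof.
(* e2 is not a multiple of e1, which would span a fixed line *)
pose e1 : V := delta_mx 0 0; pose e2 := phi_iter n i0 e1.
have e1n : e1 != 0 by apply/eqP => /matrixP/(_ 0 0)/eqP; rewrite !mxE oner_eq0.
have e2n : e2 != 0 by rewrite phi_iter_eq0.
have ind (c : V) : mx2 e1 e2 *m c = 0 -> c = 0.
  rewrite mulmx_col2 col_mx20 col_mx21 => E.
  have c1 : c 1 0 = 0.
    apply/eqP; apply: contraPT E => c1 E.
    apply: (@no_fixed_line i0 e1 (- (c 1 0)^-1 * c 0 0) e1n).
    rewrite -/e2 -scalerA scaleNr -scalerN; apply: (canRL (scalerK c1)).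
    by apply/eqP; rewrite -addr_eq0 addrC E.
  move: E; rewrite c1 scale0r addr0 => /eqP; rewrite scaler_eq0 (negbTE e1n) orbF => /eqP c0.
  by apply: cv2P; rewrite ?c0 ?c1 mxE.
have EU := unitmx_inj ind.
have [gam [del gd]] : exists gam del, phi_iter n i0 e2 = gam *: e1 + del *: e2.
  pose c := invmx (mx2 e1 e2) *m phi_iter n i0 e2; exists (c 0 0), (c 1 0).
  by have := mulmx_col2 (mx2 e1 e2) c; rewrite mulVmxv// col_mx20 col_mx21.
exists e1, e2, gam, del.
have gam0 : gam != 0.
  apply/eqP => g0; apply: (@no_fixed_line i0 e2 del e2n).
  by rewrite gd g0 scale0r add0r.
split=> //; have [[x xP]|//] := companion_dichotomy (expp_gt0 n) (q_gt1 i0) del gam0.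
pose c : V := x *: delta_mx 0 0 + delta_mx 1 0; pose v := mx2 e1 e2 *m c.
have vE : v = e2 + x *: e1.
  by rewrite /v mulmx_col2 !mxE /= col_mx20 col_mx21 mulr1 mulr0 addr0 add0r scale1r addrC.
exfalso; apply: (@no_fixed_line i0 v (frob (expp_gt0 n) x + del)).
  rewrite /v unitmx_mulv_eq0//; apply/eqP => /matrixP/(_ 1 0)/eqP.
  by rewrite !mxE /= mulr0 add0r oner_eq0.
rewrite vE phi_iterD phi_iterZ gd -/e2 scalerDr scalerA [_ * x]mulrC xP.
by rewrite [in RHS]scalerDl [RHS]addrC -addrA; congr (_ + _); exact: addrC.
Qed.

(** The norm is defined by the companion basis in the plane of i0 and by its
    images along the cycle elsewhere, so that compatibility with Phi is only at
    stake when the cycle closes up; this is [wt_companion]. *)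
Lemma system_norm (i0 : I) (e := (q%:Z - 1) * (q%:Z + 1)) : exists w : I -> V -> int,
  (forall i, is_norm e q (w i)) /\
  forall i v, v != 0 -> w (tau i) (phiV i v) = p%:Z * w i v.
Proof.
have [e1 [e2 [gam [del [EU i1 i2 gam0 [dP nd]]]]]] := companion_basis i0.
pose E m := mx2 (phi_iter m i0 e1) (phi_iter m i0 e2).
have ES m : E m.+1 = D (iter m tau i0) *m map_mx frb (E m).
  by rewrite /E map_mx2 mul_mx2.
have EmU m : E m \in unitmx.
  by elim: m => [|m IH]; [exact: EU|rewrite ES unitmx_mul D_unit map_unitmx].
have E0 : E 0%N = mx2 e1 e2 by [].
have En : E n = mx2 e2 (gam *: e1 + del *: e2) by rewrite /E i1 i2.
clearbody E; clear i1 i2.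
pose G := lval gam; pose P m := (p ^ m)%N%:Z.
have q1 : 1 < q%:Z by rewrite ltz_nat; apply: q_gt1.
have e0 : 0 < e by rewrite /e mulr_gt0 ?subr_gt0//; lia.
pose w i v := wt e (P (findex tau i0 i) * G) (P (findex tau i0 i) * (q%:Z * G))
  (invmx (E (findex tau i0 i)) *m v).
exists w; split=> [i|i v vn0].
  rewrite /w; move: (findex tau i0 i) (findex_lt tau_trans i0 i) => m mn.
  apply: (wt_is_norm e0 (EmU m)).
  - by rewrite [q%:Z * (P m * G)]mulrCA; apply: eqm_refl.
  - by apply/eqmP; exists (- (P m * G)); rewrite /e; ring.
  - apply: eqm_swap => //; rewrite coprimezE -PoszD !absz_nat coprimeXr//.
    rewrite -(prednK (card_cycle_gt0 i0)) expnSr.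
    by rewrite /coprime gcdnC gcdnMDl gcdn1.
pose m := findex tau i0 i.
have iE : iter m tau i0 = i by rewrite iter_findex_cycle.
have [c cn0 vE] : exists2 c : V, c != 0 & v = E m *m c.
  by exists (invmx (E m) *m v); rewrite ?mulVmxv// unitmx_mulv_eq0 ?unitmx_inv.
have cn0' : map_mx frb c != 0 by rewrite map_frob_eq0.
have phiE : phiV i v = E m.+1 *m map_mx frb c by rewrite vE phiV_mul ES iE.
have wv : p%:Z * w i v = wt e (P m.+1 * G) (P m.+1 * (q%:Z * G)) (map_mx frb c).
  by rewrite /w -/m vE mulKmx// -wt_frob /P expnS PoszM -!mulrA.
rewrite wv /w phiE; case: (findex_next tau_inj tau_trans i0 i) => [<-|[mn _ ->]].
  by rewrite mulKmx.
rewrite -/m in mn; rewrite /P mn expn0 !mul1r E0 En.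
set c1 := map_mx frb c in cn0' *.
pose c' : V := \col_i (if i == 0 then gam * c1 1 0 else c1 0 0 + del * c1 1 0).
have -> : mx2 e2 (gam *: e1 + del *: e2) *m c1 = mx2 e1 e2 *m c'.
  rewrite !mulmx_col2 !col_mx20 !col_mx21 !mxE /=.
  by rewrite scalerDr !scalerA scalerDl addrCA [_ * gam]mulrC [_ * del]mulrC.
rewrite mulKmx//; apply: (wt_companion (gam := gam) (del := del)) => //;
  by rewrite !mxE.
Qed.

End System.

(** * A dichotomy for lattices *)

Section Dichotomy.
Variable F : fieldType.
Local Notation K := (laurent F).
Local Notation V := 'cV[K]_2.
Implicit Types (v c : V) (g b B h : 'M[K]_2).

Lemma integral_invmx h : integral h -> \det h != 0 -> lval (\det h) = 0 ->
  integral (invmx h).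
Proof.
move=> h0 dn dv i j; rewrite /invmx unitmx_det_neq0 dn !mxE /cofactor det_mx11 !mxE.
apply: lval_ge0M; first by apply/lval_ge_iff => _; rewrite lvalV// dv.
apply: lval_ge0M => //; elim: (_ + _)%N => [|m IH]; first exact: lval_ge_one.
by rewrite exprS; apply: lval_ge0M => //; apply/lval_geN/lval_ge_one.
Qed.

Lemma lattice_lmonoP k B v : B \in unitmx ->
  lattice (lmono F k *: B) v <-> forall r, lval_ge k ((invmx B *m v) r 0).
Proof.
move=> BU; rewrite lattice_scale latticeP// -scalemxAr; split=> H.
  by move=> r; have := H r 0; rewrite mxE -{1}(addNr k) => /lval_ge_mono.
by move=> r j; rewrite (ord1 j) mxE -(addNr k); apply/lval_ge_mono.
Qed.

Lemma lattice_mulP (A : 'M[K]_2) g v :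
  lattice (A *m g) v <-> exists2 x, lattice g x & v = A *m x.
Proof.
split=> [[c c0 <-]|[_ [c c0 <-] ->]]; last by exists c => //; rewrite mulmxA.
by exists (g *m c); [exists c|rewrite mulmxA].
Qed.

Lemma coord_neq0 B v : B \in unitmx -> v != 0 -> invmx B *m v != 0.
Proof. by move=> BU vn0; rewrite unitmx_mulv_eq0 ?unitmx_inv. Qed.

Variables (e q : int) (w : V -> int).
Hypotheses (e_gt0 : 0 < e) (wN : is_norm e q w).

Lemma wt_lmono_ge k s0 s1 c : c != 0 -> s0 < s1 -> (forall r, lval_ge k (c r 0)) ->
  e * k + s0 <= wt e s0 s1 c.
Proof.
move=> cn0 s01 ck; apply/wt_geP => //; split=> cr.
  by rewrite lerD2r ler_pM2l//; apply/lval_geP.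
rewrite lerD// ?(ltW s01)// ler_pM2l//; exact/lval_geP.
Qed.

(** In the tree: B is a vertex, v points from B away from the fixed point and also
    lies in the lattice of g. Either the path from B to the lattice of g starts
    elsewhere, and then all of B is contained in it, or this path also starts
    away from the fixed point, which is the second alternative. If no vector of
    smallest order of the lattice of g has smallest norm, then one such vector
    and v span B modulo u, and Nakayama's lemma gives the first alternative. *)
Lemma lattice_dichotomy B g v : adapted e q w B -> g \in unitmx ->
    lattice B v -> lattice g v -> v != 0 -> w v = w (col 0 B) ->
  lattice B `<=` lattice g \/
  exists k, lattice g `<=` lattice (lmono F k *: B) /\
    exists v', [/\ lattice g v', v' != 0 & w v' = w (col 0 B) + e * k].
Proof.
move=> Bad gU Bv gv vn0 wv; have BU := adapted_unitmx wN Bad.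
have [b0 b1 bc blt] := Bad.
have [N subN] := lattice_commensurable gU BU.
(* x has smallest order in the basis B among the vectors of the lattice of g *)
have [||x [gx xn0] xmin] := @int_min _ (fun x => lattice g x /\ x != 0)
    (fun x => wt 1 0 0 (invmx B *m x)) (- N%:Z).
- by exists v.
- move=> x [gx xn0]; have cn0 := coord_neq0 BU xn0.
  have /(lattice_lmonoP _ _ BU) xN : lattice (lmono F (- N%:Z) *: B) x.
    apply/lattice_scale; rewrite opprK; apply: subN; apply/lattice_scale.
    by rewrite scalerA lmonoVl scale1r.
  by apply/wt_geP => //; split=> cr; rewrite mul1r addr0; apply/lval_geP.
set c := invmx B *m x in xmin *; set k := wt 1 0 0 c in xmin.
have cn0 : c != 0 by apply: coord_neq0.
have subk : lattice g `<=` lattice (lmono F k *: B).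
  move=> y gy; have [->|yn0] := eqVneq y 0; first exact: lattice0.
  have /(wt_geP _ _ _ _ (coord_neq0 BU yn0))[y0 y1] := xmin _ (conj gy yn0).
  apply/lattice_lmonoP => // r; apply/lval_ge_iff.
  by case: (ord2P r) => -> /[dup] cr; [move=> /y0|move=> /y1]; rewrite mul1r addr0.
have [ck0 ck1] : (c 0 0 != 0 -> k <= lval (c 0 0)) /\ (c 1 0 != 0 -> k <= lval (c 1 0)).
  by have /(wt_geP _ _ _ _ cn0) := lexx k; rewrite !mul1r !addr0.
have wx : w x = wt e (w (col 0 B)) (w (col 1 B)) c.
  by rewrite -(adapted_wt wN Bad cn0) mulVmxv.
case: (boolP ((c 0 0 != 0) && (lval (c 0 0) == k))) => [/andP[c0 /eqP ck]|c0].
  right; exists k; split=> //; exists x; split=> //; rewrite wx addrC; apply/eqP.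
  rewrite eq_le; apply/andP; split; last first.
    apply: wt_lmono_ge => // r; apply/lval_ge_iff.
    by case: (ord2P r) => ->; [apply: ck0|apply: ck1].
  have /(wt_geP _ _ _ _ cn0)[/(_ c0) + _] := lexx (wt e (w (col 0 B)) (w (col 1 B)) c).
  by rewrite ck.
have {}ck0 : c 0 0 != 0 -> k + 1 <= lval (c 0 0).
  move=> cn; have := ck0 cn; move: c0; rewrite cn /= => ne le.
  by rewrite lezD1 lt_neqAle eq_sym ne.
left.
have [c1 ck] : c 1 0 != 0 /\ lval (c 1 0) = k.
  case: (wt_attained 1 0 0 cn0) => -[cn]; rewrite -/k mul1r addr0 => // E.
  by have := ck0 cn; rewrite -E gerDl.
set d := invmx B *m v.
have dn0 : d != 0 by apply: coord_neq0.
have d_int : integral d by apply/latticeP.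
have wd : w v = wt e (w (col 0 B)) (w (col 1 B)) d.
  by rewrite -(adapted_wt wN Bad dn0) mulVmxv.
have [d0 dv] : d 0 0 != 0 /\ lval (d 0 0) = 0.
  case: (wt_attained e (w (col 0 B)) (w (col 1 B)) dn0) => -[dn]; rewrite -wd wv => E.
    split=> //; apply: (@mulfI _ e); first by rewrite gt_eqF.
    by apply: (addIr (w (col 0 B))); rewrite -E mulr0 add0r.
  exfalso; apply: (norm_swap wN b0); apply: eqm_trans (eqm_sym bc) _.
  by apply/eqmP; exists (- lval (d 1 0)); rewrite E; ring.
have k0 : k <= 0.
  have /(wt_geP _ _ _ _ dn0)[/(_ d0) + _] := xmin _ (conj gv vn0).
  by rewrite dv mulr0 addr0.
(* modulo u, x' is a multiple of the second vector of B, but v is not *)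
pose x' := lmono F (- k) *: x.
have gx' : lattice g x'.
  apply: latticeZ => //; apply/lval_geP; rewrite ?lmono_neq0// lval_mono.
  by rewrite oppr_ge0.
pose h := mx2 d (lmono F (- k) *: c).
have h0 i j : lval_ge 0 (h i j).
  rewrite mxE; case: ifP => _ //; rewrite mxE -(addNr k); apply/lval_ge_mono/lval_ge_iff.
  case: (ord2P i) => ->; [move=> /ck0|by rewrite ck].
  by apply: le_trans; rewrite lerDl.
have [||dh dhv] := @lvalD_lt _ (d 0 0 * (lmono F (- k) * c 1 0)) (- ((lmono F (- k) * c 0 0) * d 1 0)).
- by rewrite !mulf_neq0// lmono_neq0.
- rewrite oppr_eq0 => H.
  have c0n : c 0 0 != 0 by apply: contraNneq H => ->; rewrite mulr0 mul0r.
  have d1 : d 1 0 != 0 by apply: contraNneq H => ->; rewrite mulr0.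
  rewrite lvalN !lvalM; do ?by rewrite ?mulf_neq0 ?lmono_neq0.
  rewrite !lval_mono dv ck.
  rewrite addNr addr0; apply: ltr_wpDr; first exact: (lval_geP 0 d1).1 (d_int 1 0).
  by rewrite addrC subr_gt0 -lezD1; apply: ck0.
have dE : \det h = d 0 0 * (lmono F (- k) * c 1 0) - (lmono F (- k) * c 0 0) * d 1 0.
  by rewrite det2 !mxE.
rewrite -dE in dh dhv.
have hv : lval (\det h) = 0.
  rewrite dhv !lvalM; do ?by rewrite ?mulf_neq0 ?lmono_neq0.
  by rewrite lval_mono dv ck addNr addr0.
have hE : mx2 v x' = B *m h by rewrite mul_mx2 mulVmxv// -scalemxAr mulVmxv.
have BE : B = mx2 v x' *m invmx h by rewrite hE mulmxK// unitmx_det_neq0.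
rewrite BE => y /(lattice_mul (integral_invmx h0 dh hv)); move: y.
by apply: lattice_sub_lattice; rewrite ?col_mx20 ?col_mx21.
Qed.

End Dichotomy.

(** * Contraction towards the fixed point *)

Section Contraction.
Variables (F : closedFieldType) (p : nat) (p_gt0 : (0 < p)%N).
Local Notation K := (laurent F).
Local Notation V := 'cV[K]_2.
Local Notation frb := (@frob F p p_gt0).
Variables (I : finType) (tau : I -> I).
Variable D : I -> 'M[K]_2.
Hypothesis D_unit : forall i, D i \in unitmx.
Hypothesis tau_inj : injective tau.
Hypothesis tau_trans : forall i j, fconnect tau i j.
Local Notation n := #|I|.
Local Notation q := ((p ^ n)%N%:Z).
Local Notation Phi := (phiV p_gt0 D).
Variables (e : int) (w : I -> V -> int).
Hypotheses (e_gt0 : 0 < e) (wN : forall i, is_norm e q (w i)).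
Hypothesis wPhi : forall i v, v != 0 -> w (tau i) (Phi i v) = p%:Z * w i v.
Implicit Types (i j : I) (v c : V) (b : 'M[K]_2) (g : I -> 'M[K]_2).

Lemma col_phi i b r : col r (D i *m map_mx frb b) = Phi i (col r b).
Proof. by rewrite /phiV map_col colE -mulmxA -colE. Qed.

Lemma adapted_phi i b : adapted e q (w i) b ->
  adapted e q (w (tau i)) (D i *m map_mx frb b).
Proof.
move=> [b0 b1 bc bl]; split; rewrite !col_phi ?phiV_eq0// !wPhi//.
  by rewrite mulrCA; apply: eqmM.
by rewrite ltr_pM2l.
Qed.

Lemma adapted_lmono i b k : adapted e q (w i) b -> adapted e q (w i) (lmono F k *: b).
Proof.
have cl r : col r (lmono F k *: b) = lmono F k *: col r b by rewrite linearZ.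
move=> [b0 b1 bc bl]; split; rewrite !cl.
- by rewrite scaler_eq0 negb_or lmono_neq0.
- by rewrite scaler_eq0 negb_or lmono_neq0.
- rewrite !(normZ (wN i)) ?lmono_neq0// lval_mono; case/eqmP: bc => l ->.
  by apply/eqmP; exists (k - q * k + l); ring.
- by rewrite !(normZ (wN i)) ?lmono_neq0// ltrD2l.
Qed.

Lemma phi_lattice i b v : lattice b v -> lattice (D i *m map_mx frb b) (Phi i v).
Proof.
move=> [c c0 <-]; rewrite phiV_mul; exists (map_mx frb c) => // r.
by rewrite mxE -[X in lval_ge X](mulr0 p%:Z); apply/lval_ge_frob/c0.
Qed.

Lemma phi_lmono i b k :
  D i *m map_mx frb (lmono F k *: b) = lmono F (p%:Z * k) *: (D i *m map_mx frb b).
Proof. by rewrite map_mxZ -scalemxAr; congr (_ *: _); apply: frob_mono. Qed.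

(** Matrices that act on a plane by conjugation with any basis, preserve the
    lattice of this basis and all its homothets, and commute with Frobenius. *)
Definition special (gam : 'M[K]_2) :=
  [/\ \det gam = 1, integral gam, integral (invmx gam) & map_mx frb gam = gam].

Lemma special_unitmx gam : special gam -> gam \in unitmx.
Proof. by case=> d1 _ _ _; rewrite unitmx_det_neq0 d1 oner_neq0. Qed.

Lemma rotated_latticeP B gam h v : lattice (B *m gam *m invmx B *m h) v <->
  exists2 x, lattice h x & v = B *m (gam *m (invmx B *m x)).
Proof.
rewrite lattice_mulP; split=> -[x hx ->]; exists x => //; by rewrite !mulmxA.
Qed.

Lemma rotated_sub B gam h k : B \in unitmx -> special gam ->
  lattice h `<=` lattice (lmono F k *: B) ->
  lattice (B *m gam *m invmx B *m h) `<=` lattice (lmono F k *: B).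
Proof.
move=> BU [_ g0 _ _] sub v /rotated_latticeP[x /sub/(lattice_lmonoP _ _ BU) xk ->].
apply/lattice_lmonoP => // r; rewrite mulKmx// mxE; apply: lval_ge_sum => l _.
by rewrite -[k]add0r; apply: lval_geM; [apply: g0|apply: xk].
Qed.

Lemma rotated_super B gam h k : B \in unitmx -> special gam ->
  lattice (lmono F k *: B) `<=` lattice h ->
  lattice (lmono F k *: B) `<=` lattice (B *m gam *m invmx B *m h).
Proof.
move=> BU gs sub v /(lattice_lmonoP _ _ BU) vk; have gU := special_unitmx gs.
case: gs => _ _ g0 _; apply/rotated_latticeP.
exists (B *m (invmx gam *m (invmx B *m v))); last by rewrite mulKmx// mulVmxv// mulVmxv.
apply/sub/lattice_lmonoP => // r; rewrite mulKmx// mxE; apply: lval_ge_sum => l _.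
by rewrite -[k]add0r; apply: lval_geM; [apply: g0|apply: vk].
Qed.

Definition stable g := forall i v, lattice (g i) v -> lattice (g (tau i)) (Phi i v).

Section Branch.
Variables (g : I -> 'M[K]_2) (j : I) (M : 'M[K]_2).
Hypotheses (gU : forall i, g i \in unitmx) (g_stable : stable g).
Hypothesis M_adapted : adapted e q (w j) M.
Local Notation "'c_ m" := (iter m tau j) (at level 0, m at level 2).

(** The images of M along the cycle, starting at j. *)
Fixpoint branch m : 'M[K]_2 :=
  if m is m'.+1 then D 'c_m' *m map_mx frb (branch m') else M.

Lemma branchS m : branch m.+1 = D 'c_m *m map_mx frb (branch m). Proof. by []. Qed.

Lemma branch_adapted m : adapted e q (w 'c_m) (branch m).
Proof. by elim: m => // m IH; rewrite branchS iterS; apply: adapted_phi. Qed.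

Lemma branch_unitmx m : branch m \in unitmx.
Proof. exact: (adapted_unitmx (wN _) (branch_adapted m)). Qed.

Lemma norm_branch m : w 'c_m (col 0 (branch m)) = (p ^ m)%N%:Z * w j (col 0 M).
Proof.
elim: m => [|m IH]; first by rewrite mul1r.
rewrite branchS iterS col_phi wPhi ?IH ?expnS ?PoszM ?mulrA//.
exact: adapted0 (branch_adapted m).
Qed.

(** The m-th lattice branches off the vertex [branch m] away from the fixed point:
    it has a vector of smallest norm among those of the homothet of [branch m]
    that just contains it. *)
Definition follows m k :=
  lattice (g 'c_m) `<=` lattice (lmono F k *: branch m) /\
  exists v, [/\ lattice (g 'c_m) v, v != 0
              & w 'c_m v = w 'c_m (col 0 (branch m)) + e * k].

(** The condition under which the (m + 1)-st lattice need not move when the m-th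
    one is rotated about [branch m]. *)
Definition contains m k := lattice (lmono F (p%:Z * k) *: branch m.+1) `<=` lattice (g 'c_m.+1).

(** [lattice_dichotomy], applied to the image of the homothet of [branch m] and to
    the image of a vector of smallest norm. *)
Lemma follows_next m k : follows m k -> contains m k \/ exists k', follows m.+1 k'.
Proof.
move=> [sub [v [gv vn0 wv]]].
pose B := lmono F (p%:Z * k) *: branch m.+1.
have Bad : adapted e q (w 'c_m.+1) B by apply/adapted_lmono/branch_adapted.
have B0 : w 'c_m.+1 (col 0 B) = e * (p%:Z * k) + w 'c_m.+1 (col 0 (branch m.+1)).
  have -> : col 0 B = lmono F (p%:Z * k) *: col 0 (branch m.+1) by rewrite linearZ.
  rewrite (normZ (wN _)) ?lmono_neq0// ?lval_mono//.
  exact: adapted0 (branch_adapted m.+1).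
have [||||//|[k' [sub' [v' [gv' v'n0 wv']]]]] :=
    lattice_dichotomy e_gt0 (wN _) (v := Phi 'c_m v) Bad (gU 'c_m.+1).
- by rewrite /B -phi_lmono; apply/phi_lattice/sub.
- exact: g_stable.
- by rewrite phiV_eq0.
- rewrite B0 [LHS]wPhi// wv branchS iterS col_phi wPhi; first by ring.
  exact: adapted0 (branch_adapted m).
- by left.
right; exists (p%:Z * k + k'); split.
  by rewrite addrC lmonoD -scalerA.
exists v'; split=> //; rewrite wv' B0; ring.
Qed.

Lemma follows_chain s : (exists k, follows 0 k) -> 
  (forall m, (m <= s)%N -> exists k, follows m k) \/
  exists2 t, (t < s)%N & (forall m, (m <= t)%N -> exists k, follows m k) /\
    exists2 k, follows t k & contains t k.
Proof.
move=> f0; elim: s => [|s [IH|[t ts H]]]; first by left; case.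
  have [k fk] := IH s (leqnn s); have [ck|fk'] := follows_next fk.
    by right; exists s => //; split=> //; exists k.
  by left=> m; rewrite leq_eqVlt => /orP[/eqP ->//|]; apply: IH.
by right; exists t => //; apply: ltnW.
Qed.

Hypothesis M_sub : lattice (lmono F 1 *: M) `<=` lattice (g j).
Hypothesis M_start : forall i v, tau i = j -> lattice (g i) v ->
  lattice (lmono F 1 *: M) (Phi i v).

Definition rotate t gam i :=
  if (findex tau j i <= t)%N
  then let B := branch (findex tau j i) in B *m gam *m invmx B *m g i
  else g i.

(** The two ways in which the propagation of a rotation ends: at a lattice that
    need not move, or at the end of the cycle. *)
Definition stops t :=
  (t.+1 < n)%N /\ (exists2 k, follows t k & contains t k) \/
  t.+1 = n /\ exists2 k, follows t k &
    lattice (lmono F (p%:Z * k) *: branch n) `<=` lattice (lmono F 1 *: M).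

(** Between two rotated lattices the condition holds because gam commutes with
    Phi; at the end of the rotated part it holds because the homothets of the
    vertices [branch m] are invariant under gam, and at j because u M is. *)
Lemma rotate_stable t gam : stops t -> special gam -> stable (rotate t gam).
Proof.
move=> st gs i v; rewrite /rotate.
set m := findex tau j i; have iE : iter m tau j = i by apply: iter_findex_cycle.
have Phib (c : V) : Phi i (branch m *m c) = branch m.+1 *m map_mx frb c.
  by rewrite phiV_mul branchS iE.
have next k : lattice (g i) `<=` lattice (lmono F k *: branch m) ->
    forall v, lattice (branch m *m gam *m invmx (branch m) *m g i) v ->
    lattice (lmono F (p%:Z * k) *: branch m.+1) (Phi i v).
  move=> sub x /(rotated_sub (branch_unitmx m) gs sub).
  by rewrite branchS iE -phi_lmono; apply: phi_lattice.
have mt_n : (t < n)%N by case: st => -[]; [move=> /ltnW|move=> <-].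
case: (findex_next tau_inj tau_trans j i) => [mE|[mn tj ->]].
  have tiE : iter m.+1 tau j = tau i by rewrite iterS iE.
  rewrite -mE -/m; case: ifP => [mt|/negbT mt]; last first.
    by rewrite ifF; [apply: g_stable|apply: contraNF mt => /ltnW].
  case: ifP => [mt'|/negbT mt'].
    move=> /rotated_latticeP[x gx ->]; apply/rotated_latticeP.
    exists (Phi i x); first exact: g_stable.
    have xE : Phi i x = branch m.+1 *m map_mx frb (invmx (branch m) *m x).
      by rewrite -(Phib (invmx (branch m) *m x)) mulVmxv// branch_unitmx.
    rewrite xE mulKmx ?branch_unitmx// (Phib (gam *m (invmx (branch m) *m x))).
    by rewrite map_mxM; case: gs => _ _ _ ->.
  have tm : t = m by apply/eqP; rewrite eqn_leq mt andbT leqNgt.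
  have mn : (m.+1 < n)%N by rewrite mE findex_lt.
  move=> gv; case: st => -[]; last by rewrite tm => E; rewrite E ltnn in mn.
  rewrite tm => _ [k [sub _] ct]; move: sub ct; rewrite /contains iE tiE => sub ct.
  by apply/ct/next.
rewrite leq0n tj; have -> : branch 0 = M by [].
move=> gv; apply: (rotated_super (branch_unitmx 0) gs M_sub); move: gv.
case: ifP => [mt|_]; last exact: M_start.
have tn : t.+1 = n by apply/eqP; rewrite eqn_leq mt_n -mn ltnS.
have tm : t = m by apply: succn_inj; rewrite tn.
case: st => -[]; first by rewrite tn ltnn.
move=> _ [k [sub _]] ct gv; apply: ct; rewrite tm iE in sub.
by rewrite -mn; apply: next gv.
Qed.

(** A rotated lattice stays in the same homothet of [branch m], in which it already
    had a vector of smallest norm. *)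
Lemma rotate_bound t gam i a : (forall m, (m <= t)%N -> exists k, follows m k) -> special gam ->
  (forall v, lattice (g i) v -> v != 0 -> a <= w i v) ->
  forall v, lattice (rotate t gam i) v -> v != 0 -> a <= w i v.
Proof.
move=> fw gs ga v; rewrite /rotate; case: ifP => [mt|_]; last exact: ga.
set m := findex tau j i in mt *; have iE : iter m tau j = i by apply: iter_findex_cycle.
have [k [sub [v0 [gv0 v0n wv0]]]] := fw m mt; rewrite iE in sub gv0 wv0.
move=> /(rotated_sub (branch_unitmx m) gs sub)/(lattice_lmonoP _ _ (branch_unitmx m)) vk vn0.
apply: le_trans (ga _ gv0 v0n) _; rewrite wv0 addrC.
have := branch_adapted m; rewrite iE => bad.
rewrite -{1}(mulVmxv v (branch_unitmx m)) (adapted_wt (wN _) bad) ?coord_neq0 ?branch_unitmx//.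
by apply: wt_lmono_ge => //; rewrite ?coord_neq0 ?branch_unitmx//; case: bad.
Qed.

(** The lattice at j consists of the vectors of M whose second coordinate is
    divisible by u. A matrix with zero upper left entry maps it to vectors whose
    first coordinate is divisible by u, and only the first basis vector of M has
    smallest norm. *)
Lemma rotate_strict t gam v : special gam -> gam 0 0 = 0 ->
    (forall v, lattice (g j) v -> forall r, lval_ge (r == 1 :> 'I_2)%:R ((invmx M *m v) r 0)) ->
  lattice (rotate t gam j) v -> v != 0 -> w j (col 0 M) < w j v.
Proof.
move=> gs g00 gM; rewrite /rotate findex0 leq0n.
have MU : M \in unitmx := branch_unitmx 0.
have -> : branch 0 = M by [].
move=> /rotated_latticeP[x /gM xM ->] vn0; set c := invmx M *m x in xM *.
have gcn0 : gam *m c != 0 by apply: contraNneq vn0 => ->; rewrite mulmx0.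
rewrite (adapted_wt (wN _) M_adapted)//; case: gs => _ g0 _ _.
have c0 : lval_ge 1 ((gam *m c) 0 0).
  by rewrite mxE sum2 g00 mul0r add0r -[X in lval_ge X]add0r; apply: lval_geM; [apply: g0|apply: (xM 1)].
have c1 : lval_ge 0 ((gam *m c) 1 0).
  rewrite mxE; apply: lval_ge_sum => l _; apply: lval_ge0M; first exact: g0.
  by apply: lval_ge_le (xM l); case: (l == 1).
case: (wt_attained e (w j (col 0 M)) (w j (col 1 M)) gcn0) => -[cn ->].
  by rewrite ltrDr mulr_gt0//; apply: (lt_le_trans ltr01); apply/lval_geP.
apply: lt_le_trans (adapted_lt M_adapted) _; rewrite lerDr mulr_ge0 ?(ltW e_gt0)//.
exact/lval_geP.
Qed.

(** After a full turn, M and its image lie on opposite sides of the fixed point.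
    The image y of a vector of smallest norm has a norm in the class of the
    second basis vector of M. As y lies in u M, its norm, which is the smallest
    one on the given homothet of [branch n], is at least that of u times the
    second basis vector, and all vectors of such norm lie in u M. *)
Lemma follows_around k : (0 < n)%N -> follows n.-1 k ->
  lattice (lmono F (p%:Z * k) *: branch n) `<=` lattice (lmono F 1 *: M).
Proof.
move=> n0 [sub [v [gv vn0 wv]]] z.
have MU : M \in unitmx := branch_unitmx 0.
have tj : tau (iter n.-1 tau j) = j by rewrite -iterS prednK// iter_cycle.
have bn0 := adapted0 (branch_adapted n.-1).
set y := Phi (iter n.-1 tau j) v.
have yn0 : y != 0 by rewrite phiV_eq0.
have yM : lattice (lmono F 1 *: M) y := M_start tj gv.
set w0 := w j (col 0 M); set w1 := w j (col 1 M).
have wy : w j y = q * w0 + e * (p%:Z * k).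
  rewrite -[in LHS]tj wPhi// wv norm_branch -(prednK n0) expnS PoszM /w0; ring.
have wy1 : e + w1 <= w j y.
  have cn0 := coord_neq0 MU yn0.
  move/(lattice_lmonoP _ _ MU) : yM => c1; move: wy.
  rewrite -{1 2}(mulVmxv y MU) (adapted_wt (wN j) M_adapted cn0).
  case: (wt_attained e w0 w1 cn0) => -[cn ->] E; last first.
    by rewrite lerD2r -[leLHS]mulr1 ler_pM2l//; apply/lval_geP.
  exfalso; apply: (norm_swap (wN j) (adapted0 M_adapted)).
  apply/eqmP; exists (lval ((invmx M *m y) 0 0) - p%:Z * k).
  apply: (addIr (e * (p%:Z * k))); rewrite -E /w0; ring.
have [->|zn0] := eqVneq z 0; first by move=> _; apply: lattice0.
move=> /(lattice_lmonoP _ _ (branch_unitmx n)) zk.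
have wz : e + w1 <= w j z.
  apply: le_trans wy1 _; rewrite wy.
  have := branch_adapted n; have := norm_branch n; rewrite iter_cycle// => wbn nad.
  rewrite -(mulVmxv z (branch_unitmx n)) (adapted_wt (wN j) nad) ?coord_neq0 ?branch_unitmx//.
  rewrite /w0 -wbn addrC; apply: wt_lmono_ge => //.
    by rewrite coord_neq0 ?branch_unitmx.
  exact: adapted_lt nad.
have dn0 := coord_neq0 MU zn0.
move: wz; rewrite -{1}(mulVmxv z MU) (adapted_wt (wN j) M_adapted dn0).
move=> /(wt_geP _ _ _ _ dn0)[d0 d1]; apply/lattice_lmonoP => // r.
have bd s x : s <= w1 -> e + w1 <= e * x + s -> 1 <= x.
  move=> sw1 le; rewrite -(ler_pM2l e_gt0) mulr1 -(lerD2r w1).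
  by apply: le_trans le _; rewrite lerD2l.
apply/lval_ge_iff; case: (ord2P r) => -> dn.
  exact: bd (ltW (adapted_lt M_adapted)) (d0 dn).
exact: bd (lexx _) (d1 dn).
Qed.

End Branch.

(** The lattice is an end of the edge that contains the fixed point. *)
Definition settled i b := w i (col 1 b) < w i (col 0 b) + e.

(** The matrix is a basis of u M, where M is the neighbour of the lattice of b
    towards the fixed point. *)
Definition startable g j b := forall i v, tau i = j -> lattice (g i) v ->
  lattice (mx2 (lmono F 1 *: col 0 b) (col 1 b)) (Phi i v).

(** The contraction step. G is the set of lattices that move, and E consists of
    the bases through which SL_2(F) acts. *)
Lemma contraction g j b :
    (forall i, g i \in unitmx) -> stable g ->
    adapted e q (w j) b -> lattice b = lattice (g j) -> ~~ (settled j b) -> startable g j b ->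
  exists (G : pred I) (E : I -> 'M[K]_2), (forall i, E i \in unitmx) /\
    forall gam, special gam ->
    let g' := fun i => if G i then E i *m gam *m invmx (E i) *m g i else g i in
    [/\ stable g',
       forall i a, (forall v, lattice (g i) v -> v != 0 -> a <= w i v) ->
          forall v, lattice (g' i) v -> v != 0 -> a <= w i v
     & gam 0 0 = 0 -> forall v, lattice (g' j) v -> v != 0 -> w j (col 0 b) < w j v].
Proof.
move=> gU gst bad bL nset start; have [b0 b1 bc blt] := bad.
(* the neighbour of the lattice of b towards the fixed point *)
pose M := mx2 (col 0 b) (lmono F (-1) *: col 1 b).
have M0 : col 0 M = col 0 b by apply: col_mx20.
have M1 : col 1 M = lmono F (-1) *: col 1 b by apply: col_mx21.
have wM1 : w j (col 1 M) = e * -1 + w j (col 1 b).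
  by rewrite M1 (normZ (wN j)) ?lmono_neq0// lval_mono.
have Mad : adapted e q (w j) M.
  split; rewrite ?M0 ?wM1//; first by rewrite M1 scaler_eq0 negb_or lmono_neq0.
    exact: eqm_addl.
  move: nset; rewrite /settled -leNgt => le.
  have lt : w j (col 0 b) + e < w j (col 1 b).
    rewrite lt_neqAle le andbT; apply/eqP => E.
    apply: (norm_swap (wN j) b0); apply: eqm_trans (eqm_sym bc) _.
    by apply/eqmP; exists 1; rewrite mulr1.
  by rewrite mulrN1 addrC ltrBrDr.
have uM : lmono F 1 *: M = mx2 (lmono F 1 *: col 0 b) (col 1 b).
  have cl r : col r (lmono F 1 *: M) = lmono F 1 *: col r M by rewrite linearZ.
  apply: col_eqP; rewrite cl ?M0 ?M1 ?col_mx20 ?col_mx21//.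
  by rewrite scalerA -lmonoD subrr scale1r.
have Msub : lattice (lmono F 1 *: M) `<=` lattice (g j).
  rewrite uM -bL; apply: lattice_sub_lattice; rewrite ?col_mx20 ?col_mx21; last exact: lattice_col.
  apply: latticeZ; last exact: lattice_col.
  by apply/lval_geP; rewrite ?lmono_neq0// lval_mono.
have Mst i v : tau i = j -> lattice (g i) v -> lattice (lmono F 1 *: M) (Phi i v).
  by rewrite uM; apply: start.
have gM v : lattice (g j) v -> forall r, lval_ge (r == 1 :> 'I_2)%:R ((invmx M *m v) r 0).
  rewrite -bL => -[c c0 <-] r.
  (* the second coordinate in M of a vector of the lattice is divisible by u *)
  pose d : V := \col_l (if l == 0 then c 0 0 else lmono F 1 * c 1 0).
  have -> : b *m c = M *m d.
    rewrite !mulmx_col2 M0 M1 !mxE /= scalerA [_ * c 1 0]mulrC -mulrA -lmonoD subrr.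
    by rewrite mulr1.
  rewrite mulKmx; last exact: (adapted_unitmx (wN j) Mad).
  rewrite mxE; case: (ord2P r) => -> /=; first exact: c0.
  by rewrite -[1%:R]addr0; apply/lval_ge_mono; apply: c0.
have f0 : exists k, follows g j M 0 k.
  exists 0; split.
    move=> v /gM vM; apply/lattice_lmonoP; first exact: (adapted_unitmx (wN j) Mad).
    by move=> r; apply: lval_ge_le (vM r); case: (r == 1).
  exists (col 0 b); split=> //; first by rewrite /= -bL; apply: lattice_col.
  by rewrite mulr0 addr0 -M0.
have n0 : (0 < n)%N := card_cycle_gt0 j.
have [t [fw st]] : exists t, (forall m, (m <= t)%N -> exists k, follows g j M m k) /\ stops g j M t.
  case: (follows_chain gU gst Mad n.-1 f0) => [fw|[t tn [fw fk]]]; last first.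
    by exists t; split=> //; left; split=> //; rewrite -ltn_predRL.
  exists n.-1; split=> //; right; split; first by rewrite prednK.
  have [k fk] := fw _ (leqnn n.-1); exists k => //.
  exact: follows_around fk.
exists (fun i => findex tau j i <= t)%N, (fun i => branch j M (findex tau j i)).
split=> [i|gam gs]; first exact: (branch_unitmx Mad).
split.
- exact: (rotate_stable gst Mad Msub Mst st gs).
- by move=> i a ga v; apply: (rotate_bound Mad fw gs ga).
- by move=> g00 v gv; rewrite -M0; apply: (rotate_strict Mad gs g00 gM gv).
Qed.

End Contraction.

(** * Configurations that cannot be contracted *)

Section AdaptedLattice.
Variable F : fieldType.
Local Notation K := (laurent F).
Local Notation V := 'cV[K]_2.
Implicit Types (v : V) (b : 'M[K]_2).
Variables (e q : int) (w : V -> int).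
Hypotheses (e_gt0 : 0 < e) (wN : is_norm e q w).

Lemma adapted_coord b v : adapted e q w b -> v != 0 ->
  w v = wt e (w (col 0 b)) (w (col 1 b)) (invmx b *m v).
Proof.
move=> bad vn0; have bU := adapted_unitmx wN bad.
by rewrite -(adapted_wt wN bad (coord_neq0 bU vn0)) mulVmxv.
Qed.

Lemma adapted_min b v : adapted e q w b -> lattice b v -> v != 0 -> w (col 0 b) <= w v.
Proof.
move=> bad bv vn0; have bU := adapted_unitmx wN bad; rewrite (adapted_coord bad vn0).
rewrite -[leLHS]add0r -[X in X + _](mulr0 e); apply: wt_lmono_ge => //.
- exact: coord_neq0.
- exact: adapted_lt bad.
- by move/(latticeP _ bU) : bv => bv r; apply: bv.
Qed.

Lemma adapted_primitive b v : adapted e q w b -> v != 0 -> w v = w (col 0 b) ->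
  (invmx b *m v) 0 0 != 0 /\ lval ((invmx b *m v) 0 0) = 0.
Proof.
move=> bad vn0; have bU := adapted_unitmx wN bad; rewrite (adapted_coord bad vn0).
have [b0 _ bc _] := bad.
case: (wt_attained e (w (col 0 b)) (w (col 1 b)) (coord_neq0 bU vn0)) => -[cn ->] E.
  split=> //; apply: (@mulfI _ e); first by rewrite gt_eqF.
  by apply: (addIr (w (col 0 b))); rewrite mulr0 add0r.
exfalso; apply: (norm_swap wN b0); apply: eqm_trans (eqm_sym bc) _.
by apply/eqmP; exists (- lval ((invmx b *m v) 1 0)); rewrite -E; ring.
Qed.

Lemma ball_sub_lattice b v : adapted e q w b -> v != 0 ->
  w (col 1 b) < w v + e -> w (col 0 b) <= w v -> lattice b v.
Proof.
move=> bad vn0 w1 w0; have bU := adapted_unitmx wN bad; apply/latticeP => // i j.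
have : w v <= w v by []; rewrite {2}(adapted_coord bad vn0).
move=> /(wt_geP _ _ _ _ (coord_neq0 bU vn0))[c0 c1].
rewrite (ord1 j); apply/lval_ge_iff; case: (ord2P i) => -> cn.
  by apply: mulDl_ge0 e_gt0 _; apply: le_trans w0 (c0 cn).
have : 0 < e * (lval ((invmx b *m v) 1 0) + 1).
  rewrite mulrDr mulr1 -(ltrD2r (w (col 1 b))) add0r addrAC.
  by apply: lt_le_trans w1 _; rewrite lerD2r; apply: c1.
by rewrite pmulr_rgt0// -[0 < _]/(_) ltzD1.
Qed.

Lemma settled_lattice b v : adapted e q w b -> w (col 1 b) < w (col 0 b) + e ->
  lattice b v <-> (v != 0 -> w (col 0 b) <= w v).
Proof.
move=> bad st; split=> [bv vn0|H]; first exact: adapted_min.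
have [->|vn0] := eqVneq v 0; first exact: lattice0.
apply: ball_sub_lattice => //; last exact: H.
by apply: lt_le_trans st _; rewrite lerD2r; apply: H.
Qed.

(** An adapted lattice is spanned by any of its vectors of smallest norm and the
    vectors whose norm is at least that of the second basis vector. So it is
    determined by one such vector and this number. *)
Lemma lattice_of_primitive b y v : adapted e q w b -> lattice b y -> y != 0 ->
    w y = w (col 0 b) ->
  lattice b v <-> exists2 x, lval_ge 0 x & (v - x *: y != 0 -> w (col 1 b) <= w (v - x *: y)).
Proof.
move=> bad by_ yn0 wy; have bU := adapted_unitmx wN bad.
have [d0 d0v] := adapted_primitive bad yn0 wy.
set d := invmx b *m y in d0 d0v.
split=> [bv|[x x0 H]]; last first.
  rewrite -[v](subrK (x *: y)); apply: latticeD; last exact: latticeZ.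
  have [->|zn0] := eqVneq (v - x *: y) 0; first exact: lattice0.
  have {}H := H zn0; apply: ball_sub_lattice => //.
    by apply: le_lt_trans H _; rewrite ltrDl.
  exact: le_trans (ltW (adapted_lt bad)) H.
pose c := invmx b *m v; have c_int : integral c by apply/latticeP.
have d_int : integral d by apply/latticeP.
have x0 : lval_ge 0 (c 0 0 / d 0 0).
  apply: lval_ge0M; first exact: c_int.
  by apply/lval_ge_iff => _; rewrite lvalV// d0v.
exists (c 0 0 / d 0 0) => // zn0.
rewrite (adapted_coord bad zn0) mulmxBr -scalemxAr -/c -/d.
have cn0 : c - (c 0 0 / d 0 0) *: d != 0.
  by rewrite /c /d scalemxAr -mulmxBr coord_neq0.
clearbody c d; apply/wt_geP => //; split=> cn.
  by move: cn; rewrite !mxE mulfVK// subrr eqxx.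
apply: le_mulDl => //; apply/lval_geP => //; rewrite !mxE.
by apply: lval_geB; [apply: c_int|apply: lval_ge0M => //; apply: d_int].
Qed.

End AdaptedLattice.

Section Minimal.
Variables (F : closedFieldType) (p : nat) (p_gt0 : (0 < p)%N).
Local Notation K := (laurent F).
Local Notation V := 'cV[K]_2.
Variables (I : finType) (tau : I -> I).
Variable D : I -> 'M[K]_2.
Hypothesis D_unit : forall i, D i \in unitmx.
Hypothesis tau_inj : injective tau.
Hypothesis tau_trans : forall i j, fconnect tau i j.
Local Notation n := #|I|.
Local Notation q := ((p ^ n)%N%:Z).
Local Notation Phi := (phiV p_gt0 D).
Variables (e : int) (w : I -> V -> int).
Hypotheses (e_gt0 : 0 < e) (wN : forall i, is_norm e q (w i)).
Hypothesis wPhi : forall i v, v != 0 -> w (tau i) (Phi i v) = p%:Z * w i v.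
Implicit Types (i j : I) (v c : V) (b g : I -> 'M[K]_2).

(** No contraction step applies. *)
Definition minimal g := forall j (b : 'M[K]_2), adapted e q (w j) b -> lattice b = lattice (g j) ->
  ~~ settled e w j b -> ~ startable p_gt0 tau D g j b.

Definition adapted_to b g := forall i, adapted e q (w i) (b i) /\ lattice (b i) = lattice (g i).

Lemma adapted_to_exists g : (forall i, g i \in unitmx) -> exists b, adapted_to b g.
Proof.
move=> gU; suff /fin_all_exists[b bP] : forall i, exists b : 'M[K]_2,
    adapted e q (w i) b /\ lattice b = lattice (g i) by exists b.
by move=> i; have [b [_ bL bad]] := lattice_adapted e_gt0 (wN i) (gU i); exists b.
Qed.

(** The distance to the fixed point only depends on the smallest norm, once the
    determinant is given. *)
Lemma adapted_volume g g' b b' i :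
    (forall i, g i \in unitmx) -> (forall i, g' i \in unitmx) ->
    adapted_to b g -> adapted_to b' g' -> lval (\det (g i)) = lval (\det (g' i)) ->
  w i (col 0 (b i)) + w i (col 1 (b i)) = w i (col 0 (b' i)) + w i (col 1 (b' i)).
Proof.
move=> gU gU' bg bg' dets.
have latdet (h h' : 'M[K]_2) : h \in unitmx -> h' \in unitmx -> lattice h = lattice h' ->
    lval (\det h) = lval (\det h').
  move=> hU hU' hh; apply/eqP; rewrite eq_le.
  by rewrite !lattice_sub_det// ?hh.
have [kap kapP] := norm_vol (wN i); have [[bad bL] [bad' bL']] := (bg i, bg' i).
have [bU bU'] := (adapted_unitmx (wN i) bad, adapted_unitmx (wN i) bad').
have [[? ? ? _] [? ? ? _]] := (bad, bad').
rewrite !kapP//; congr (e * _ + _).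
by rewrite (latdet _ (g i))// (latdet (b' i) (g' i)).
Qed.

Lemma minimal_step g b i : adapted_to b g -> stable p_gt0 tau D g ->
  w (tau i) (col 0 (b (tau i))) <= p%:Z * w i (col 0 (b i)).
Proof.
move=> bg gst; have [bad bL] := bg i; have [bad' bL'] := bg (tau i).
have b0 := adapted0 bad.
rewrite -wPhi//; apply: (adapted_min e_gt0 (wN _) bad'); rewrite ?phiV_eq0//.
by rewrite bL'; apply: gst; rewrite -bL; apply: lattice_col.
Qed.

(** The contraction step does not apply, so some vector of the image of the
    previous lattice involves the first basis vector with a unit coefficient,
    and has smallest norm. *)
Lemma minimal_not_settled g b i : adapted_to b g -> stable p_gt0 tau D g -> minimal g ->
  ~~ settled e w (tau i) (b (tau i)) ->
  w (tau i) (col 0 (b (tau i))) = p%:Z * w i (col 0 (b i)).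
Proof.
move=> bg gst gm ns; apply/eqP; rewrite eq_le (minimal_step i bg gst) andTb.
have [bad bL] := bg i; have [bad' bL'] := bg (tau i).
have bU := adapted_unitmx (wN _) bad'.
rewrite leNgt; apply/negP => lt; apply: (gm _ _ bad' bL' ns) => i' v /tau_inj -> gv.
have [->|vn0] := eqVneq v 0; first by rewrite phiV0; apply: lattice0.
have yn0 : Phi i v != 0 by rewrite phiV_eq0.
set y := Phi i v in yn0 *; pose d := invmx (b (tau i)) *m y.
have /(latticeP _ bU) d_int : lattice (b (tau i)) y by rewrite bL'; apply: gst.
have wy : w (tau i) (col 0 (b (tau i))) < w (tau i) y.
  by apply: lt_le_trans lt _; rewrite wPhi// ler_pM2l ?ltz_nat//;
    apply: (adapted_min e_gt0 (wN _) bad); rewrite ?bL.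
have yE : y = d 0 0 *: col 0 (b (tau i)) + d 1 0 *: col 1 (b (tau i)).
  by rewrite -mulmx_col2 mulVmxv.
have d0 : lval_ge 1 (d 0 0).
  apply/lval_ge_iff => d0; move: wy.
  have /(wt_geP _ _ _ _ (coord_neq0 bU yn0))[/(_ d0) + _] := lexx (wt e (w (tau i) (col 0 (b (tau i)))) (w (tau i) (col 1 (b (tau i)))) d).
  rewrite -(adapted_coord (wN _) bad' yn0) => le lt'.
  have := lt_le_trans lt' le; rewrite ltrDr pmulr_rgt0//.
pose d' : V := \col_r (if r == 0 then lmono F (-1) * d 0 0 else d 1 0).
exists d'.
  move=> r; rewrite mxE; case: ifP => _; last exact: (d_int 1 0).
  by rewrite -[0](addNr 1); apply/lval_ge_mono.
rewrite yE mulmx_col2 col_mx20 col_mx21 !mxE /= scalerA.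
by rewrite mulrAC -lmonoD addNr mul1r.
Qed.

(** The norms of an adapted basis have a fixed sum and lie in different classes,
    so their difference cannot be smaller than for an end of the central edge. *)
Lemma settled_max g g' b b' j : adapted_to b g -> adapted_to b' g' ->
    w j (col 0 (b j)) + w j (col 1 (b j)) = w j (col 0 (b' j)) + w j (col 1 (b' j)) ->
    settled e w j (b j) ->
  w j (col 0 (b' j)) <= w j (col 0 (b j)).
Proof.
move=> /(_ j)[[b0 b1 bc bl] _] /(_ j)[[b0' b1' bc' bl'] _]; rewrite /settled.
have := norm_class (wN j) b0 b0'; move: bc bl bl'.
move: (w j (col 0 (b j))) (w j (col 1 (b j))) (w j (col 0 (b' j))) (w j (col 1 (b' j))).
move=> a c a' c' ca ac a'c' cl S st; rewrite leNgt; apply/negP => lt.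
(* two norms in the same class differ by at least e *)
have small (x y : int) : eqm e x y -> y < x -> x < y + e -> False.
  move=> /eqmP[k ->]; rewrite ltrDl ltrD2l pmulr_rgt0// => k0.
  by rewrite gtr_pMr// => k1; lia.
have c'c : c' < c by move: S lt; lia.
case: cl => cl; first by apply: (small a' a cl lt); move: st; lia.
apply: (small c a' (eqm_trans ca (eqm_sym cl))); lia.
Qed.

(** Otherwise the smallest norm would be multiplied by q around the cycle, which
    would change its class. *)
Lemma exists_settled g b (i0 : I) : adapted_to b g -> stable p_gt0 tau D g -> minimal g ->
  exists j, settled e w j (b j).
Proof.
move=> bg gst gm; apply: contrapT => none.
have ns j : ~~ settled e w j (b j) by apply/negP => st; apply: none; exists j.
have pw m : w (iter m tau i0) (col 0 (b (iter m tau i0))) = (p ^ m)%N%:Z * w i0 (col 0 (b i0)).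
  elim: m => [|m IH]; first by rewrite mul1r.
  by rewrite iterS (minimal_not_settled bg gst gm (ns _)) IH expnS PoszM mulrA.
have := pw n; rewrite iter_cycle// => E.
by apply: (norm_swap (wN i0) (adapted0 (bg i0).1)); rewrite -E; apply: eqm_refl.
Qed.

(** Start at a settled lattice, where the smallest norm is as large as possible,
    and follow the recursion of [minimal_not_settled]. *)
Lemma minimal_le g g' b b' : adapted_to b g -> stable p_gt0 tau D g -> minimal g ->
    adapted_to b' g' -> stable p_gt0 tau D g' ->
    (forall j, w j (col 0 (b j)) + w j (col 1 (b j)) =
       w j (col 0 (b' j)) + w j (col 1 (b' j))) ->
  forall i, w i (col 0 (b' i)) <= w i (col 0 (b i)).
Proof.
move=> bg gst gm bg' gst' S i; have [j stj] := exists_settled i bg gst gm.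
rewrite -(iter_findex_cycle tau_trans j i); elim: (findex _ _ _) => [|m IH].
  exact: settled_max bg bg' (S j) stj.
rewrite iterS; set l := iter m tau j in IH *.
case: (boolP (settled e w (tau l) (b (tau l)))) => [st|ns].
  exact: settled_max bg bg' (S _) st.
rewrite (minimal_not_settled bg gst gm ns).
by apply: le_trans (minimal_step _ bg' gst') _; rewrite ler_pM2l ?ltz_nat.
Qed.

(** By symmetry of [minimal_le] the smallest norms agree. A settled lattice is a
    ball; any other one is determined by the previous lattice, whose vectors of
    smallest norm have images of smallest norm. *)
Lemma minimal_unique g g' : (forall i, g i \in unitmx) -> (forall i, g' i \in unitmx) ->
    stable p_gt0 tau D g -> stable p_gt0 tau D g' ->
    (forall i, lval (\det (g i)) = lval (\det (g' i))) ->
    minimal g -> minimal g' ->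
  forall i, lattice (g i) = lattice (g' i).
Proof.
move=> gU gU' gst gst' dets gm gm' i.
have [[b bg] [b' bg']] := (adapted_to_exists gU, adapted_to_exists gU').
have S j : w j (col 0 (b j)) + w j (col 1 (b j)) = w j (col 0 (b' j)) + w j (col 1 (b' j)).
  exact: adapted_volume gU gU' bg bg' (dets j).
have a_eq j : w j (col 0 (b j)) = w j (col 0 (b' j)).
  by apply/eqP; rewrite eq_le (minimal_le bg' gst' gm' bg gst) ?(minimal_le bg gst gm bg' gst').
have c_eq j : w j (col 1 (b j)) = w j (col 1 (b' j)).
  by apply: (addrI (w j (col 0 (b j)))); rewrite {2}a_eq.
have [j stj] := exists_settled i bg gst gm.
have settled_eq l : settled e w l (b l) -> lattice (g l) = lattice (g' l).
  move=> st; have [[bad bL] [bad' bL']] := (bg l, bg' l).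
  have st' : settled e w l (b' l) by rewrite /settled -c_eq -a_eq.
  rewrite -bL -bL'; apply/seteqP; split=> v.
    by move/(settled_lattice e_gt0 (wN l) v bad st) => H; apply/(settled_lattice e_gt0 (wN l) v bad' st'); rewrite -a_eq.
  by move/(settled_lattice e_gt0 (wN l) v bad' st') => H; apply/(settled_lattice e_gt0 (wN l) v bad st); rewrite a_eq.
rewrite -(iter_findex_cycle tau_trans j i); elim: (findex _ _ _) => [|m IH].
  exact: settled_eq.
rewrite iterS; set l := iter m tau j in IH *.
case: (boolP (settled e w (tau l) (b (tau l)))) => [st|ns]; first exact: settled_eq.
have [[bad bL] [bad' bL']] := (bg (tau l), bg' (tau l)).
have wl := minimal_not_settled bg gst gm ns.
have [badl bLl] := bg l; have b0 := adapted0 badl.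
pose y := Phi l (col 0 (b l)).
have yn0 : y != 0 by rewrite phiV_eq0.
have gl : lattice (g l) (col 0 (b l)) by rewrite -bLl; apply: lattice_col.
have gy : lattice (b (tau l)) y by rewrite bL; apply: gst.
have gy' : lattice (b' (tau l)) y by rewrite bL'; apply: gst'; rewrite -IH.
have wy : w (tau l) y = w (tau l) (col 0 (b (tau l))) by rewrite wPhi.
have wy' : w (tau l) y = w (tau l) (col 0 (b' (tau l))) by rewrite wy a_eq.
rewrite -bL -bL'; apply/seteqP; split=> v.
  move/(lattice_of_primitive e_gt0 (wN _) v bad gy yn0 wy) => H.
  by apply/(lattice_of_primitive e_gt0 (wN _) v bad' gy' yn0 wy'); rewrite -c_eq.
move/(lattice_of_primitive e_gt0 (wN _) v bad' gy' yn0 wy') => H.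
by apply/(lattice_of_primitive e_gt0 (wN _) v bad gy yn0 wy); rewrite c_eq.
Qed.

End Minimal.

(** * Cartan decomposition for two by two matrices *)

Section Cartan.
Variable F : fieldType.
Local Notation K := (laurent F).
Implicit Types (C P Q : 'M[K]_2).

Lemma GL2_integralM P Q : GL2_integral P -> GL2_integral Q -> GL2_integral (P *m Q).
Proof.
move=> [PU P0 P1] [QU Q0 Q1]; split; first by rewrite unitmx_mul PU.
  exact: integralM P0 Q0.
have -> : invmx (P *m Q) = invmx Q *m invmx P.
  apply: (can_inj (mulKmx (_ : P *m Q \in unitmx))); first by rewrite unitmx_mul PU.
  rewrite mulmxV ?unitmx_mul ?PU// mulmxA -[P *m Q *m _]mulmxA mulmxV// mulmx1 mulmxV//.
exact: integralM Q1 P1.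
Qed.

Lemma GL2_integral_det P : GL2_integral P -> \det P != 0 /\ lval (\det P) = 0.
Proof.
move=> [PU P0 P1]; have dP : \det P != 0 by rewrite -unitmx_det_neq0.
have dV : \det (invmx P) = (\det P)^-1 by rewrite det_inv.
split=> //; apply/eqP; rewrite eq_le; apply/andP; split; last first.
  exact: (lval_geP 0 dP).1 (integral_det P0).
rewrite -oppr_ge0 -lvalV// -dV; apply/lval_geP; last exact: integral_det.
by rewrite dV invr_eq0.
Qed.

Lemma integral_perm (s : {perm 'I_2}) : integral (perm_mx s : 'M[K]_2).
Proof. by move=> i j; rewrite !mxE; case: (_ == _); [apply: lval_ge_one|apply: lval_ge_zero]. Qed.

Lemma GL2_integral_perm (s : {perm 'I_2}) : GL2_integral (perm_mx s : 'M[K]_2).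
Proof.
have E : perm_mx s *m perm_mx s^-1 = 1%:M :> 'M[K]_2 by rewrite -perm_mxM mulgV perm_mx1.
have sU : (perm_mx s : 'M[K]_2) \in unitmx by have [] := mulmx1_unit E.
split=> //; first exact: integral_perm.
have -> : invmx (perm_mx s : 'M[K]_2) = perm_mx s^-1 by rewrite -[RHS](mulKmx sU) E mulmx1.
exact: integral_perm.
Qed.

Lemma GL2_integral_of_det P : integral P -> \det P != 0 -> lval (\det P) = 0 -> GL2_integral P.
Proof.
by move=> P0 dP dv; split=> //; [rewrite unitmx_det_neq0|apply: integral_invmx].
Qed.

Lemma unit_part (x : K) : x != 0 ->
  exists y, [/\ y != 0, lval y = 0 & x = y * lmono F (lval x)].
Proof.
move=> x0; exists (x * lmono F (- lval x)); split.
- by rewrite mulf_neq0 ?lmono_neq0.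
- by rewrite lvalM ?lmono_neq0// lval_mono subrr.
- by rewrite -mulrA -lmonoD addNr mulr1.
Qed.

(** Elimination with a pivot of least valuation. The pivot is in the lower right
    corner because the second exponent of a dominant cocharacter is the
    smaller one. *)
Lemma cartan_pivot C : \det C != 0 -> C 1 1 != 0 ->
    (forall i j, C i j != 0 -> lval (C 1 1) <= lval (C i j)) ->
  exists (P Q : 'M[K]_2) (ab : int * int), [/\ GL2_integral P, GL2_integral Q,
    C = P *m diag_upow F ab *m Q, ab.2 = lval (C 1 1) & ab.2 <= ab.1].
Proof.
move=> dC x0 Cmin; set x := C 1 1 in x0 Cmin *.
pose y := C 0 0 - C 0 1 * C 1 0 / x.
have dE : \det C = y * x by rewrite det2 /y mulrBl mulfVK.
have y0 : y != 0 by apply: contraNneq dC => y0; rewrite dE y0 mul0r.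
have xy : lval x <= lval y.
  have quo i j : C i j != 0 -> lval_ge 0 (C i j / x).
    by move=> c0; apply/lval_ge_iff => _; rewrite lvalM ?invr_eq0// lvalV// subr_ge0 Cmin.
  have ge i j : lval_ge (lval x) (C i j) by apply/lval_ge_iff; apply: Cmin.
  apply/lval_geP => //; apply: lval_geB => //; rewrite -mulrA -[lval x]addr0.
  apply: lval_geM => //; have [->|/quo//] := eqVneq (C 1 0) 0.
  by rewrite mul0r; apply: lval_ge_zero.
have quo i j : lval_ge 0 (C i j / x).
  have [->|c0] := eqVneq (C i j) 0; first by rewrite mul0r; apply: lval_ge_zero.
  by apply/lval_ge_iff => _; rewrite lvalM ?invr_eq0// lvalV// subr_ge0 Cmin.
have [eps [eps0 epsv yE]] := unit_part y0; have [eta [eta0 etav xE]] := unit_part x0.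
have vi z : z != 0 -> lval z = 0 -> lval_ge 0 z by move=> z0 zv; apply/lval_geP; rewrite ?zv.
pose P : 'M[K]_2 := \matrix_(i, j) if i == 0 then (if j == 0 then eps else C 0 1 / x * eta)
   else if j == 0 then 0 else eta.
pose Q : 'M[K]_2 := \matrix_(i, j) if i == 0 then (if j == 0 then 1 else 0)
   else if j == 0 then C 1 0 / x else 1.
exists P, Q, (lval y, lval x); split=> //.
- apply: GL2_integral_of_det; rewrite ?det2 ?mxE /= ?mulr0 ?subr0 ?mulf_neq0//.
    move=> i j; rewrite mxE; case: ifP => _; case: ifP => _.
    - exact: vi eps0 epsv.
    - by apply: lval_ge0M; [exact: quo|exact: vi].
    - exact: lval_ge_zero.
    - exact: vi eta0 etav.
  by rewrite lvalM// epsv etav.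
- apply: GL2_integral_of_det; rewrite ?det2 ?mxE /= ?mul0r ?subr0 ?mulr1 ?oner_eq0 ?lval1//.
  by move=> i j; rewrite mxE; do 2![case: ifP => _ //]; apply: lval_ge_one.
apply/matrixP => i j; rewrite !mxE !sum2 !mxE !sum2 !mxE /=.
case: (ord2P i) => ->; case: (ord2P j) => -> /=; rewrite ?mulr0 ?mul0r ?addr0 ?add0r ?mulr1.
- by rewrite -yE -(mulrA (C 0 1 / x) eta) -xE mulfVK// /y [_ * (C 1 0 / x)]mulrA subrK.
- by rewrite -mulrA -xE mulfVK.
- by rewrite add0r -xE mulrC mulfVK.
- by rewrite -xE.
Qed.

Lemma cartan C a : integral C -> \det C != 0 -> lval (\det C) = a ->
  exists (P Q : 'M[K]_2) (ab : int * int), [/\ GL2_integral P, GL2_integral Q,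
    C = P *m diag_upow F ab *m Q, ab.1 + ab.2 = a & 0 <= ab.2 <= ab.1].
Proof.
move=> C0 dC da.
have [||[r s] /= Crs Cmin] := @int_min _ (fun ij : 'I_2 * 'I_2 => C ij.1 ij.2 != 0)
    (fun ij => lval (C ij.1 ij.2)) 0.
- apply: contrapT => none; move/negP: dC; apply; rewrite det2.
  have z i j : C i j = 0 by apply/eqP; apply: contrapT => /negP c0; apply: none; exists (i, j).
  by rewrite !z mulr0 subrr.
- by move=> [i j] /= c0; apply/lval_geP => //; apply: C0.
(* move the pivot to the lower right corner *)
pose S := perm_mx (tperm r 1) : 'M[K]_2; pose S' := perm_mx (tperm s 1) : 'M[K]_2.
pose C' := S *m C *m S'.
have C'E i j : C' i j = C (tperm r 1 i) (tperm s 1 j).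
  by rewrite /C' /S' -[tperm s 1]invgK -col_permE -row_permE !mxE invgK tpermV.
have C'11 : C' 1 1 = C r s by rewrite C'E !tpermR.
have [S0 S'0] : GL2_integral S /\ GL2_integral S' by split; apply: GL2_integral_perm.
have [[dS _] [dS' _]] := (GL2_integral_det S0, GL2_integral_det S'0).
have [||i j|P [Q [ab [P0 Q0 CE ab2 ab12]]]] := @cartan_pivot C'.
- by rewrite /C' !det_mulmx !mulf_neq0.
- by rewrite C'11.
- by rewrite C'11 C'E => c0; apply: (Cmin (_, _)).
have SS (t : 'I_2) : perm_mx (tperm t 1) *m perm_mx (tperm t 1) = 1%:M :> 'M[K]_2.
  by rewrite -perm_mxM tperm2 perm_mx1.
exists (S *m P), (Q *m S'), ab.
have E : C = (S *m P) *m diag_upow F ab *m (Q *m S').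
  rewrite !mulmxA -(mulmxA S P) -(mulmxA S _ Q) -CE /C' !mulmxA SS mul1mx -mulmxA SS.
  by rewrite mulmx1.
have SP := GL2_integralM S0 P0; have QS := GL2_integralM Q0 S'0.
split=> //.
  have [[d1 v1] [d2 v2]] := (GL2_integral_det SP, GL2_integral_det QS).
  have dD : \det (diag_upow F ab) = lmono F ab.1 * lmono F ab.2.
    by rewrite det2 !mxE /= mulr0 subr0.
  rewrite -da E !det_mulmx -!det_mulmx [in RHS]det_mulmx [in RHS]det_mulmx dD.
  by rewrite !lvalM ?mulf_neq0 ?lmono_neq0// v1 v2 !lval_mono add0r addr0.
by rewrite ab12 andbT ab2 C'11; apply/lval_geP => //; apply: C0.
Qed.

Lemma cartan_integral P Q ab : GL2_integral P -> GL2_integral Q -> 0 <= ab.2 <= ab.1 ->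
  integral (P *m diag_upow F ab *m Q) /\ lval (\det (P *m diag_upow F ab *m Q)) = ab.1 + ab.2.
Proof.
move=> P0 Q0 /andP[b0 ba]; split.
  apply: integralM; last by case: Q0.
  apply: integralM; first by case: P0.
  have m0 c : 0 <= c -> lval_ge 0 (lmono F c) by move=> c0; apply/lval_geP; rewrite ?lmono_neq0 ?lval_mono.
  move=> i j; rewrite mxE; do 2![case: ifP => _ //]; apply: m0 => //.
  exact: le_trans ba.
have dD : \det (diag_upow F ab) = lmono F ab.1 * lmono F ab.2.
  by rewrite det2 !mxE /= mulr0 subr0.
have [[d1 v1] [d2 v2]] := (GL2_integral_det P0, GL2_integral_det Q0).
rewrite !det_mulmx dD.
by rewrite !lvalM ?mulf_neq0 ?lmono_neq0// v1 v2 !lval_mono add0r addr0.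
Qed.

End Cartan.

(** * Components of a module over the product ring *)

Section Components.
Variables (n : nat) (F : closedFieldType) (T : comNzRingType).
Variables (iF : {rmorphism F -> T}) (theta : 'I_n -> {rmorphism T -> F}).
Hypothesis thetaP : is_identification iF theta.
Local Notation K := (laurent F).
Local Notation I := 'I_n.

Lemma theta_iF i x : theta i (iF x) = x.
Proof. by case: thetaP. Qed.

Lemma theta_inj t t' : (forall i, theta i t = theta i t') -> t = t'.
Proof.
case: thetaP => _ /bij_inj tinj tt'; apply: tinj; apply/ffunP => i.
by rewrite !ffunE.
Qed.

Lemma theta_surj (f : I -> F) : exists t, forall i, theta i t = f i.
Proof.
case: thetaP => _ [inv _ invK]; exists (inv [ffun i => f i]) => i.
by have /ffunP/(_ i) := invK [ffun i => f i]; rewrite !ffunE.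
Qed.

Lemma index_exists : exists i : I, True.
Proof.
apply: contrapT => none; have /eqP := oner_neq0 T; apply.
by apply: theta_inj => i; exfalso; apply: none; exists i.
Qed.

(** An algebra morphism from F^n to F is nonzero on one of the idempotents, and then
    it is the corresponding projection. *)
Lemma theta_complete (chi : {rmorphism T -> F}) : (forall x, chi (iF x) = x) ->
  exists l, chi =1 theta l.
Proof.
move=> chiF.
have /fin_all_exists[idem idemP] : forall l : I, exists t, forall i, theta i t = (i == l)%:R.
  by move=> l; apply: theta_surj.
have sum1 : \sum_l idem l = 1.
  apply: theta_inj => i; rewrite rmorph_sum rmorph1 (bigD1 i)//= idemP eqxx.
  by rewrite big1 ?addr0// => l li; rewrite idemP eq_sym (negbTE li).
(* the idempotents sum to 1 *)
have [l chil] : exists l, chi (idem l) != 0.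
  apply: contrapT => none; have /eqP := oner_neq0 F; apply.
  rewrite -(rmorph1 chi) -sum1 rmorph_sum big1// => l _.
  by apply/eqP; apply: contrapT => /negP h; apply: none; exists l.
exists l => t; apply: (mulfI chil).
have -> : theta l t = chi (iF (theta l t)) by rewrite chiF.
rewrite -!rmorphM; congr (chi _); apply: theta_inj => i.
by rewrite !rmorphM theta_iF idemP; case: eqP => [->|]; rewrite ?mul0r.
Qed.

Definition component m (v : 'M[laurent T]_(2, m)) (i : I) : 'M[K]_(2, m) := map_mx (lmap (theta i)) v.

Lemma component_inj m (v v' : 'M[laurent T]_(2, m)) : (forall i, component v i = component v' i) -> v = v'.
Proof.
move=> vv'; apply/matrixP => r s; apply: laurentP => j; apply: theta_inj => i.
by have /matrixP/(_ r s) := vv' i; rewrite !mxE => /(congr1 (fun f => lcoef f j)).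
Qed.

Lemma lglue (f : I -> K) : exists h : laurent T, forall i, lmap (theta i) h = f i.
Proof.
have /choice[t tP] : forall j : int, exists t, forall i, theta i t = lcoef (f i) j.
  by move=> j; apply: theta_surj.
have /fin_all_exists[N NP] : forall i, exists N : nat, forall j : int, j < - N%:Z -> lcoef (f i) j = 0.
  by move=> i; apply: lcoef_bound.
have bd : `[< bounded_below t >].
  apply/asboolP; exists (- (\max_i N i)%N%:Z) => j jN; apply: theta_inj => i.
  rewrite tP rmorph0; apply: NP; apply: lt_le_trans jN _.
  by rewrite lerN2 lez_nat leq_bigmax.
by exists (Laurent bd) => i; apply: laurentP => j /=; rewrite tP.
Qed.

Lemma glue_components m (f : I -> 'M[K]_(2, m)) : exists v, forall i, component v i = f i.
Proof.
have /fin_all_exists[h hP] : forall rs : 'I_2 * 'I_m,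
    exists h : laurent T, forall i, lmap (theta i) h = f i rs.1 rs.2.
  by move=> rs; apply: lglue.
by exists (\matrix_(r, s) h (r, s)) => i; apply/matrixP => r s; rewrite !mxE hP.
Qed.

Lemma componentM m (A : 'M[laurent T]_2) (v : 'M[laurent T]_(2, m)) i :
  component (A *m v) i = component A i *m component v i.
Proof. exact: map_mxM. Qed.

Lemma component1 i : component 1%:M i = 1%:M.
Proof. exact: map_mx1. Qed.

Lemma component0 m i : component (0 : 'M[laurent T]_(2, m)) i = 0.
Proof. exact: map_mx0. Qed.

Lemma componentD m (v v' : 'M[laurent T]_(2, m)) i : component (v + v') i = component v i + component v' i.
Proof. exact: map_mxD. Qed.

Lemma componentZ m x (v : 'M[laurent T]_(2, m)) i : component (x *: v) i = lmap (theta i) x *: component v i.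
Proof. exact: map_mxZ. Qed.

Lemma component_unitmx (g : 'M[laurent T]_2) : g \in unitmx <-> forall i, component g i \in unitmx.
Proof.
split=> [gU i|gU].
  by rewrite unitmxE det_map_mx rmorph_unit// -unitmxE.
have [h hP] := glue_components (fun i => invmx (component g i)).
have E : g *m h = 1%:M by apply: component_inj => i; rewrite componentM hP component1 mulmxV.
by have [] := mulmx1_unit E.
Qed.

Lemma component_invmx (g : 'M[laurent T]_2) i : g \in unitmx -> component (invmx g) i = invmx (component g i).
Proof.
move=> gU; have giU := (component_unitmx g).1 gU i.
by rewrite -[LHS](mulKmx giU) -componentM mulmxV// component1 mulmx1.
Qed.

Lemma lval_ge_comp a (f : laurent T) : lval_ge a f <-> forall i, lval_ge a (lmap (theta i) f).
Proof.
split=> [fa i|fa j ja]; first exact: lval_ge_map.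
by apply: theta_inj => i; rewrite rmorph0; apply: fa.
Qed.

Lemma component_lattice (g : 'M[laurent T]_2) v : g \in unitmx ->
  lattice g v <-> forall i, lattice (component g i) (component v i).
Proof.
move=> gU; split=> [[c c0 <-] i|gv].
  exists (component c i); last by rewrite componentM.
  by move=> r; rewrite mxE; apply/lval_ge_map/c0.
exists (invmx g *m v); last by rewrite mulVmxv.
move=> r; apply/lval_ge_comp => i.
have giU := (component_unitmx g).1 gU i.
have /(latticeP _ giU)/(_ r 0) := gv i.
by rewrite -component_invmx// -componentM mxE.
Qed.

Lemma component_std_lattice a (v : 'cV[laurent T]_2) :
  std_lattice T a v <-> forall i, std_lattice F a (component v i).
Proof.
split=> [va i r|va r]; first by rewrite mxE; apply/lval_ge_map/va.
by apply/lval_ge_comp => i; have := va i r; rewrite mxE.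
Qed.

Lemma component_GL2_integral (P : 'M[laurent T]_2) :
  GL2_integral P <-> forall i, GL2_integral (component P i).
Proof.
split=> [[PU P0 P1] i|P0].
  split; first exact: (component_unitmx P).1.
    by move=> r s; rewrite mxE; apply/lval_ge_map/P0.
  by move=> r s; rewrite -component_invmx// mxE; apply/lval_ge_map/P1.
have PU : P \in unitmx by apply/component_unitmx => i; case: (P0 i).
split=> // r s; apply/lval_ge_comp => i; have [_ Pi Pi1] := P0 i.
  by have := Pi r s; rewrite mxE.
by have := Pi1 r s; rewrite -component_invmx// mxE.
Qed.

Section PhiModule.
Variables (p : nat) (p_gt0 : (0 < p)%N) (phi : {rmorphism T -> T}).
Hypothesis phiF : forall x, phi (iF x) = iF x.
Local Notation frb := (@frob F p p_gt0).

Lemma phi_shift : exists sigma : I -> I, forall i t, theta i (phi t) = theta (sigma i) t.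
Proof.
have ex i : exists l, forall t, theta i (phi t) = theta l t.
  by have [|l lP] := @theta_complete (theta i \o phi); [move=> x /=; rewrite phiF theta_iF|exists l].
by have /fin_all_exists[sigma sP] := ex; exists sigma.
Qed.

Variable sigma : I -> I.
Hypothesis sigmaP : forall i t, theta i (phi t) = theta (sigma i) t.

Lemma component_lfrob m (v : 'M[laurent T]_(2, m)) i :
  component (map_mx (lfrob p phi) v) i = map_mx frb (component v (sigma i)).
Proof.
apply/matrixP => r s; rewrite !mxE; apply: laurentP => j /=; rewrite /lfrob_fun.
by case: ifP => _; rewrite ?rmorph0//= sigmaP.
Qed.

Variable A : 'M[laurent T]_2.

(** The vectors whose components vanish on an orbit of sigma form a stable
    submodule, which is proper and, if the orbit is not everything, nonzero. *)
Lemma simple_shift_orbit : simple_phi_module p phi A -> forall i j, fconnect sigma i j.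
Proof.
move=> simple i0 j; apply: contrapT => /negP nij.
pose M : set 'cV[laurent T]_2 := [set v | forall i, fconnect sigma i0 i -> component v i = 0].
have [|||M0] := simple M.
- split=> [i _|v w Mv Mw i ii|a v Mv i ii]; first exact: component0.
    by rewrite componentD Mv// Mw// addr0.
  by rewrite componentZ Mv// scaler0.
- move=> v Mv i ii; rewrite componentM component_lfrob Mv ?map_mx0 ?mulmx0//.
  exact: connect_trans ii (fconnect1 _ _).
- move=> M0; have [v vP] := glue_components (fun i => if i == j then const_mx 1 else 0 : 'cV[K]_2).
  have : M v by move=> i ii; rewrite vP; case: eqP => // ij; rewrite -ij ii in nij.
  rewrite M0 /= => v0; have := vP j; rewrite eqxx v0 component0 => /matrixP/(_ 0 0)/eqP.
  by rewrite !mxE eq_sym oner_eq0.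
have : M (const_mx 1) by rewrite M0.
move=> /(_ i0 (connect0 _ _))/matrixP/(_ 0 0)/eqP.
by rewrite !mxE rmorph1 oner_eq0.
Qed.

(** A stable family of lines is a stable submodule, neither zero nor everything. *)
Lemma simple_no_line : simple_phi_module p phi A ->
  forall l : I -> 'cV[K]_2, (forall i, l i != 0) ->
  ~ (forall i, exists x, component A i *m map_mx frb (l (sigma i)) = x *: l i).
Proof.
move=> simple l ln0 lP; have [i0 _] := index_exists.
pose M : set 'cV[laurent T]_2 := [set v | forall i, exists x, component v i = x *: l i].
have [|||M0] := simple M.
- split=> [i|v w Mv Mw i|a v Mv i]; first by exists 0; rewrite component0 scale0r.
    by have [[x vx] [y wy]] := (Mv i, Mw i); exists (x + y); rewrite componentD vx wy scalerDl.
  by have [x vx] := Mv i; exists (lmap (theta i) a * x); rewrite componentZ vx scalerA.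
- move=> v Mv i; have [[x vx] [y ly]] := (Mv (sigma i), lP i).
  by exists (frb x * y); rewrite componentM component_lfrob vx map_mxZ -scalemxAr ly scalerA.
- move=> M0; have [v vP] := glue_components l.
  have : M v by move=> i; exists 1; rewrite vP scale1r.
  by rewrite M0 /= => v0; have := ln0 i0; rewrite -vP v0 component0 eqxx.
pose w0 : 'cV[K]_2 := delta_mx 0 0; pose w1 : 'cV[K]_2 := delta_mx 1 0.
have [[v vP] [v' v'P]] := (glue_components (fun=> w0), glue_components (fun=> w1)).
have : M v /\ M v' by rewrite M0.
move=> [/(_ i0)[x] + /(_ i0)[y]]; rewrite vP v'P => xE yE.
have E : \det (mx2 w0 w1) = 1 by rewrite det2 !mxE /= mulr1 mulr0 subr0.
have : \det (mx2 w0 w1) = 0.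
  by rewrite det2 xE yE !mxE /=; ring.
by rewrite E => /eqP; rewrite oner_eq0.
Qed.

End PhiModule.
End Components.

(** * Pluecker coordinates *)

Section PluckerPolynomials.
Variables (n : nat) (F : fieldType).

Lemma meval_homog m (P : mpoly m F) d c (v : 'I_m -> F) : P \is ishomog1 d mdeg ->
  meval (fun i => c * v i) P = c ^+ d * meval v P.
Proof.
move=> /dhomogP Pd; rewrite !mevalE mulr_sumr; apply: eq_big_seq => mn mnP.
have -> : d = mdeg mn := esym (Pd mn mnP).
rewrite mulrCA; congr (_ * _); rewrite mdegE -prodrXr.
by rewrite -big_split; apply: eq_bigr => i _ /=; rewrite exprMn.
Qed.

Lemma pluckerM N d (X : 'M[F]_d) (B : 'M[F]_(d, vdim n N)) J :
  plucker (X *m B) J = \det X * plucker B J.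
Proof.
rewrite /plucker -det_mulmx; congr (\det _); apply/matrixP => i j.
by rewrite !mxE; apply: eq_bigr => l _; rewrite !mxE.
Qed.

Lemma plucker_poly N d (B0 B1 : 'M[F]_(d, vdim n N)) (P : mpoly (plucker_dim n N d) F) :
  exists R : {poly F}, forall t, R.[t] = meval (plucker (B0 + t *: B1)) P.
Proof.
pose pl (J : 'I_(plucker_dim n N d)) : {poly F} :=
  \det (colsub (enum_val J) (map_mx polyC B0 + 'X *: map_mx polyC B1)).
exists (\sum_(m <- msupp P) mcoeff m P *: \prod_i pl i ^+ m i) => t.
rewrite mevalE horner_sum; apply: eq_bigr => m _.
rewrite hornerZ horner_prod; congr (_ * _); apply: eq_bigr => J _.
rewrite horner_exp; congr (_ ^+ _).
rewrite -/(horner_eval t (pl J)) /pl -det_map_mx; congr (\det _).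
apply/matrixP => i j; rewrite !mxE; set b0 := B0 _ _; set b1 := B1 _ _.
by rewrite -[LHS]/((b0%:P + 'X * b1%:P).[t]) !hornerE.
Qed.

End PluckerPolynomials.

Section BasisChange.
Variables (n : nat) (F : fieldType) (T : comNzRingType).
Variable theta : 'I_n -> {rmorphism T -> F}.

Lemma basis_sub N d d' (L : affgr theta) (B : 'M[F]_(d, vdim n N)) (B' : 'M[F]_(d', vdim n N)) :
  is_basis L B -> is_basis L B' -> (B' <= B)%MS.
Proof.
move=> [_ HB] [_ HB']; apply/row_subP => i; apply/HB/HB'; exact: row_sub.
Qed.

(** Two bases of the same subspace differ by an invertible matrix, which multiplies
    all Pluecker coordinates by its determinant. *)
Lemma basic_open_basis N (P : forall d, mpoly (plucker_dim n N d) F) (L : affgr theta)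
    d (B : 'M[F]_(d, vdim n N)) :
    (forall d, exists e, P d \is ishomog1 e mdeg) -> is_basis L B ->
  meval (plucker B) (P d) != 0 -> basic_open P L.
Proof.
move=> Ph LB PB d' B' LB'; have [s s'] := (basis_sub LB LB', basis_sub LB' LB).
have [[fB _] [fB' _]] := (LB, LB').
have dd : d' = d.
  have [rB rB'] := (eqP fB, eqP fB'); have r1 := mxrankS s; have r2 := mxrankS s'.
  by rewrite rB rB' in r1 r2; apply/eqP; rewrite eqn_leq r1 r2.
subst d'; have /submxP[X BX] := s; have [e Pe] := Ph d.
have XU : X \in unitmx.
  rewrite -row_free_unit /row_free eqn_leq rank_leq_row /= -{1}(eqP fB') BX.
  exact: mxrankM_maxl.
have -> : plucker B' = fun J => \det X * plucker B J by apply/funext => J; rewrite BX pluckerM.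
by rewrite (meval_homog _ _ Pe) mulf_neq0// expf_neq0// -unitfE -unitmxE.
Qed.

End BasisChange.

Section Subspaces.
Variables (F : fieldType) (m : nat) (S : 'rV[F]_m -> Prop).
Hypotheses (S0 : S 0) (SD : forall u v, S u -> S v -> S (u + v))
  (SZ : forall a u, S u -> S (a *: u)).

(** A matrix of largest rank among those with rows in S. *)
Lemma subspace_matrix : exists M : 'M[F]_m, forall w, (w <= M)%MS <-> S w.
Proof.
have [|M M_S|M M_S Mmax] := @int_min _ (fun M : 'M[F]_m => forall u : 'rV[F]_m, (u <= M)%MS -> S u)
    (fun M => - (\rank M)%:Z) (- m%:Z).
- by exists 0 => u; rewrite submx0 => /eqP ->.
- by rewrite lerN2 lez_nat rank_leq_row.
exists M => w; split; first exact: M_S.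
move=> Sw; apply: contrapT => /negP wM.
have /Mmax : forall u : 'rV[F]_m, (u <= M + w)%MS -> S u.
  move=> u /sub_addsmxP[[a b] ->]; apply: SD; first by apply: M_S; rewrite /= submxMl.
  by rewrite /= [b]mx11_scalar mul_scalar_mx; apply: SZ.
have : (M < M + w)%MS.
  by rewrite ltmxE addsmxSl; apply: contra wM; apply: submx_trans; apply: addsmxSr.
by rewrite ltmxErank => /andP[_ lt]; rewrite lerN2 lez_nat leqNgt lt.
Qed.

End Subspaces.

(** * Affine lines in the affine Grassmannian *)

Section Line.
Variables (n : nat) (F : closedFieldType) (T : comNzRingType).
Variables (iF : {rmorphism F -> T}) (theta : 'I_n -> {rmorphism T -> F}).
Hypothesis thetaP : is_identification iF theta.
Local Notation K := (laurent F).
Local Notation V := 'cV[K]_2.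
Local Notation I := 'I_n.
Local Notation cpt := (component theta).

Definition coordsK N (f : I -> V) : 'rV[F]_(vdim n N) :=
  \row_j (let x : coord_index n N := enum_val j in
          lcoef (f x.1.2 x.1.1 0) ((x.2 : nat)%:Z - N%:Z)).

Lemma coordsE N v : coords theta N v = coordsK N (cpt v).
Proof. by apply/rowP => j; rewrite [LHS]mxE [RHS]mxE /component /= mxE. Qed.

Lemma coordsKD N f g : coordsK N (fun i => f i + g i) = coordsK N f + coordsK N g.
Proof. by apply/rowP => j; rewrite !mxE /= !mxE. Qed.

Lemma coordsKZ N a f : coordsK N (fun i => lconst a *: f i) = a *: coordsK N f.
Proof. by apply/rowP => j; rewrite !mxE /= !mxE lcoefMconst. Qed.

Lemma coordsK0 N f : (forall i, std_lattice F N%:Z (f i)) -> coordsK N f = 0.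
Proof.
move=> f0; apply/rowP => j; rewrite !mxE; case: (enum_val j) => -[r i] s /=.
by apply: f0; have := ltn_ord s; lia.
Qed.

Lemma coordsK_sum N J (s : seq J) (b : J -> F) (g : J -> I -> V) :
  coordsK N (fun i => \sum_(l <- s) lconst (b l) *: g l i) =
  \sum_(l <- s) b l *: coordsK N (g l).
Proof.
elim: s => [|l s IH].
  by rewrite big_nil; apply: coordsK0 => i r; rewrite big_nil mxE.
rewrite big_cons -IH -coordsKZ -coordsKD; congr coordsK.
by apply/funext => i; rewrite big_cons.
Qed.

Lemma coordsK_ker N f : (forall i, std_lattice F (- N%:Z) (f i)) -> coordsK N f = 0 ->
  forall i, std_lattice F N%:Z (f i).
Proof.
move=> fN f0 i r j jN; have [jN'|jN'] := ltP j (- N%:Z); first exact: fN.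
have sN : (absz (j + N%:Z : int) < N + N)%N by lia.
move/rowP/(_ (enum_rank ((r, i), Ordinal sN))) : f0; rewrite !mxE enum_rankK /= => <-.
by congr lcoef; lia.
Qed.

Lemma std_latticeP a (v : V) : std_lattice F a v <-> lattice (lmono F a *: 1%:M) v.
Proof.
split=> [va|/(lattice_lmonoP _ _ (unitmx1 _ _)) va r].
  by apply/lattice_lmonoP => [|r]; rewrite ?unitmx1// invmx1 mul1mx; apply: va.
by have := va r; rewrite invmx1 mul1mx.
Qed.

Lemma lattice_lmono_le (E : 'M[K]_2) a b : a <= b ->
  lattice (lmono F b *: E) `<=` lattice (lmono F a *: E).
Proof.
move=> ab v; rewrite !lattice_scale; have -> : - a = (b - a) + - b by lia.
rewrite lmonoD -scalerA => gv; apply: latticeZ => //.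
by apply/lval_geP; rewrite ?lmono_neq0// lval_mono subr_ge0.
Qed.

Lemma commensurable_family (g h : I -> 'M[K]_2) : (forall i, g i \in unitmx) ->
    (forall i, h i \in unitmx) ->
  exists N : nat, forall i, lattice (lmono F N%:Z *: g i) `<=` lattice (h i).
Proof.
move=> gU hU; have /fin_all_exists[N NP] : forall i, exists N : nat,
    lattice (lmono F N%:Z *: g i) `<=` lattice (h i).
  by move=> i; apply: lattice_commensurable.
exists (\max_i N i)%N => i v gv; apply: NP; apply: lattice_lmono_le gv.
by rewrite lez_nat leq_bigmax.
Qed.

Variables (h E Z : I -> 'M[K]_2).
Hypotheses (hU : forall i, h i \in unitmx) (EU : forall i, E i \in unitmx).
Hypotheses (Z_int : forall i, integral (Z i)) (ZZ : forall i, Z i *m Z i = 0).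

(** The one-parameter group t |-> 1 + t Z, written in the basis E. *)
Definition unipotent (t : F) i : 'M[K]_2 :=
  1%:M + lconst t *: (E i *m Z i *m invmx (E i)).

Lemma unipotentN t i : unipotent t i *m unipotent (- t) i = 1%:M.
Proof.
have XX : (E i *m Z i *m invmx (E i)) *m (E i *m Z i *m invmx (E i)) = 0.
  by rewrite -(mulmxA (E i *m Z i)) -(mulmxA (E i) (Z i) (invmx _)) mulKmx// mulmxA
     -(mulmxA (E i)) ZZ mulmx0 mul0mx.
rewrite /unipotent; move: (E i *m Z i *m invmx (E i)) XX => X XX.
have -> : lconst (- t) = - lconst t by apply: rmorphN.
move: (lconst t) => a; rewrite scaleNr mulmxDl !mulmxDr !mul1mx mulmx1 mulmxN.
by rewrite -scalemxAl -scalemxAr XX !scaler0 oppr0 addr0 subrK.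
Qed.

Lemma unipotentK t i (v : V) : unipotent (- t) i *m (unipotent t i *m v) = v.
Proof. by rewrite mulmxA -{2}[t]opprK unipotentN mul1mx. Qed.

Lemma unipotent_preserves t i c v : lattice (lmono F c *: E i) v ->
  lattice (lmono F c *: E i) (unipotent t i *m v).
Proof.
move=> /(lattice_lmonoP _ _ (EU i)) vc; apply/lattice_lmonoP => // r.
rewrite mulmxDl mul1mx -scalemxAl mulmxDr -scalemxAr !mulmxA mulVmx// mul1mx -mulmxA.
rewrite mxE; apply: lval_geD => //; rewrite mxE -[c]add0r.
apply: lval_geM; first exact: lval_ge_const.
rewrite mxE -[c]add0r; apply: lval_ge_sum => l _; apply: lval_geM; first exact: Z_int.
exact: vc.
Qed.

Variable L : F -> affgr theta.
Hypothesis L_lattice : forall t v,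
  affgr_set (L t) v <-> forall i, lattice (unipotent t i *m h i) (cpt v i).

(** Fix a lattice Y, a homothet of that of E, contained in all lattices of h; it
    is preserved by the unipotent matrices. A basis of the lattices on the line
    modulo u^N is made of a basis of Y and of the images of a basis of a
    complement of Y in the lattice of h; the images depend linearly on the
    parameter. *)
Lemma line_basis : exists N d (B0 B1 : 'M[F]_(d, vdim n N)),
  forall t, truncated N (L t) /\ is_basis (L t) (B0 + t *: B1).
Proof.
have [c1 c1P] := commensurable_family EU hU; have [c2 c2P] := commensurable_family hU EU.
have idU : forall i : I, 1%:M \in (@unitmx K 2) by move=> i; apply: unitmx1.
have EcU (c : int) i : lmono F c *: E i \in unitmx by apply: unitmx_lmono.
(* u^N times the standard lattice is contained in Y, and u^-N times it contains
   all lattices on the line *)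
have [N1 N1P] := commensurable_family idU (EcU c1%:Z).
have [N2 N2P] := commensurable_family (EcU (- c2%:Z)) idU.
pose N := maxn N1 N2.
pose Y i := lattice (lmono F c1%:Z *: E i).
have YN i v : std_lattice F N%:Z v -> Y i v.
  move=> /std_latticeP vN; apply: N1P; apply: lattice_lmono_le vN.
  by rewrite lez_nat leq_maxl.
have Yh i : Y i `<=` lattice (h i) by apply: c1P.
have hE i v : lattice (h i) v -> lattice (lmono F (- c2%:Z) *: E i) v.
  move=> hv; apply/lattice_scale; rewrite opprK; apply: c2P; apply/lattice_scale.
  by rewrite scalerA lmonoVl scale1r.
have EN i v : lattice (lmono F (- c2%:Z) *: E i) v -> std_lattice F (- N%:Z) v.
  move=> Ev; apply/std_latticeP/(@lattice_lmono_le _ _ (- N2%:Z)).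
    by rewrite lerN2 lez_nat leq_maxr.
  apply/lattice_scale; rewrite opprK; apply: (N2P i); apply/lattice_scale.
  by rewrite scalerA lmonoVl scale1r.
have Yu t i v : Y i v -> Y i (unipotent t i *m v) by apply: unipotent_preserves.
have hN t i v : lattice (h i) v -> std_lattice F (- N%:Z) (unipotent t i *m v).
  by move=> /hE hv; apply: EN; apply: unipotent_preserves.
have YD i v v' : Y i v -> Y i v' -> Y i (v + v') by apply: latticeD.
pose S (A : I -> set V) (w : 'rV[F]_(vdim n N)) :=
  exists2 f : I -> V, (forall i, A i (f i)) & coordsK N f = w.
have SM (b : I -> 'M[K]_2) : exists M : 'M[F]_(vdim n N),
    forall w, (w <= M)%MS <-> S (fun i => lattice (b i)) w.
  apply: subspace_matrix.
  - exists (fun=> 0); first by move=> i; apply: lattice0.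
    by apply: coordsK0 => i r; rewrite mxE.
  - move=> _ _ [f fA <-] [g gA <-]; exists (fun i => f i + g i); last exact: coordsKD.
    by move=> i; apply: latticeD.
  - move=> a _ [f fA <-]; exists (fun i => lconst a *: f i); last exact: coordsKZ.
    by move=> i; apply: latticeZ => //; apply: lval_ge_const.
have [MY MYP] := SM (fun i => lmono F c1%:Z *: E i); have [M0 M0P] := SM h.
pose BY := row_base MY; pose C := row_base (M0 :\: MY)%MS.
have BYE w : (w <= BY)%MS = (w <= MY)%MS by rewrite eq_row_base.
have CE w : (w <= C)%MS = (w <= M0 :\: MY)%MS by rewrite eq_row_base.
have /fin_all_exists[f fP] : forall l, exists f : I -> V,
    (forall i, lattice (h i) (f i)) /\ coordsK N f = row l C.
  move=> l; have /M0P[f fh fl] : (row l C <= M0)%MS.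
    by apply: submx_trans (diffmxSl M0 MY); rewrite -CE row_sub.
  by exists f.
pose X i := E i *m Z i *m invmx (E i).
(* the derivative of the basis with respect to the parameter *)
pose C1 := \matrix_l coordsK N (fun i => X i *m f l i).
pose fb (b : 'rV[F]_(\rank (M0 :\: MY)%MS)) i : V := \sum_l lconst (b 0 l) *: f l i.
have fb_h b i : lattice (h i) (fb b i).
  rewrite /fb; elim/big_rec: _ => [|l v _ hv]; first exact: lattice0.
  by apply: latticeD => //; apply: latticeZ; [apply: lval_ge_const|case: (fP l)].
have sum_coords (g : 'I_(\rank (M0 :\: MY)%MS) -> I -> V) (b : 'rV_(\rank (M0 :\: MY)%MS)) :
    coordsK N (fun i => \sum_l lconst (b 0 l) *: g l i) = b *m \matrix_l coordsK N (g l).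
  rewrite mulmx_sum_row; under [RHS]eq_bigr do rewrite rowK.
  exact: coordsK_sum.
have fb_C b : coordsK N (fb b) = b *m C.
  rewrite sum_coords; congr (_ *m _); apply/row_matrixP => l; rewrite rowK.
  by case: (fP l).
have fb_t b t : coordsK N (fun i => unipotent t i *m fb b i) = b *m (C + t *: C1).
  have -> : (fun i => unipotent t i *m fb b i) =
      (fun i => fb b i + lconst t *: (\sum_l lconst (b 0 l) *: (X i *m f l i))).
    apply/funext => i; rewrite mulmxDl mul1mx -scalemxAl -/(X i); congr (_ + _ *: _).
    by rewrite mulmx_sumr; apply: eq_bigr => l _; rewrite scalemxAr.
  by rewrite coordsKD coordsKZ fb_C (sum_coords (fun l i => X i *m f l i)) mulmxDr scalemxAr.
have coordsY y : (forall i, Y i (y i)) -> (coordsK N y <= BY)%MS.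
  by move=> Yy; rewrite BYE; apply/MYP; exists y.
(* a family whose coordinates vanish lies in u^N times the standard lattices *)
have kerY g : (forall i, std_lattice F (- N%:Z) (g i)) -> coordsK N g = 0 -> forall i, Y i (g i).
  by move=> gN g0 i; apply: YN; apply: (coordsK_ker gN g0).
exists N, (\rank (M0 :\: MY)%MS + \rank MY)%N, (col_mx C BY), (col_mx C1 0) => t.
have BtE : col_mx C BY + t *: col_mx C1 0 = col_mx (C + t *: C1) BY.
  by rewrite scale_col_mx add_col_mx scaler0 addr0.
rewrite {}BtE; split.
  split=> v; rewrite ?L_lattice.
    move/(component_std_lattice thetaP) => vN i; apply/lattice_mulP.
    exists (unipotent (- t) i *m cpt v i); last by rewrite -{1}[t]opprK unipotentK.
    by apply/Yh/Yu/YN.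
  move=> Lv; apply/(component_std_lattice thetaP) => i.
  by have /lattice_mulP[x hx ->] := Lv i; apply: hN.
split.
  apply: inj_row_free => u; rewrite -[u]hsubmxK mul_row_col.
  set b := lsubmx u; set a := rsubmx u => E0.
  have [y Yy ya] : S Y (a *m BY) by apply/MYP; rewrite -BYE submxMl.
  have b0 : b = 0.
    pose z i := unipotent t i *m fb b i + y i.
    have zN i : std_lattice F (- N%:Z) (z i).
      by move=> r; rewrite mxE; apply: lval_geD; [apply: hN|apply: EN; apply: hE; apply: Yh].
    have z0 : coordsK N z = 0 by rewrite coordsKD fb_t ya.
    have Yf i : Y i (fb b i).
      rewrite -(unipotentK t i (fb b i)); apply: Yu.
      have -> : unipotent t i *m fb b i = z i - y i by rewrite /z addrK.
      exact: latticeB (kerY z zN z0 i) (Yy i).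
    have : (b *m C <= (M0 :\: MY) :&: MY)%MS.
      by rewrite sub_capmx -CE submxMl /= -fb_C -BYE coordsY.
    rewrite capmx_diff submx0 => /eqP bC; apply: (row_free_inj (row_base_free _)).
    by rewrite mul0mx.
  have a0 : a = 0.
    move: E0; rewrite b0 mul0mx add0r => aB; apply: (row_free_inj (row_base_free _)).
    by rewrite mul0mx.
  by rewrite b0 a0 row_mx0.
move=> w; split.
  move=> /submxP[u ->]; rewrite -[u]hsubmxK mul_row_col.
  set b := lsubmx u; set a := rsubmx u.
  have [y Yy <-] : S Y (a *m BY) by apply/MYP; rewrite -BYE submxMl.
  have [v vP] := glue_components thetaP (fun i => unipotent t i *m fb b i + y i).
  exists v; last first.
    by rewrite coordsE -fb_t -coordsKD; congr coordsK; apply/funext.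
  apply/L_lattice => i; rewrite vP; apply: latticeD.
    by apply/lattice_mulP; exists (fb b i).
  apply/lattice_mulP; exists (unipotent (- t) i *m y i); last by rewrite -{1}[t]opprK unipotentK.
  by apply/Yh/Yu/Yy.
move=> [v /L_lattice Lv <-]; rewrite coordsE.
have /fin_all_exists[x xP] : forall i, exists x : V, lattice (h i) x /\ cpt v i = unipotent t i *m x.
  by move=> i; have /lattice_mulP[x hx ->] := Lv i; exists x.
have xM : (coordsK N x <= (M0 :\: MY) + MY)%MS.
  have : (coordsK N x <= M0)%MS by apply/M0P; exists x => // i; case: (xP i).
  move/submx_trans; apply; rewrite -(addsmx_diff_cap_eq M0 MY).
  by apply: addsmxS => //; apply: capmxSr.
have [[b a'] xE] := sub_addsmxP xM.
have [b' b'E] : exists b', b *m (M0 :\: MY)%MS = b' *m C.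
  by apply/submxP; rewrite CE submxMl.
have [y Yy yE] : S Y (a' *m MY) by apply/MYP; rewrite submxMl.
pose y' i := x i - fb b' i.
have Yy' i : Y i (y' i).
  have -> : y' i = (y' i - y i) + y i by rewrite subrK.
  apply: YD => //; apply: (kerY (fun i => y' i - y i)).
    have subN v1 v2 : std_lattice F (- N%:Z) v1 -> std_lattice F (- N%:Z) v2 ->
        std_lattice F (- N%:Z) (v1 - v2).
      by move=> v1N v2N r; rewrite !mxE; apply: lval_geB; [apply: v1N|apply: v2N].
    move=> l; apply: (subN); last by apply: (EN l); apply: hE; apply: Yh.
    apply: (subN); apply: (EN l); apply: hE; [by case: (xP l)|exact: fb_h].
  have -> : coordsK N (fun i => y' i - y i) = coordsK N x - coordsK N (fb b') - coordsK N y.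
    by apply/rowP => j; rewrite !mxE /y' /= !mxE.
  by rewrite xE /= fb_C b'E yE [_ + a' *m MY]addrC addrK subrr.
have -> : coordsK N (cpt v) = coordsK N (fun i => unipotent t i *m fb b' i + unipotent t i *m y' i).
  congr coordsK; apply/funext => i; case: (xP i) => _ ->.
  by rewrite -mulmxDr /y' addrC subrK.
rewrite coordsKD fb_t -addsmxE; apply: addmx_sub_adds; first exact: submxMl.
by apply: coordsY => i; apply: Yu.
Qed.

(** The homogeneous polynomials which define the two open sets become nonzero
    polynomials in the parameter, and a field that is algebraically closed has
    a common nonroot of them. *)
Lemma line_opens_meet U U' t0 t1 : zariski_open U -> zariski_open U' ->
  U (L t0) -> U' (L t1) -> exists t, U (L t) /\ U' (L t).
Proof.
move=> Uo Uo' UL UL'; have [N [d [B0 [B1 BP]]]] := line_basis.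
have [[L0 Bt0] [L1 Bt1]] := (BP t0, BP t1).
have [P [Ph LP PU]] := Uo N _ L0 UL; have [P' [Ph' LP' PU']] := Uo' N _ L1 UL'.
have [R RP] := plucker_poly B0 B1 (P d); have [R' RP'] := plucker_poly B0 B1 (P' d).
have RR : R * R' != 0.
  apply: mulf_neq0.
    by apply: contraNneq (LP _ _ Bt0) => R0; rewrite -RP R0 horner0.
  by apply: contraNneq (LP' _ _ Bt1) => R0; rewrite -RP' R0 horner0.
have /closed_nonrootP[t] := RR; rewrite rootM negb_or => /andP[Rt Rt'].
exists t; have [Lt Bt] := BP t; split; [apply: PU|apply: PU']; split=> //.
  by apply: (basic_open_basis Ph Bt); rewrite -RP.
by apply: (basic_open_basis Ph' Bt); rewrite -RP'.
Qed.

End Line.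

(** * Points of the Kisin variety as configurations of lattices *)

Section KisinPoints.
Variables (n : nat) (F : closedFieldType) (T : comNzRingType).
Variables (iF : {rmorphism F -> T}) (theta : 'I_n -> {rmorphism T -> F}).
Hypothesis thetaP : is_identification iF theta.
Variables (p : nat) (p_gt0 : (0 < p)%N) (phi : {rmorphism T -> T}).
Local Notation K := (laurent F).
Local Notation V := 'cV[K]_2.
Local Notation I := 'I_n.
Local Notation cpt := (component theta).
Local Notation frb := (@frob F p p_gt0).
Variables (sigma tau : I -> I).
Hypothesis sigmaP : forall i t, theta i (phi t) = theta (sigma i) t.
Hypotheses (tauK : cancel tau sigma) (sigmaK : cancel sigma tau).
Variables (nu : cocharacter n) (A : 'M[laurent T]_2) (A_unit : A \in unitmx).

(** The twist by u^(-beta) turns the type (alpha, beta) into (alpha - beta, 0), so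
    that the condition on the relative position becomes integrality together
    with the valuation of the determinant. *)
Definition twisted i : 'M[K]_2 := lmono F (- (nu (tau i)).2) *: cpt A (tau i).

Definition represents (L : affgr theta) (h : I -> 'M[K]_2) : Prop :=
  forall v, affgr_set L v <-> forall i, lattice (h i) (cpt v i).

Definition kisin_config (h : I -> 'M[K]_2) : Prop :=
  [/\ forall i, h i \in unitmx, stable p_gt0 tau twisted h
    & forall i, lval (\det (h (tau i))) + ((nu (tau i)).1 - (nu (tau i)).2) =
        lval (\det (twisted i)) + p%:Z * lval (\det (h i))].

Lemma twisted_unitmx i : twisted i \in unitmx.
Proof. by apply: unitmx_lmono; apply: (component_unitmx thetaP _).1. Qed.

Lemma affgr_eq (L L' : affgr theta) : affgr_set L = affgr_set L' -> L = L'.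
Proof. by case: L L' => [S SP] [S' S'P] /= E; subst S'; congr AffGr; apply: Prop_irrelevance. Qed.

Lemma represents_inj L L' h h' : represents L h -> represents L' h' ->
  (forall i, lattice (h i) = lattice (h' i)) -> L = L'.
Proof.
move=> Lh Lh' hh; apply/affgr_eq/seteqP.
split=> v; first by move=> /Lh H; apply/Lh' => i; rewrite -hh.
by move=> /Lh' H; apply/Lh => i; rewrite hh.
Qed.

Lemma represents_exists h : (forall i, h i \in unitmx) -> exists L, represents L h.
Proof.
move=> hU; have [g gP] := glue_components thetaP h.
have gU : g \in unitmx by apply/(component_unitmx thetaP) => i; rewrite gP.
have ex : exists2 g', g' \in unitmx & lattice g = lattice g' by exists g.
exists (AffGr theta ex) => v /=; split=> [/(component_lattice thetaP _ gU) H i|H].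
  by rewrite -gP.
by apply/(component_lattice thetaP) => // i; rewrite gP.
Qed.

Lemma stableP (D h : I -> 'M[K]_2) : (forall i, h i \in unitmx) ->
  stable p_gt0 tau D h <->
  forall i, integral (invmx (h (tau i)) *m (D i *m map_mx frb (h i))).
Proof.
move=> hU; split=> [st i|H i v hv].
  apply: lattice_sub_integral => //; apply: lattice_sub_lattice;
    rewrite col_phi; apply: st; exact: lattice_col.
have := phi_lattice p_gt0 D i hv.
have -> : D i *m map_mx frb (h i) = h (tau i) *m (invmx (h (tau i)) *m (D i *m map_mx frb (h i))).
  by rewrite [RHS]mulmxA mulmxV// mul1mx.
exact: lattice_mul.
Qed.

Lemma lval_det_twist (D h : I -> 'M[K]_2) i : (forall i, D i \in unitmx) ->
  (forall i, h i \in unitmx) ->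
  \det (invmx (h (tau i)) *m (D i *m map_mx frb (h i))) != 0 /\
  lval (\det (invmx (h (tau i)) *m (D i *m map_mx frb (h i)))) =
    lval (\det (D i)) + p%:Z * lval (\det (h i)) - lval (\det (h (tau i))).
Proof.
move=> DU hU; have d0 (g : 'M[K]_2) : g \in unitmx -> \det g != 0 by rewrite unitmx_det_neq0.
have f0 : frb (\det (h i)) != 0 by rewrite frob_eq0 d0.
have [n1 n2 n3] := And3 (d0 _ (hU (tau i))) (d0 _ (DU i)) f0.
have E : \det (invmx (h (tau i)) *m (D i *m map_mx frb (h i))) =
    (\det (h (tau i)))^-1 * (\det (D i) * frb (\det (h i))).
  by rewrite !det_mulmx det_inv det_map_mx.
rewrite E; split; first by rewrite !mulf_neq0 ?invr_eq0.
have n4 : \det (D i) * frb (\det (h i)) != 0 by rewrite mulf_neq0.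
have n5 : (\det (h (tau i)))^-1 != 0 by rewrite invr_eq0.
by rewrite (lvalM n5 n4) (lvalM n2 n3) (lvalV n1) lval_frob addrC.
Qed.

Lemma diag_upow_shift a b c :
  lmono F c *: diag_upow F (a, b) = diag_upow F (a + c, b + c).
Proof.
apply/matrixP => i j; rewrite !mxE /=; case: (i == j); last by rewrite mulr0.
by case: (i == 0); rewrite [_ + c]addrC lmonoD.
Qed.

Lemma twistE (g : 'M[laurent T]_2) i : g \in unitmx ->
  invmx (cpt g (tau i)) *m (twisted i *m map_mx frb (cpt g i)) =
  lmono F (- (nu (tau i)).2) *: cpt (invmx g *m A *m map_mx (lfrob p phi) g) (tau i).
Proof.
move=> gU; rewrite !(componentM theta) (component_invmx thetaP _ gU).
rewrite (component_lfrob p_gt0 sigmaP) tauK /twisted -scalemxAl -scalemxAr.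
by rewrite mulmxA.
Qed.

Lemma kisin_config_of L : kisin_variety theta p phi nu A L ->
  exists2 h, kisin_config h & represents L h.
Proof.
move=> [g [gU Lg [nu' [dom le [P [U [Q [P0 Unu Q0 E]]]]]]]].
exists (cpt g); last by move=> v; rewrite Lg; apply: (component_lattice thetaP).
have hU : forall i, cpt g i \in unitmx by apply/(component_unitmx thetaP).
have key i : integral (invmx (cpt g (tau i)) *m (twisted i *m map_mx frb (cpt g i))) /\
    lval (\det (invmx (cpt g (tau i)) *m (twisted i *m map_mx frb (cpt g i)))) =
      (nu (tau i)).1 - (nu (tau i)).2.
  rewrite twistE// E !(componentM theta).
  have -> : cpt U (tau i) = diag_upow F (nu' (tau i)) := Unu (tau i).
  have [s d] := le (tau i); have := dom (tau i).
  case: (nu' (tau i)) s d => a b /= s d ba.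
  rewrite scalemxAl scalemxAr diag_upow_shift.
  have [|I1 I2] := cartan_integral ((component_GL2_integral thetaP P).1 P0 (tau i))
    ((component_GL2_integral thetaP Q).1 Q0 (tau i)) (ab := (a - (nu (tau i)).2, b - (nu (tau i)).2)).
    by rewrite /=; apply/andP; split; lia.
  by split=> //; rewrite I2 /=; lia.
split=> //; first by apply/(stableP _ hU) => i; case: (key i).
move=> i; have [_ dv] := lval_det_twist i twisted_unitmx hU.
by have [_] := key i; rewrite dv => <-; rewrite addrC subrK.
Qed.

Lemma kisin_of_config L h : kisin_config h -> represents L h ->
  kisin_variety theta p phi nu A L.
Proof.
move=> [hU hst hdet] Lh; have [g gP] := glue_components thetaP h.
have gU : g \in unitmx by apply/(component_unitmx thetaP) => i; rewrite gP.
have Lg : affgr_set L = lattice g.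
  apply/seteqP; split=> v.
    by move=> /Lh H; apply/(component_lattice thetaP) => // i; rewrite gP.
  by move=> /(component_lattice thetaP _ gU) H; apply/Lh => i; rewrite -gP.
have /fin_all_exists[X XP] : forall l : I, exists X : ('M[K]_2 * 'M[K]_2) * (int * int),
  [/\ GL2_integral X.1.1, GL2_integral X.1.2,
   lmono F (- (nu l).2) *: cpt (invmx g *m A *m map_mx (lfrob p phi) g) l =
     X.1.1 *m diag_upow F X.2 *m X.1.2,
   X.2.1 + X.2.2 = (nu l).1 - (nu l).2 & 0 <= X.2.2 <= X.2.1].
  move=> l; have TE := twistE (sigma l) gU; rewrite sigmaK !gP in TE.
  have [dn dv] := lval_det_twist (sigma l) twisted_unitmx hU.
  have H0 := (stableP _ hU).1 hst (sigma l).
  have hd := hdet (sigma l); rewrite sigmaK in dn dv H0 hd.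
  have [P [Q [ab [P0 Q0 E s b]]]] := cartan H0 dn dv.
  exists ((P, Q), ab); split=> //=; first by rewrite -TE.
  by rewrite s -hd addrC addKr.
exists g; split=> //.
pose nu' : cocharacter n := fun l => ((X l).2.1 + (nu l).2, (X l).2.2 + (nu l).2).
exists nu'; split.
- by move=> l; have [_ _ _ _ /andP[_ le]] := XP l; rewrite /= lerD2r.
- by move=> l; have [_ _ _ s /andP[b _]] := XP l; rewrite /=; split; lia.
have [P PP] := glue_components thetaP (fun l => (X l).1.1).
have [Q QP] := glue_components thetaP (fun l => (X l).1.2).
have [U UP] := glue_components thetaP (fun l => diag_upow F (nu' l)).
exists P, U, Q; split.
- by apply/(component_GL2_integral thetaP) => l; rewrite PP; case: (XP l).
- by move=> l; apply: UP.
- by apply/(component_GL2_integral thetaP) => l; rewrite QP; case: (XP l).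
apply: (component_inj thetaP) => l; have [_ _ E _ _] := XP l.
rewrite !(componentM theta) PP UP QP /nu' -diag_upow_shift -scalemxAr -scalemxAl.
have -> : diag_upow F ((X l).2.1, (X l).2.2) = diag_upow F (X l).2 by case: ((X l).2).
rewrite -E scalerA -lmonoD subrr lmono0 scale1r !(componentM theta).
by [].
Qed.

End KisinPoints.

(** * Connectedness *)

Lemma fconnect_injective (I : finType) (f : I -> I) :
  (forall i j, fconnect f i j) -> injective f.
Proof.
move=> ft; pose g j := iter (findex f (f j) j) f j.
have gK : cancel g f by move=> j; rewrite /g -iterS iterSr iter_findex.
exact: can_inj ((bij_can_sym (injF_bij (can_inj gK)) f).2 gK).
Qed.

Lemma conjugate_unipotent (R : comUnitRingType) m (E z gam h : 'M[R]_m) a :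
  E \in unitmx ->
  (1%:M + a *: (E *m z *m invmx E)) *m (E *m gam *m invmx E *m h) =
  E *m ((1%:M + a *: z) *m gam) *m invmx E *m h.
Proof.
move=> EU; rewrite [LHS]mulmxDl mul1mx (mulmxDl 1%:M _ gam) mul1mx mulmxDr !mulmxDl.
congr (_ + _); rewrite -[LHS]scalemxAl -(scalemxAl a z gam) -(scalemxAr a E) -!scalemxAl.
by congr (_ *: _); rewrite !mulmxA mulmxKV.
Qed.

Section Connectedness.
Variables (n : nat) (F : closedFieldType) (T : comNzRingType).
Variables (iF : {rmorphism F -> T}) (theta : 'I_n -> {rmorphism T -> F}).
Hypothesis thetaP : is_identification iF theta.
Variables (p : nat) (p_gt0 : (0 < p)%N) (phi : {rmorphism T -> T}).
Local Notation K := (laurent F).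
Local Notation V := 'cV[K]_2.
Local Notation I := 'I_n.
Local Notation cpt := (component theta).
Variables (sigma tau : I -> I).
Hypothesis sigmaP : forall i t, theta i (phi t) = theta (sigma i) t.
Hypotheses (tauK : cancel tau sigma) (sigmaK : cancel sigma tau).
Hypothesis tau_trans : forall i j, fconnect tau i j.
Variables (nu : cocharacter n) (A : 'M[laurent T]_2) (A_unit : A \in unitmx).

Local Notation C := (kisin_variety theta p phi nu A).
Local Notation D := (twisted theta tau nu A).
Local Notation config := (kisin_config theta p_gt0 tau nu A).
Local Notation Pts := (@represents n F T theta).
Let D_unit : forall i, D i \in unitmx := twisted_unitmx thetaP tau nu A_unit.
Let tau_inj : injective tau := can_inj tauK.

Definition clopen_in (B : set (affgr theta)) : Prop :=
  (exists2 U, open U & B = C `&` U) /\ (exists2 W, closed W & B = C `&` W).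

Definition linked (h h' : I -> 'M[K]_2) : Prop :=
  forall B, clopen_in B -> forall L L', Pts L h -> Pts L' h' -> B L -> B L'.

Lemma linked_trans h h' h'' : (forall i, h' i \in unitmx) ->
  linked h h' -> linked h' h'' -> linked h h''.
Proof.
move=> hU' hh' hh'' B Bc L L' Lh Lh'' BL; have [L0 Lh'] := represents_exists thetaP hU'.
exact: hh'' Bc _ _ Lh' Lh'' (hh' B Bc _ _ Lh Lh' BL).
Qed.

Lemma linked_refl h h' : (forall i, lattice (h i) = lattice (h' i)) -> linked h h'.
Proof. by move=> hh B _ L L' Lh Lh'; rewrite (represents_inj Lh Lh' hh). Qed.

Lemma line_linked (h E Z : I -> 'M[K]_2) t0 t1 :
    (forall i, E i \in unitmx) -> (forall i, integral (Z i)) -> (forall i, Z i *m Z i = 0) ->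
    (forall t, config (fun i => unipotent E Z t i *m h i)) -> (forall i, h i \in unitmx) ->
  linked (fun i => unipotent E Z t0 i *m h i) (fun i => unipotent E Z t1 i *m h i).
Proof.
move=> EU Z_int ZZ cfg hU B [[U Uo BU] [W Wc BW]] L0 L1 rep0 rep1 BL0.
have /choice[L LP] : forall t, exists L, Pts L (fun i => unipotent E Z t i *m h i).
  by move=> t; apply: (represents_exists thetaP); case: (cfg t).
have LC t : C (L t) by exact: (kisin_of_config thetaP sigmaP tauK sigmaK A_unit (cfg t) (LP t)).
have E0 : L0 = L t0 by apply: (represents_inj rep0 (LP t0)).
have E1 : L1 = L t1 by apply: (represents_inj rep1 (LP t1)).
apply: contrapT => BL1.
have UL0 : U (L t0) by move: BL0; rewrite BU E0 => -[].
have WL1 : (~` W) (L t1) by move=> WL; apply: BL1; rewrite E1 BW.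
have [t [Ut Wt]] := line_opens_meet thetaP hU EU Z_int ZZ LP
  (Uo : zariski_open U) (closed_openC Wc : zariski_open (~` W)) UL0 WL1.
have : B (L t) by rewrite BU.
by rewrite BW => -[_ /Wt].
Qed.

Section Rotations.
Variables (h E : I -> 'M[K]_2) (G : pred I).
Hypotheses (hU : forall i, h i \in unitmx) (EU : forall i, E i \in unitmx).

Definition rotation (gam : 'M[F]_2) i : 'M[K]_2 :=
  if G i then E i *m map_mx (@lconst F) gam *m invmx (E i) *m h i else h i.

Hypothesis rot_config : forall gam, \det gam = 1 -> config (rotation gam).

Lemma rotation_linked (gam z : 'M[F]_2) : \det gam = 1 -> z *m z = 0 ->
    (forall t, \det (1%:M + t *: z) = 1) ->
  linked (rotation gam) (rotation ((1%:M + z) *m gam)).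
Proof.
move=> g1 zz dz; pose Z i : 'M[K]_2 := if G i then map_mx (@lconst F) z else 0.
have E0 t : (fun i => unipotent E Z t i *m rotation gam i) =
    rotation ((1%:M + t *: z) *m gam).
  apply/funext => i; rewrite /unipotent /rotation /Z; case: ifP => _; last first.
    by rewrite mulmx0 mul0mx scaler0 addr0 mul1mx.
  have -> : map_mx (@lconst F) ((1%:M + t *: z) *m gam) =
      (1%:M + lconst t *: map_mx (@lconst F) z) *m map_mx (@lconst F) gam.
    by rewrite map_mxM map_mxD map_mx1 map_mxZ.
  exact: conjugate_unipotent.
have gU : forall i, rotation gam i \in unitmx by case: (rot_config g1).
have := @line_linked (rotation gam) E Z 0 1 EU.
rewrite !E0 scale0r addr0 mul1mx scale1r; apply=> //.
- by move=> i; rewrite /Z; case: ifP => _ r s; rewrite mxE; [apply: lval_ge_const|apply: lval_ge_zero].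
- move=> i; rewrite /Z; case: ifP => _; last by rewrite mulmx0.
  by rewrite -map_mxM zz map_mx0.
- by move=> t; rewrite E0; apply: rot_config; rewrite det_mulmx dz g1 mulr1.
Qed.

Lemma rotation_rev_linked (gam z : 'M[F]_2) : \det gam = 1 -> z *m z = 0 ->
    (forall t, \det (1%:M + t *: z) = 1) ->
  linked (rotation ((1%:M + z) *m gam)) (rotation gam).
Proof.
move=> g1 zz dz.
(* z has square zero, so that 1 + z has inverse 1 - z *)
have gE : gam = (1%:M - z) *m ((1%:M + z) *m gam).
  by rewrite mulmxA mulmxDr mulmx1 mulmxBl mul1mx zz subr0 subrK mul1mx.
rewrite {2}gE; apply: rotation_linked.
- by rewrite det_mulmx g1 mulr1; have := dz 1; rewrite scale1r.
- by rewrite mulmxN mulNmx zz !oppr0.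
- by move=> t; have := dz (- t); rewrite scaleNr scalerN.
Qed.

(** (0, 1; -1, 0) is the product of the elementary matrices (1, 1; 0, 1),
    (1, 0; -1, 1) and (1, 1; 0, 1), and each factor is joined to the identity by
    an affine line. *)
Lemma weyl_linked : exists gam : 'M[F]_2, [/\ \det gam = 1, gam 0 0 = 0,
  linked (rotation 1%:M) (rotation gam) & linked (rotation gam) (rotation 1%:M)].
Proof.
pose z01 : 'M[F]_2 := delta_mx 0 1; pose z10 : 'M[F]_2 := - delta_mx 1 0.
have zz01 : z01 *m z01 = 0 by rewrite /z01 mul_delta_mx_0.
have zz10 : z10 *m z10 = 0 by rewrite /z10 mulmxN mulNmx mul_delta_mx_0// !oppr0.
have d01 t : \det (1%:M + t *: z01) = 1 by rewrite det2 !mxE /=; ring.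
have d10 t : \det (1%:M + t *: z10) = 1 by rewrite det2 !mxE /=; ring.
pose g1 := (1%:M + z01) *m 1%:M; pose g2 := (1%:M + z10) *m g1.
pose g3 := (1%:M + z01) *m g2.
have dd01 : \det (1%:M + z01) = 1 by have := d01 1; rewrite scale1r.
have dd10 : \det (1%:M + z10) = 1 by have := d10 1; rewrite scale1r.
have dg1 : \det g1 = 1 by rewrite /g1 det_mulmx dd01 det1 mulr1.
have dg2 : \det g2 = 1 by rewrite /g2 det_mulmx dd10 dg1 mulr1.
have dg3 : \det g3 = 1 by rewrite /g3 det_mulmx dd01 dg2 mulr1.
have rU g : \det g = 1 -> forall i, rotation g i \in unitmx by move=> /rot_config[].
exists g3; split=> //.
- by rewrite /g3 /g2 /g1 mulmx1 !mxE sum2 !mxE !sum2 !mxE /=; ring.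
- apply: (linked_trans (rU _ dg1)); first exact: rotation_linked (det1 _ _) zz01 d01.
  apply: (linked_trans (rU _ dg2)); first exact: rotation_linked dg1 zz10 d10.
  exact: rotation_linked dg2 zz01 d01.
apply: (linked_trans (rU _ dg2)); first exact: rotation_rev_linked dg2 zz01 d01.
apply: (linked_trans (rU _ dg1)); first exact: rotation_rev_linked dg1 zz10 d10.
exact: rotation_rev_linked (det1 _ _) zz01 d01.
Qed.

End Rotations.

Variables (e : int) (w : I -> V -> int).
Local Notation q := ((p ^ #|I|)%N%:Z).
Hypotheses (e_gt0 : 0 < e) (wN : forall i, is_norm e q (w i)).
Hypothesis wPhi : forall i v, v != 0 -> w (tau i) (phiV p_gt0 D i v) = p%:Z * w i v.

Lemma special_const (gam : 'M[F]_2) : \det gam = 1 -> special p_gt0 (map_mx (@lconst F) gam).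
Proof.
move=> g1; split.
- by rewrite det_map_mx g1 rmorph1.
- by move=> i j; rewrite mxE; apply: lval_ge_const.
- by move=> i j; rewrite -map_invmx mxE; apply: lval_ge_const.
- by apply/matrixP => i j; rewrite !mxE frob_const.
Qed.

(** No lattice moves away from the fixed point and one of them comes closer. *)
Lemma contract h b : config h -> adapted_to p e w b h -> ~ minimal p_gt0 tau D e w h ->
  exists h' b', [/\ config h', adapted_to p e w b' h', linked h h', linked h' h
    & \sum_i (w i (col 1 (b' i)) - w i (col 0 (b' i))) <
      \sum_i (w i (col 1 (b i)) - w i (col 0 (b i)))].
Proof.
move=> cfg bh nm; have [hU hst hdet] := cfg.
have [j [c [cad cL cns cst]]] : exists j, exists c : 'M[K]_2,
    [/\ adapted e q (w j) c, lattice c = lattice (h j), ~~ settled e w j c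
      & startable p_gt0 tau D h j c].
  apply: contrapT => none; apply: nm => j c cad cL cns cst; apply: none.
  by exists j, c.
have [G [E [EU rot]]] := contraction D_unit tau_inj tau_trans e_gt0 wN wPhi hU hst cad cL cns cst.
have rU gam : \det gam = 1 -> forall i, rotation h E G gam i \in unitmx.
  move=> g1 i; rewrite /rotation; case: ifP => _ //.
  by rewrite !unitmx_mul EU unitmx_inv EU hU (special_unitmx (special_const g1)).
have rdet gam i : \det gam = 1 -> \det (rotation h E G gam i) = \det (h i).
  move=> g1; rewrite /rotation; case: ifP => _ //.
  rewrite !det_mulmx det_inv det_map_mx g1 rmorph1 mulr1 mulfV ?mul1r//.
  by rewrite -unitmx_det_neq0.
have rcfg gam : \det gam = 1 -> config (rotation h E G gam).
  move=> g1; split; first exact: rU.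
    by have [] := rot _ (special_const g1).
  by move=> i; rewrite !rdet.
have [gam [g1 g00 lk kl]] := weyl_linked EU rcfg.
have r1 i : rotation h E G 1%:M i = h i.
  by rewrite /rotation map_mx1 mulmx1 mulmxV ?mul1mx//; case: ifP.
have rh : rotation h E G 1%:M = h by apply/funext.
rewrite rh in lk kl.
have [_ bound strict] := rot _ (special_const g1).
have {}strict : forall v, lattice (rotation h E G gam j) v -> v != 0 -> w j (col 0 c) < w j v.
  by apply: strict; rewrite mxE g00 rmorph0.
have {}bound i a : (forall v, lattice (h i) v -> v != 0 -> a <= w i v) ->
    forall v, lattice (rotation h E G gam i) v -> v != 0 -> a <= w i v by apply: bound.
set h' := rotation h E G gam in lk kl strict bound *.
have hU' : forall i, h' i \in unitmx by apply: rU.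
have [b' bh'] := adapted_to_exists e_gt0 wN hU'.
exists h', b'; split=> //; first exact: rcfg.
have S i : w i (col 0 (b i)) + w i (col 1 (b i)) = w i (col 0 (b' i)) + w i (col 1 (b' i)).
  by apply: (adapted_volume wN hU hU' bh bh'); rewrite rdet.
have le i : w i (col 0 (b i)) <= w i (col 0 (b' i)).
  have [[bad bL] [bad' bL']] := (bh i, bh' i).
  apply: (bound i); last exact: adapted0 bad'.
    by move=> v; rewrite -bL; apply: (adapted_min e_gt0 (wN i) bad).
  by rewrite -bL'; apply: lattice_col.
have cb : w j (col 0 c) = w j (col 0 (b j)).
  have [bad bL] := bh j; apply/eqP; rewrite eq_le; apply/andP; split.
    apply: (adapted_min e_gt0 (wN j) cad); last exact: adapted0 bad.
    by rewrite cL -bL; apply: lattice_col.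
  apply: (adapted_min e_gt0 (wN j) bad); last exact: adapted0 cad.
  by rewrite bL -cL; apply: lattice_col.
have lt : w j (col 0 (b j)) < w j (col 0 (b' j)).
  rewrite -cb; have [bad' bL'] := bh' j.
  by apply: strict; [rewrite -bL'; apply: lattice_col|exact: adapted0 bad'].
have red (x y x' y' : int) : x + y = x' + y' -> x <= x' -> y' - x' <= y - x.
  by lia.
have red' (x y x' y' : int) : x + y = x' + y' -> x < x' -> y' - x' < y - x.
  by lia.
rewrite (bigD1 j)//= [ltRHS](bigD1 j)//=; apply: ltr_leD; first exact: red' (S j) lt.
by apply: ler_sum => i _; apply: red (S i) (le i).
Qed.

(** The sum of the distances to the fixed points, which is a nonnegative integer,
    decreases with every contraction. *)
Lemma reach_minimal (k : nat) (h b : I -> 'M[K]_2) : config h -> adapted_to p e w b h ->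
    \sum_i (w i (col 1 (b i)) - w i (col 0 (b i))) < k%:Z ->
  exists h', [/\ config h', minimal p_gt0 tau D e w h', linked h h' & linked h' h].
Proof.
elim: k h b => [|k IH] h b cfg bh hk.
  exfalso; move: hk; apply/negP; rewrite -leNgt; apply: sumr_ge0 => i _.
  by rewrite subr_ge0; apply/ltW/(adapted_lt (bh i).1).
case: (pselect (minimal p_gt0 tau D e w h)) => [hm|nm].
  by exists h; split=> //; apply: linked_refl.
have [h1 [b1 [cfg1 bh1 l1 l1' lt]]] := contract cfg bh nm.
have lt' : \sum_i (w i (col 1 (b1 i)) - w i (col 0 (b1 i))) < k%:Z.
  by apply: lt_le_trans lt _; rewrite -ltzD1 addrC; apply: hk.
have [h2 [cfg2 hm2 l2 l2']] := IH h1 b1 cfg1 bh1 lt'.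
have [h1U _ _] := cfg1.
by exists h2; split=> //; apply: (linked_trans h1U).
Qed.

(** The differences of the valuations for two configurations are multiplied by
    p from one index to the next, hence by q > 1 around the cycle. *)
Lemma config_det_unique h h' : (1 < p)%N -> config h -> config h' ->
  forall i, lval (\det (h i)) = lval (\det (h' i)).
Proof.
move=> p1 [_ _ d] [_ _ d'] i.
pose del i := lval (\det (h i)) - lval (\det (h' i)).
have step l : del (tau l) = p%:Z * del l.
  have := d l; have := d' l; rewrite /del mulrBr.
  move: (lval (\det (h (tau l)))) (lval (\det (h' (tau l)))) (lval (\det (h l))) (lval (\det (h' l))).
  by move=> a b c f E1 E2; lia.
have steps m : del (iter m tau i) = (p ^ m)%N%:Z * del i.
  elim: m => [|m IH]; first by rewrite mul1r.
  by rewrite iterS step IH expnS PoszM mulrA.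
have := steps #|I|; rewrite iter_cycle// => E.
have n0 := card_cycle_gt0 i.
have P1 : (1 < p ^ #|I|)%N by rewrite -{1}(exp1n #|I|) ltn_exp2r.
have : del i = 0.
  apply/eqP; move: E => /eqP; rewrite -subr_eq0 -{1}[del i]mul1r -mulrBl mulf_eq0.
  by case/orP => // /eqP E1; lia.
by move/eqP; rewrite subr_eq0 => /eqP.
Qed.

Lemma kisin_connected : (1 < p)%N -> connected C.
Proof.
move=> p1 B [x Bx] Bo Bc; have Bcl : clopen_in B by split.
have BC y : B y -> C y by case: Bo => U _ -> [].
have reach y : C y -> exists h, [/\ config h, minimal p_gt0 tau D e w h,
    (forall z, Pts z h -> B y -> B z) & (forall z, Pts z h -> B z -> B y)].
  move=> Cy; have [h cfg rep] := kisin_config_of thetaP p_gt0 sigmaP tauK A_unit Cy.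
  have [hU _ _] := cfg.
  have [b bh] := adapted_to_exists e_gt0 wN hU.
  pose s := \sum_i (w i (col 1 (b i)) - w i (col 0 (b i))).
  have [|h' [cfg' hm' l l']] := @reach_minimal (absz s).+1 h b cfg bh; first by rewrite -/s; lia.
  exists h'; split=> // z zh'; first exact: l Bcl _ _ rep zh'.
  exact: l' Bcl _ _ zh' rep.
apply/seteqP; split=> // y Cy.
have [h [cfg hm xh _]] := reach x (BC x Bx); have [h' [cfg' hm' _ yh']] := reach y Cy.
have [[hU hst _] [hU' hst' _]] := (cfg, cfg').
have [z zh] := represents_exists thetaP hU; have [z' zh'] := represents_exists thetaP hU'.
apply: (yh' z' zh'); have -> : z' = z; last exact: xh.
apply: (represents_inj zh' zh) => i; symmetry.
apply: (minimal_unique D_unit tau_inj tau_trans e_gt0 wN wPhi hU hU' hst hst') => //.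
exact: config_det_unique.
Qed.

End Connectedness.

Theorem theorem1p1 (p : nat)
  (k : finFieldType) (kp : p \in [pchar k])
  (F : closedFieldType) (Fp : p \in [pchar F])
  (Fclosure : is_algebraic_closure_Fp Fp)
  (T : comNzRingType) (iF : {rmorphism F -> T}) (iK : {rmorphism k -> T})
  (Ttensor : is_tensor_product iF iK)
  (phi : {rmorphism T -> T}) (phiP : is_coef_frobenius p iF iK phi)
  (theta : 'I_(degree_Fp kp) -> {rmorphism T -> F})
  (thetaP : is_identification iF theta)
  (nu : cocharacter (degree_Fp kp)) (nu_dominant : dominant nu)
  (A : 'M[laurent T]_2) (A_unit : A \in unitmx)
  (A_simple : simple_phi_module p phi A) :
  connected (kisin_variety theta p phi nu A).
Proof.
have p_gt1 : (1 < p)%N := prime_gt1 (pcharf_prime kp).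
have p_gt0 : (0 < p)%N := ltnW p_gt1.
have [phiF _] := phiP.
have [sigma sigmaP] := phi_shift thetaP phiF.
have orbit := simple_shift_orbit thetaP p_gt0 sigmaP A_simple.
have sigma_inj := fconnect_injective orbit.
pose tau := finv sigma.
have tauK : cancel tau sigma := f_finv sigma_inj.
have sigmaK : cancel sigma tau := finv_f sigma_inj.
have tau_trans i j : fconnect tau i j by rewrite same_fconnect_finv.
have D_unit := twisted_unitmx thetaP tau nu A_unit.
have no_line (l : 'I_(degree_Fp kp) -> 'cV[laurent F]_2) : (forall i, l i != 0) ->
    ~ (forall i, exists x, phiV p_gt0 (twisted theta tau nu A) i (l i) = x *: l (tau i)).
  move=> ln0 lP; apply: (simple_no_line thetaP (p_gt0 := p_gt0) sigmaP A_simple ln0) => i.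
  have [x] := lP (sigma i); rewrite /phiV /twisted sigmaK -scalemxAl => E.
  exists (lmono F (nu i).2 * x); rewrite -scalerA -E scalerA -lmonoD subrr.
  by rewrite lmono0 scale1r.
have [i0 _] := index_exists thetaP.
have [w [wN wPhi]] := system_norm p_gt1 D_unit (can_inj tauK) tau_trans no_line i0.
apply: (kisin_connected thetaP sigmaP tauK sigmaK tau_trans A_unit _ wN wPhi p_gt1).
have q1 := q_gt1 p_gt1 i0.
by rewrite mulr_gt0 ?subr_gt0 ?ltz_nat//; lia.
Qed.
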